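(* Let $\ell\ge2$ and let $$\dot{\mathfrak g}=\left\{\begin{pmatrix}a&b\\c&-a^T\end{pmatrix}\in M_{4\ell}(\mathbb C)\ \Big|\ b^T=-b,\ c^T=-c\right\}$$ ($a,b,c$ being $2\ell\times2\ell$ blocks), the simple Lie algebra of type $D_{2\ell}$. Put $$\sigma_0=\mathrm{Ad}\Big(\sum_{i=1}^{4\ell}(-1)^iE_{i,4\ell+1-i}\Big),\quad \sigma_1=\mathrm{Ad}\Big(\sum_{i=1}^{2\ell}\big((-1)^iE_{i,4\ell+1-i}-(-1)^iE_{2\ell+i,2\ell+1-i}\big)\Big).$$ Then $\dot{\mathfrak g}_{(\overline0,\overline0)}$ is the simple Lie algebra of type $C_\ell$; each of the three spaces $\dot{\mathfrak g}_{(\overline0,\overline1)},\dot{\mathfrak g}_{(\overline1,\overline0)},\dot{\mathfrak g}_{(\overline1,\overline1)}$ is, as a $\dot{\mathfrak g}_{(\overline0,\overline0)}$-module, the direct sum of a 1-dimensional trivial and a $(2\ell^2-\ell-1)$-dimensional irreducible representation; and the set $R$ of non-isotropic roots of the twisted 2-toroidal Lie algebra $\mathfrak g(\sigma_0,\sigma_1)$ is the extended affine root system $C_\ell^{(2,2)}$: $$R=\{\alpha+m\delta_0+n\delta_1\mid\alpha\in R(C_\ell)\text{ short},\ m,n\in\mathbb Z\}\cup\{\alpha+2m\delta_0+2n\delta_1\mid\alpha\in R(C_\ell)\text{ long},\ m,n\in\mathbb Z\},$$ where $R(C_\ell)$ is the root system of $\dot{\mathfrak g}_{(\overline0,\overline0)}$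 with respect to its Cartan subalgebra $\dot{\mathfrak h}_{\overline0}$.
   Context: $E_{ij}$ are matrix units and $\mathrm{Ad}(A)(X)=AXA^{-1}$. Work over $\mathbb C$. Let $\dot{\mathfrak g}$ be a simple finite-dimensional Lie algebra with Killing form $(\cdot,\cdot)$, and $\sigma_0,\sigma_1$ commuting automorphisms of finite orders $n_0,n_1$ (order 1 allowed). Put $\epsilon_j=\exp(2\pi i/n_j)$ and, for $p,q\in\mathbb Z$, $\dot{\mathfrak g}_{(\overline p,\overline q)}=\{g\in\dot{\mathfrak g}\mid\sigma_0(g)=\epsilon_0^p g,\ \sigma_1(g)=\epsilon_1^q g\}$, where $\overline p=p \bmod n_0$, $\overline q=q\bmod n_1$. Let $\mathcal R=\mathbb C[t_0^{\pm1},t_1^{\pm1}]$, $\mathcal K=\Omega^1_{\mathcal R}/d\mathcal R$, $k_i=t_i^{-1}dt_i$, and let $\mathcal K(\Sigma)\subset\mathcal K$ be spanned by the elements $t_0^{n_0a}t_1^{n_1b}k_i$ ($a,b\in\mathbb Z$, $i=0,1$). The twisted 2-toroidal Lie algebra is $$\mathfrak g(\sigma_0,\sigma_1)=\bigoplus_{m,n\in\mathbb Z}\dot{\mathfrak g}_{(\overline m,\overline n)}\otimes t_0^mt_1^n\ \oplus\ \mathcal K(\Sigma)\ \oplus\ \mathbb Cd_0\oplus\mathbb Cd_1,$$ with bracket $[g_1\otimes f_1,g_2\otimes f_2]=[g_1,g_2]\otimes f_1f_2+(g_1,g_2)f_2\,df_1$; $\mathcal K(\Sigma)$ commutes with itself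 and with all $g\otimes f$; $d_j=t_j\partial/\partial t_j$ acts by $[d_j,g\otimes t_0^{r_0}t_1^{r_1}]=r_j\,g\otimes t_0^{r_0}t_1^{r_1}$, $[d_j,t_0^{r_0}t_1^{r_1}k_i]=r_j\,t_0^{r_0}t_1^{r_1}k_i$; and $[d_0,d_1]=0$. Let $\dot{\mathfrak h}_{\overline 0}$ be a Cartan subalgebra of the reductive algebra $\dot{\mathfrak g}_{(\overline 0,\overline 0)}$ and $\mathfrak h=\dot{\mathfrak h}_{\overline 0}\oplus\mathbb Cd_0\oplus\mathbb Cd_1\oplus\mathbb Ck_0\oplus\mathbb Ck_1$. Elements of $\dot{\mathfrak h}_{\overline 0}^*$ are extended to $\mathfrak h$ by $0$ on all $d_i,k_i$; $\delta_i\in\mathfrak h^*$ is defined by $\delta_i(d_j)=\delta_{ij}$ and zero on $\dot{\mathfrak h}_{\overline 0}$ and all $k_j$. Let $V=\dot{\mathfrak h}_{\overline 0}^*\oplus\mathbb C\delta_0\oplus\mathbb C\delta_1$ with the bilinear form $(\cdot,\cdot)_V$ which on $\dot{\mathfrak h}_{\overline 0}^*$ is dual to the restriction of the Killing form to $\dot{\mathfrak h}_{\overline 0}$ and has $\delta_0,\delta_1$ in its radical. Then $R$ is the set of $\beta\in V$ with $(\beta,\beta)_V\ne0$ whose weight space in $\mathfrak g(\sigma_0,\sigma_1)$ under the adjoint action of $\mathfrak h$ is nonzero. *)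

(* Defs.v *)
From HB Require Import structures.
From mathcomp Require Import all_boot all_order all_algebra.
From mathcomp Require Import complex finmap.
From mathcomp Require Import boolp classical_sets functions cardinality fsbigop.
From mathcomp Require Import reals trigo.

(* The complex numbers are [R[i]] for an arbitrary R : realType. *)

Set Implicit Arguments.
Unset Strict Implicit.
Unset Printing Implicit Defensive.

Import Order.TTheory GRing.Theory Num.Theory.

Local Open Scope classical_set_scope.
Local Open Scope ring_scope.

(* [finsupp I V] is the direct sum of copies of V indexed by I.  With
   I = int * int and (m, n) read as t_0^m t_1^n, it is V (x) C[t_0^±1, t_1^±1]. *)

Section FinSupp.
Variables (K : nzRingType) (I : choiceType) (V : lmodType K).

Definition supp (f : I -> V) : set I := [set i | f i != 0].

Definition has_finsupp : {pred (I -> V)} := fun f => `[< finite_set (supp f) >].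

Lemma has_finsupp_submod_closed : submod_closed has_finsupp.
Proof.
split=> [|a f g].
  apply/asboolP; suff -> : supp (0 : I -> V) = set0 by exact: finite_set0.
  by apply/seteqP; split=> i //=; rewrite /supp /= eqxx.
move=> /asboolP Ff /asboolP Fg; apply/asboolP.
apply: (@sub_finite_set _ _ (supp f `|` supp g)); last by rewrite finite_setU.
move=> i; rewrite /supp /= !fctE => nz.
have [f0|/negP f0] := boolP (f i == 0); last by left; apply/negP.
by right; move: nz; rewrite (eqP f0) scaler0 add0r.
Qed.

HB.instance Definition _ :=
  GRing.isSubmodClosed.Build K (I -> V) has_finsupp has_finsupp_submod_closed.

Record finsupp := Finsupp { fs_val :> I -> V; fs_valP : fs_val \in has_finsupp }.

HB.instance Definition _ := [isSub for fs_val].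
HB.instance Definition _ := [Choice of finsupp by <:].
HB.instance Definition _ := [SubChoice_isSubLmodule of finsupp by <:].

Definition single_fun (i : I) (v : V) : I -> V := fun j => if j == i then v else 0.

Lemma single_finsupp i v : single_fun i v \in has_finsupp.
Proof.
apply/asboolP; apply: (@sub_finite_set _ _ [set i]); last exact: finite_set1.
by move=> j; rewrite /supp /single_fun /=; case: (j =P i); rewrite ?eqxx.
Qed.

(* v (x) t^i *)
Definition single i v : finsupp := Finsupp (single_finsupp i v).

(* The extension by additivity of a map given on the elements v (x) t^i. *)
Definition fs_sum (T : nmodType) (F : I -> V -> T) (f : finsupp) : T :=
  \sum_(i \in supp f) F i (f i).

End FinSupp.

Lemma fs_finite (K : nzRingType) (I : choiceType) (V : lmodType K)
  (f : finsupp I V) : finite_set (supp f).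
Proof. exact/asboolP/(fs_valP f). Qed.

Section FinSuppTheory.
Variables (K : nzRingType) (I : choiceType) (V : lmodType K).
Implicit Types f g : finsupp I V.

Lemma finsuppP f g : f =1 g -> f = g.
Proof. by move=> fg; apply: val_inj; apply/funext. Qed.

Lemma fs_addE f g i : (f + g) i = f i + g i.
Proof. by []. Qed.

Lemma fs_oppE f i : (- f) i = - f i.
Proof. by []. Qed.

Lemma fs_scaleE a f i : (a *: f) i = a *: f i.
Proof. by []. Qed.

End FinSuppTheory.

Lemma fs_map_sumE (K : nzRingType) (I : choiceType) (V W : lmodType K)
    (F : I -> V -> W) (f : finsupp I V) (j : I) : F j 0 = 0 ->
  fs_sum (fun i v => single i (F i v)) f j = F j (f j).
Proof.
move=> F0; rewrite /fs_sum fsbig_finite /=; last exact: fs_finite.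
rewrite (_ : fs_val _ j =
    \sum_(i <- fset_set (supp f)) (single i (F i (f i)) : I -> W) j); last first.
  by elim: (enum_fset _) => [|i e IH]; rewrite ?big_nil // !big_cons -IH.
have [fj0|fj] := eqVneq (f j) 0; last first.
  rewrite (bigD1_seq j) //= ?big1 ?addr0 ?fset_uniq /single_fun ?eqxx //.
    by move=> i ij; rewrite eq_sym (negPf ij).
  by rewrite in_fset_set ?inE //; exact: fs_finite.
rewrite big1_seq ?fj0 // => i; rewrite in_fset_set; last exact: fs_finite.
rewrite andTb inE /supp /= /single_fun => fi.
by case: eqP => // ji; move: fi; rewrite -ji fj0 eqxx.
Qed.

(* Lie algebras are subspaces of a matrix algebra, with the commutator as bracket. *)
Section LinearLie.
Variables (F : fieldType) (N : nat).
Local Notation M := 'M[F]_N.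
Implicit Types (U W I H : {vspace M}) (x y : M).

Definition comm x y : M := x *m y - y *m x.

(* [U, W], the span of all brackets *)
Definition lie_prod U W : {vspace M} :=
  <<[seq comm x y | x <- vbasis U, y <- vbasis W]>>%VS.

Definition is_subalgebra U := {in U &, forall x y, comm x y \in U}.

(* W is a submodule of the ambient adjoint module under U. *)
Definition stable_under U W := {in U & W, forall x w, comm x w \in W}.

Definition is_trivial_module U W := {in U & W, forall x w, comm x w = 0}.

Definition is_irreducible_module U W :=
  [/\ stable_under U W, W <> 0%VS &
      forall W', (W' <= W)%VS -> stable_under U W' -> W' = 0%VS \/ W' = W].

Definition is_simple_lie U :=
  [/\ is_subalgebra U,
      exists x y, [/\ x \in U, y \in U & comm x y != 0] &
      forall I, (I <= U)%VS -> stable_under U I -> I = 0%VS \/ I = U].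

Definition is_nilpotent_lie H := exists n, iter n (lie_prod H) H = 0%VS.

Definition is_cartan U H :=
  [/\ (H <= U)%VS, is_subalgebra H, is_nilpotent_lie H &
      forall x, x \in U -> {in H, forall h, comm x h \in H} -> x \in H].

(* For x, y in U, the trace of (ad x) (ad y) on U *)
Definition killing U x y : F :=
  \sum_(i < \dim U) coord (vbasis U) i (comm x (comm y (vbasis U)`_i)).

Definition dual H := 'Hom(subvs_of H, F^o).

(* h |-> (h, _), the map from H to its dual defined by the Killing form of U *)
Definition killing_map U H : 'Hom(subvs_of H, dual H) :=
  linfun (fun h : subvs_of H =>
    (linfun (fun h' : subvs_of H => killing U (vsval h) (vsval h') : F^o) : dual H)).

(* The form on the dual of H transported from the restriction to H of the
   Killing form of U (this restriction is nondegenerate for the H used below,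
   so that the inverse of [killing_map] is a genuine inverse). *)
Definition dual_form U H (a b : dual H) : F :=
  let h := ((killing_map U H)^-1)%VF in
  killing U (vsval (h a)) (vsval (h b)).

Local Arguments dual_form U H a b : clear implicits.

Definition lie_roots U H : set (dual H) :=
  [set a | a != 0 /\ exists x, [/\ x \in U, x != 0 &
     forall h : subvs_of H, comm (vsval h) x = (a h : F) *: x]].

Local Arguments lie_roots U H a : clear implicits.

(* Cartan matrix of type C_l: the last simple root is the long one, and the
   entry (i, j) is 2 (a_i, a_j) / (a_j, a_j). *)
Definition cartan_matrix_C (l : nat) : 'M[int]_l :=
  \matrix_(i < l, j < l)
    (if i == j then 2
     else if (i == j.+1 :> nat) && (i.+1 == l) then - 2
     else if (i == j.+1 :> nat) || (j == i.+1 :> nat) then - 1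
     else 0).

(* The root system of U with respect to H has a base whose Cartan matrix is
   of type C_l. *)
Definition has_root_type_C U H (l : nat) :=
  exists a : 'I_l -> dual H,
  [/\ basis_of fullv (codom a),
      forall i, lie_roots U H (a i),
      forall b, lie_roots U H b -> exists k : 'I_l -> nat,
        b = \sum_i a i *+ k i \/ b = - \sum_i a i *+ k i &
      forall i j, 2 * dual_form U H (a i) (a j) / dual_form U H (a j) (a j)
                  = (cartan_matrix_C l i j)%:~R].

End LinearLie.

Arguments dual_form {F N} U H a b.
Arguments lie_roots {F N} U H _.

Section RootLength.
Variables (R : realType) (N : nat) (U H : {vspace 'M[R[i]]_N}).

(* Roots of minimal, resp. maximal, length.  In R[i], x <= y means that y - x
   is a nonnegative real. *)
Definition short_roots : set (dual H) :=
  [set a | lie_roots U H a /\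
     forall b, lie_roots U H b -> dual_form U H a a <= dual_form U H b b].

Definition long_roots : set (dual H) :=
  [set a | lie_roots U H a /\
     forall b, lie_roots U H b -> dual_form U H b b <= dual_form U H a a].

End RootLength.

Arguments short_roots {R N} U H _.
Arguments long_roots {R N} U H _.

(* The degree (m, n) of the monomial t_0^m t_1^n *)
Notation deg := (int * int)%type.

Section Toroidal.
Variable R : realType.
Local Notation C := R[i].
Local Notation C2 := (C^o * C^o)%type.
Local Open Scope quotient_scope.

Definition deg_vec (r : deg) : C2 := (r.1%:~R, r.2%:~R).

Definition pairing (c : C2) (r : deg) : C := c.1 * r.1%:~R + c.2 * r.2%:~R.

Local Notation laurent := (finsupp deg C^o).

(* Omega^1 is free over the Laurent polynomials with basis
   k_i = t_i^-1 dt_i; the value (u, v) at r stands for t^r (u k_0 + v k_1). *)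
Local Notation Omega := (finsupp deg C2).

(* d (t^r) = t^r (r_0 k_0 + r_1 k_1) *)
Definition diff (f : laurent) : Omega :=
  fs_sum (fun r (u : C^o) => single r ((u : C) *: deg_vec r)) f.

Lemma diffE f r : diff f r = (f r : C) *: deg_vec r.
Proof. by apply: fs_map_sumE; rewrite scale0r. Qed.

Definition exact_forms : {pred Omega} := fun w => `[< exists f, w = diff f >].

Lemma exact_forms_lin a w w' : w \in exact_forms -> w' \in exact_forms ->
  a *: w + w' \in exact_forms.
Proof.
move=> /asboolP[f ->] /asboolP[g ->]; apply/asboolP; exists (a *: f + g).
apply/finsuppP => r.
rewrite diffE fs_addE fs_scaleE !diffE fs_addE fs_scaleE.
by rewrite scalerDl scalerA.
Qed.

Lemma exact_forms0 : 0 \in exact_forms.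
Proof.
apply/asboolP; exists 0; apply/finsuppP => r.
by rewrite diffE scale0r.
Qed.

Lemma exact_forms_zmod : zmod_closed exact_forms.
Proof.
split=> [|w w' ew ew']; first exact: exact_forms0.
by rewrite addrC -scaleN1r exact_forms_lin.
Qed.

HB.instance Definition _ :=
  GRing.isZmodClosed.Build Omega exact_forms exact_forms_zmod.

(* K = Omega^1 / d R.  [Quotient.quot] only yields a zmodType, hence the
   instance below. *)
Definition Kdiff := Quotient.quot exact_forms.

HB.instance Definition _ := GRing.Zmodule.on Kdiff.

Definition cls (w : Omega) : Kdiff := \pi_(Quotient.quot exact_forms) w.

Lemma clsK (z : Kdiff) : cls (repr z) = z.
Proof. exact: reprK. Qed.

Lemma clsP w w' : reflect (cls w = cls w') (w - w' \in exact_forms).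
Proof. by rewrite Quotient.idealrBE; exact: eqP. Qed.

Lemma clsD w w' : cls (w + w') = cls w + cls w'.
Proof. exact: raddfD. Qed.

Definition Kscale (a : C) (z : Kdiff) : Kdiff := cls (a *: repr z).

Lemma Kscale_cls a w : Kscale a (cls w) = cls (a *: w).
Proof.
apply/clsP; rewrite -scalerBr -[X in X \in _]addr0 exact_forms_lin ?exact_forms0 //.
by apply/clsP; rewrite clsK.
Qed.

Lemma KscaleA a b z : Kscale a (Kscale b z) = Kscale (a * b) z.
Proof. by rewrite -[z]clsK !Kscale_cls scalerA. Qed.

Lemma Kscale1 : left_id 1 Kscale.
Proof. by move=> z; rewrite -[z]clsK Kscale_cls scale1r. Qed.

Lemma KscaleDr : right_distributive Kscale +%R.
Proof.
move=> a x y; rewrite -[x]clsK -[y]clsK.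
by rewrite -clsD !Kscale_cls scalerDr clsD.
Qed.

Lemma KscaleDl z : {morph Kscale^~ z : a b / a + b}.
Proof. by move=> a b; rewrite -[z]clsK !Kscale_cls scalerDl clsD. Qed.

HB.instance Definition _ := GRing.Zmodule_isLmodule.Build C Kdiff
  KscaleA Kscale1 KscaleDr KscaleDl.

(* The action of the derivation c_0 d_0 + c_1 d_1 on V (x) C[t_0^±1, t_1^±1] *)
Definition deriv_act (V : lmodType C) (c : C2) (f : finsupp deg V) : finsupp deg V :=
  fs_sum (fun r v => single r (pairing c r *: v)) f.

Lemma deriv_actE V c (f : finsupp deg V) r : deriv_act c f r = pairing c r *: f r.
Proof. by apply: (fs_map_sumE (F := fun r v => _)); rewrite scaler0. Qed.

(* The choice of representative is immaterial, see [Kderiv_act_cls]. *)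
Definition Kderiv_act (c : C2) (z : Kdiff) : Kdiff := cls (deriv_act c (repr z)).

Lemma Kderiv_act_cls c w : Kderiv_act c (cls w) = cls (deriv_act c w).
Proof.
apply/clsP; have /clsP/asboolP[f ef] : cls (repr (cls w)) = cls w by exact: clsK.
apply/asboolP; exists (deriv_act c f); apply/finsuppP => r.
rewrite diffE fs_addE fs_oppE !deriv_actE -scalerBr -fs_oppE -fs_addE ef.
by rewrite diffE scalerA.
Qed.

Variable N : nat.
Local Notation M := 'M[C]_N.
Implicit Types (g : {vspace M}) (s : M -> M).

(* M (x) C[t_0^±1, t_1^±1] + K + C d_0 + C d_1; the twisted toroidal algebra
   is the subspace [in_toroidal] of it. *)
Definition toroidal := (finsupp deg M * Kdiff * C2)%type.

(* [x t^a, y t^b] = [x, y] t^(a + b) + (x, y) t^b d(t^a) and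
   t^b d(t^a) = t^(a + b) (a_0 k_0 + a_1 k_1); the d_i act by derivations. *)
Definition tor_bracket g (X Y : toroidal) : toroidal :=
  let: (f, z, c) := X in let: (f', z', c') := Y in
  ( fs_sum (fun a x => fs_sum (fun b y => single (a + b) (comm x y)) f') f
      + deriv_act c f' - deriv_act c' f,
    cls (fs_sum (fun a x => fs_sum (fun b y =>
           single (a + b) (killing g x y *: deg_vec a)) f') f)
      + Kderiv_act c z' - Kderiv_act c' z,
    0 ).

(* exp (2 pi i / n) *)
Definition root_of_unity (n : nat) : C :=
  (cos (2 * pi / n%:R) +i* sin (2 * pi / n%:R))%C.

(* The order of the automorphism s of g: the least n > 0 with s^n = id on g *)
Definition aut_order g s : nat :=
  xget 0%N [set n | [/\ (0 < n)%N, {in g, iter n s =1 id} &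
     forall m, (0 < m)%N -> {in g, iter m s =1 id} -> (n <= m)%N]].

Definition grading g s0 s1 (p q : int) : {vspace M} :=
  (g :&: passmx.leigenspace (linfun s0) (root_of_unity (aut_order g s0) ^ p)
     :&: passmx.leigenspace (linfun s1) (root_of_unity (aut_order g s1) ^ q))%VS.

(* K(Sigma), the span of the classes of the t_0^(n_0 a) t_1^(n_1 b) k_i *)
Definition in_Ksigma g s0 s1 (z : Kdiff) :=
  exists2 w : Omega, z = cls w &
    forall r, w r != 0 ->
      ((aut_order g s0)%:Z %| r.1)%Z && ((aut_order g s1)%:Z %| r.2)%Z.

Definition in_toroidal g s0 s1 (X : toroidal) :=
  (forall m n, X.1.1 (m, n) \in grading g s0 s1 m n) /\ in_Ksigma g s0 s1 X.1.2.

(* The element h + c_0 d_0 + c_1 d_1 + e_0 k_0 + e_1 k_1 *)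
Definition tor_cartan (h : M) (c e : C2) : toroidal :=
  (single 0 h, cls (single 0 e), c).

(* V = H^* + C delta_0 + C delta_1 *)
Definition weights (H : {vspace M}) := (dual H * C2)%type.

Definition weight_of H (a : dual H) : weights H := (a, 0).
Definition delta0 H : weights H := (0, (1, 0)).
Definition delta1 H : weights H := (0, (0, 1)).

Definition weight_form g H (b b' : weights H) : C := dual_form g H b.1 b'.1.

Definition weight_eval H (b : weights H) (h : subvs_of H) (c : C2) : C :=
  b.1 h + b.2.1 * c.1 + b.2.2 * c.2.

Definition toroidal_roots g s0 s1 H : set (weights H) :=
  [set b | weight_form g b b != 0 /\
     exists X, [/\ in_toroidal g s0 s1 X, X != 0 &
       forall h c e, tor_bracket g (tor_cartan (vsval h) c e) X
                     = weight_eval b h c *: X]].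

End Toroidal.

Arguments toroidal_roots {R N} g s0 s1 H _.
Arguments delta0 {R N} H.
Arguments delta1 {R N} H.

Section TypeD.
Variables (R : realType) (l : nat).
Local Notation C := R[i].
Local Notation M := 'M[C]_(2 * l + 2 * l).

Definition Ad (A : M) (X : M) : M := A *m X *m invmx A.

Definition so_defect (X : M) : 'M[C]_(2 * l) * 'M[C]_(2 * l) * 'M[C]_(2 * l) :=
  (drsubmx X + (ulsubmx X)^T, (ursubmx X)^T + ursubmx X,
   (dlsubmx X)^T + dlsubmx X).

Lemma so_defect_linear : linear so_defect.
Proof.
move=> a X Y; congr (_, _, _);
  by apply/matrixP => i j; rewrite !mxE mulrDr addrACA.
Qed.

HB.instance Definition _ :=
  GRing.isLinear.Build C M _ *:%R so_defect so_defect_linear.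

Definition so_algebra : {vspace M} := lker (linfun so_defect).

Lemma so_algebraP X : reflect
  (exists a b c, [/\ X = block_mx a b c (- a^T), b^T = - b & c^T = - c])
  (X \in so_algebra).
Proof.
rewrite memv_ker lfunE /=; apply: (iffP eqP).
  case=> h1 h2 h3; exists (ulsubmx X), (ursubmx X), (dlsubmx X).
  split; [|by apply/eqP; rewrite -addr_eq0; apply/eqP..].
    by move/eqP: h1; rewrite addr_eq0 => /eqP <-; rewrite submxK.
case=> a [b [c [-> hb hc]]]; rewrite /so_defect.
by rewrite block_mxKul block_mxKur block_mxKdl block_mxKdr hb hc !addNr.
Qed.

(* Indices start at 0 here: E_(i, 4l+1-i) is [delta_mx i' (rev_ord i')], i' = i - 1. *)
Definition sigma0 : M -> M :=
  Ad (\sum_(i < 2 * l + 2 * l) (-1) ^+ i.+1 *: delta_mx i (rev_ord i)).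

Definition sigma1 : M -> M :=
  Ad (\sum_(i < 2 * l)
        ((-1) ^+ i.+1 *: delta_mx (lshift (2 * l) i) (rshift (2 * l) (rev_ord i))
         - (-1) ^+ i.+1 *: delta_mx (rshift (2 * l) i) (lshift (2 * l) (rev_ord i)))).

Definition gdot (p q : int) : {vspace M} := grading so_algebra sigma0 sigma1 p q.

End TypeD.

(* Main.v *)
(* Let S be the skew matrix with entries (-1)^i at (i, 2l+1-i) and put
   X^* = S X^T S^-1 on 2l x 2l matrices.  In block form, sigma_0 and sigma_1 are
   conjugations by [0 S; S 0] and [0 S; -S 0].  Hence the (0,0) component is
   {diag(a, -a^T) | a^* = -a}, a copy of sp_2l, and each other component is a copy
   of P = {y | y^* = y}, on which sp_2l acts by commutators.  Irreducibility of sp_2l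
   and of the traceless part of P follows by acting with the rank one elements
   v v^T S^-1.

   Let H be any Cartan subalgebra of sp_2l.  The semisimple part of h in H is an odd
   polynomial in h, so it lies in sp_2l; it commutes with H (downward induction on the
   lower central series), so it lies in H, H being self-normalizing.  By Engel's
   argument H is the full centralizer in sp_2l of its semisimple elements, so the trace
   form is nondegenerate on H.  As [H, H] consists of nilpotent matrices, this forces H
   to be abelian, and then diagonalizable.  The eigenvalues theta_i of H are
   distinct and can be numbered so that theta_(2l+1-i) = -theta_i.  The roots of sp_2l
   are the theta_i - theta_j with i <> j, and the nonzero weights of P are those with
   j <> 2l+1-i, that is the short ones.  Finally, a weight vector of the toroidal
   algebra whose weight does not vanish on H has no central and no derivation part, and
   is carried by a single degree (m, n), which depends only on the weight. *)

Require Import Defs.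
From HB Require Import structures.
From mathcomp Require Import all_boot all_order all_algebra all_fingroup.
From mathcomp Require Import complex ring zify.
From mathcomp Require Import boolp classical_sets functions cardinality fsbigop.
From mathcomp Require Import reals trigo.

Set Implicit Arguments.
Unset Strict Implicit.
Unset Printing Implicit Defensive.

Import Order.TTheory GRing.Theory Num.Theory.

Local Open Scope ring_scope.

(* Closes an identity of the additive group of matrices, with products as atoms. *)
Ltac mx_abel := repeat (let t := fresh "t" in set t := (_ *m _); clearbody t);
  apply/matrixP => ? ?; rewrite !mxE; ring.

(** [is_cartan] only says nilpotent and self-normalizing. The claim concerns every such H and not a
    chosen torus, so diagonalizability, the distinctness of the eigenvalues and their pairing by
    sign all have to be derived from these two properties. Two Killing forms occur. Root lengths
    refer to that of sp_2l, which is 2l + 2 times the trace form of 2l x 2l matrices; isotropy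
    refers to that of so_4l, which is 4l - 2 times the trace form of 4l x 4l matrices. Both come
    from one computation for the Lie algebra of a form with S^T = e S, where e is -1 or 1: the
    matrix units projected to the algebra are an overcomplete family whose coefficients are plain
    matrix entries, so that no basis has to be chosen. The even degrees of the long roots have a
    single source. In an eigenbasis of H, the matrix unit E at (i, 2l+1-i) satisfies E^* = -E
    because the form is skew, so E lies in sp_2l and its projection to P vanishes. *)

Section Frame.
Variables (F : fieldType) (vT : vectType F) (U : {vspace vT}).

(* A frame [e], [phi] is a decomposition x = sum phi_k(x) e_k valid on U; unlike
   for a basis, no linear independence is required. *)
Lemma coord_trace_frame (I : finType) (e : I -> vT) (phi : I -> {scalar vT})
    (f : {linear vT -> vT}) :
  (forall k, e k \in U) -> {in U, forall x, x = \sum_k phi k x *: e k} ->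
  {in U, forall x, f x \in U} ->
  \sum_(i < \dim U) coord (vbasis U) i (f (vbasis U)`_i) = \sum_k phi k (f (e k)).
Proof.
move=> eU decU fU.
have vbU (i : 'I_(\dim U)) : (vbasis U)`_i \in U by rewrite vbasis_mem ?mem_nth ?size_tuple.
under eq_bigr => i _ do rewrite [X in f X](decU _ (vbU i)) !linear_sum.
rewrite exchange_big /=; apply: eq_bigr => k _.
rewrite [in RHS](coord_vbasis (fU _ (eU k))) linear_sum.
by apply: eq_bigr => i _; rewrite !linearZ /= mulrC.
Qed.

(** The trace of the identity. An overcomplete family still computes the dimension, as an element of
    F. *)
Lemma dim_frame (I : finType) (e : I -> vT) (phi : I -> {scalar vT}) :
  (forall k, e k \in U) -> {in U, forall x, x = \sum_k phi k x *: e k} ->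
  (\dim U)%:R = \sum_k phi k (e k).
Proof.
move=> eU decU; rewrite -(@coord_trace_frame _ e phi idfun) //.
under eq_bigr => i _ do rewrite /= coord_free ?eqxx ?(basis_free (vbasisP U)) //.
by rewrite sumr_const card_ord.
Qed.
End Frame.

(** * The commutator bracket *)

Section Commutator.
Variables (F : fieldType) (N : nat).
Implicit Types x y z : 'M[F]_N.

Lemma comm_linear x : linear (comm x).
Proof.
by move=> a y z; rewrite /comm mulmxDr mulmxDl -scalemxAr -scalemxAl scalerBr opprD addrACA.
Qed.
HB.instance Definition _ x := GRing.isLinear.Build F 'M[F]_N 'M[F]_N *:%R (comm x) (comm_linear x).

Lemma commE x y : comm x y = x *m y - y *m x.
Proof. by []. Qed.
Lemma commC x y : comm x y = - comm y x.
Proof. by rewrite /comm opprB. Qed.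
Lemma commDl x y z : comm (x + y) z = comm x z + comm y z.
Proof. by rewrite /comm mulmxDl mulmxDr opprD addrACA. Qed.
Lemma commZl a x z : comm (a *: x) z = a *: comm x z.
Proof. by rewrite /comm -scalemxAl -scalemxAr scalerBr. Qed.
Lemma commBr x y z : comm x (y - z) = comm x y - comm x z.
Proof. exact: linearB. Qed.
Lemma commZr a x y : comm x (a *: y) = a *: comm x y.
Proof. exact: linearZ. Qed.
Lemma commx0 x : comm x 0 = 0.
Proof. exact: linear0. Qed.
Lemma comm0x x : comm 0 x = 0.
Proof. by rewrite commC commx0 oppr0. Qed.
Lemma commxx x : comm x x = 0.
Proof. exact: subrr. Qed.
Lemma comm_eq0P x y : comm x y = 0 <-> x *m y = y *m x.
Proof. by rewrite /comm; split=> [/eqP|->]; rewrite ?subrr // subr_eq0 => /eqP. Qed.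
Lemma comm_suml (I : Type) (r : seq I) (P : pred I) (f : I -> 'M[F]_N) z :
  comm (\sum_(i <- r | P i) f i) z = \sum_(i <- r | P i) comm (f i) z.
Proof. by rewrite commC linear_sum -sumrN; apply: eq_bigr => i _; rewrite -commC. Qed.
Lemma comm_diagE (d : 'rV[F]_N) x i j : comm (diag_mx d) x i j = (d 0 i - d 0 j) * x i j.
Proof. by rewrite commE mul_diag_mx mul_mx_diag !mxE mulrBl [x i j * _]mulrC. Qed.
Lemma jacobi x y z : comm x (comm y z) = comm (comm x y) z + comm y (comm x z).
Proof.
by rewrite /comm !mulmxBl !mulmxBr !mulmxA; mx_abel.
Qed.
End Commutator.

Local Opaque comm.

(** * Skew and self-adjoint matrices for a bilinear form, and their Killing form *)

Section FormAlgebra.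
Variables (F : fieldType) (n : nat) (S : 'M[F]_n).
Implicit Types X Y : 'M[F]_n.

(* The adjoint of X for the bilinear form of matrix invmx S. *)
Definition adjm X := S *m X^T *m invmx S.

Lemma adjm_linear : linear adjm.
Proof. by move=> a X Y; rewrite /adjm linearP mulmxDr mulmxDl -scalemxAr -scalemxAl. Qed.
HB.instance Definition _ := GRing.isLinear.Build F 'M[F]_n 'M[F]_n *:%R adjm adjm_linear.

(** For e = -1 this is the Lie algebra of the form, symplectic or orthogonal according to S; for e =
    1 it is the complementary module of self-adjoint matrices. *)
Definition adj_eigen (e : F) : {vspace 'M[F]_n} :=
  passmx.leigenspace (linfun adjm) e.

Lemma adj_eigenP e X : reflect (adjm X = e *: X) (X \in adj_eigen e).
Proof.
rewrite memv_ker add_lfunE opp_lfunE scale_lfunE id_lfunE lfunE /= subr_eq0.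
exact: eqP.
Qed.

Hypothesis Su : S \in unitmx.

Lemma adjmM X Y : adjm (X *m Y) = adjm Y *m adjm X.
Proof. by rewrite /adjm trmx_mul !mulmxA mulmxKV. Qed.

Lemma adjm_comm X Y : adjm (comm X Y) = - comm (adjm X) (adjm Y).
Proof. by rewrite !commE linearB /= !adjmM opprB. Qed.

(** [adjm] reverses products, so its opposite preserves brackets: its fixed points form a Lie
    algebra and its eigenspaces are modules over it. *)
Lemma comm_adj_eigen e X Y : X \in adj_eigen (-1) -> Y \in adj_eigen e ->
  comm X Y \in adj_eigen e.
Proof.
move=> /adj_eigenP hX /adj_eigenP hY; apply/adj_eigenP.
by rewrite adjm_comm hX hY commZl scaleN1r opprK linearZ.
Qed.

Lemma mxtrace_adj X : \tr (adjm X) = \tr X.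
Proof. by rewrite mxtrace_mulC mulmxA mulVmx // mul1mx mxtrace_tr. Qed.

Lemma adj_eigenN1P X : reflect (X *m S + S *m X^T = 0) (X \in adj_eigen (-1)).
Proof.
apply: (iffP (adj_eigenP _ _)); rewrite scaleN1r => h.
  by rewrite -[S *m _](mulmxKV Su) -/(adjm X) h mulNmx addrN.
rewrite /adjm (_ : S *m X^T = - (X *m S)) ?mulNmx ?mulmxK //.
by apply/eqP; rewrite -addr_eq0 addrC h.
Qed.

Variable e : F.
Hypothesis Se : S^T = e *: S.
Hypothesis ee : e * e = 1.

Lemma invmx_form : (invmx S)^T = e *: invmx S.
Proof.
rewrite trmx_inv Se; apply: (@can_inj _ _ _ _ (mulKmx (_ : e *: S \in unitmx))).
  by rewrite -Se unitmx_tr.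
rewrite mulmxV -?Se ?unitmx_tr // Se -scalemxAl -scalemxAr scalerA ee scale1r.
by rewrite mulmxV.
Qed.

Lemma adjmK X : adjm (adjm X) = X.
Proof.
rewrite /adjm !trmx_mul trmxK Se invmx_form.
rewrite -!scalemxAl -!scalemxAr !scalerA ee scale1r !mulmxA mulmxV // mul1mx.
by rewrite mulmxK.
Qed.

Hypothesis two_neq0 : 2 != 0 :> F.

Definition adj_proj c X := 2^-1 *: (X + c *: adjm X).

Lemma adj_projP c X : c * c = 1 -> adj_proj c X \in adj_eigen c.
Proof.
move=> cc; apply/adj_eigenP; rewrite /adj_proj linearZ linearD linearZ /= adjmK.
by rewrite scalerA mulrC -scalerA; congr (_ *: _); rewrite scalerDr scalerA cc scale1r addrC.
Qed.

Lemma adj_proj_id c X : c * c = 1 -> X \in adj_eigen c -> adj_proj c X = X.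
Proof.
move=> cc /adj_eigenP hX; rewrite /adj_proj hX scalerA cc scale1r -mulr2n.
by rewrite -scaler_nat scalerA mulVf // scale1r.
Qed.

Definition mxentry (k : 'I_n * 'I_n) X : F := X k.1 k.2.
Lemma mxentry_scalar k : scalar (mxentry k).
Proof. by move=> a X Y; rewrite /mxentry !mxE. Qed.
HB.instance Definition _ k :=
  GRing.isLinear.Build F 'M[F]_n F *%R (mxentry k) (mxentry_scalar k).

Lemma mxentryB k X Y : mxentry k (X - Y) = mxentry k X - mxentry k Y.
Proof. exact: linearB. Qed.
Lemma mxentryZ k a X : mxentry k (a *: X) = a * mxentry k X.
Proof. exact: linearZ. Qed.

(** Project the expansion of X in matrix units to the eigenspace that already contains X. *)
Lemma adj_eigen_frame c X : c * c = 1 -> X \in adj_eigen c ->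
  X = \sum_k mxentry k X *: adj_proj c (delta_mx k.1 k.2).
Proof.
move=> cc hX; rewrite -{1}(adj_proj_id cc hX) {1}[X]matrix_sum_delta pair_big /=.
rewrite /adj_proj [adjm _]linear_sum scaler_sumr -big_split scaler_sumr /=.
apply: eq_bigr => k _; rewrite [adjm (_ *: _)]linearZ /= [c *: (_ *: _)]scalerA.
by rewrite [c * _]mulrC -[_ *: adjm _]scalerA -scalerDr !scalerA mulrC.
Qed.

(** The trace of Z |-> A Z B on the space of all matrices. *)
Lemma sum_entry_delta (A B : 'M[F]_n) :
  \sum_k mxentry k (A *m delta_mx k.1 k.2 *m B) = \tr A * \tr B.
Proof.
rewrite /mxtrace big_distrlr pair_big /=; apply: eq_bigr => -[i j] _ /=.
rewrite /mxentry /= (_ : A *m delta_mx i j *m B = col i A *m row j B) //.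
  by rewrite mxE big_ord1 !mxE.
by rewrite colE rowE -!mulmxA; congr (A *m _); rewrite mulmxA mul_delta_mx.
Qed.

(** The trace of Z |-> A Z^* B; the sign [e] arises from transposing S. *)
Lemma sum_entry_adj_delta (A B : 'M[F]_n) :
  \sum_k mxentry k (A *m adjm (delta_mx k.1 k.2) *m B) = e * \tr (adjm A *m B).
Proof.
have -> : e * \tr (adjm A *m B) = \tr ((A *m S)^T *m (invmx S *m B)).
  by rewrite trmx_mul Se -scalemxAl -scalemxAl mxtraceZ /adjm !mulmxA.
rewrite /mxtrace; under [RHS]eq_bigr => i _ do rewrite mxE.
rewrite exchange_big pair_big /=; apply: eq_bigr => -[i j] _ /=.
rewrite /mxentry /adjm trmx_delta !mulmxA.
rewrite (_ : _ *m B = col j (A *m S) *m row i (invmx S *m B)) //.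
  by rewrite mxE big_ord1 !mxE.
by rewrite colE rowE -!mulmxA; do 2! congr (_ *m _); rewrite [RHS]mulmxA mul_delta_mx.
Qed.

Lemma dim_adj_eigen c : c * c = 1 ->
  (\dim (adj_eigen c))%:R = 2^-1 * (n%:R * n%:R + c * e * n%:R) :> F.
Proof.
move=> cc; rewrite (dim_frame (e := fun k => adj_proj c (delta_mx k.1 k.2))
    (phi := fun k => mxentry k)); last 2 first.
- by move=> k; apply: adj_projP.
- by move=> X hX; apply: adj_eigen_frame.
under eq_bigr => k _ do rewrite /adj_proj linearZ linearD linearZ /=.
rewrite -big_distrr big_split -big_distrr /=; congr (_ * (_ + _)).
  have := sum_entry_delta 1%:M 1%:M; rewrite mxtrace1 => <-.
  by apply: eq_bigr => k _; rewrite mul1mx mulmx1.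
have := sum_entry_adj_delta 1%:M 1%:M; rewrite mulmx1 mxtrace_adj mxtrace1 -mulrA => <-.
by congr (_ * _); apply: eq_bigr => k _; rewrite mul1mx mulmx1.
Qed.

Lemma mxtrace_adj_skew X : X \in adj_eigen (-1) -> \tr X = 0.
Proof.
move=> /adj_eigenP /(congr1 mxtrace); rewrite mxtrace_adj mxtraceZ mulN1r => /eqP.
by rewrite -addr_eq0 -mulr2n -mulr_natl mulf_eq0 (negPf two_neq0) => /eqP.
Qed.

(** In the frame of projected matrix units the trace is half the contribution of the units minus
    half that of their adjoints. The former is 2n tr(XY), X and Y being traceless, and the latter is
    4e tr(XY). The constant is thus n + 2 for sp_n and n - 2 for so_n. *)
Lemma killing_adj_skew X Y : X \in adj_eigen (-1) -> Y \in adj_eigen (-1) ->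
  killing (adj_eigen (-1)) X Y = (n%:R - 2 * e) * \tr (X *m Y).
Proof.
move=> hX hY; have c1 : (-1) * (-1) = 1 :> F by rewrite mulrNN mulr1.
rewrite /killing (@coord_trace_frame _ _ _ _
  (fun k => adj_proj (-1) (delta_mx k.1 k.2)) (fun k => mxentry k) (comm X \o comm Y)).
- have projE k : mxentry k ((comm X \o comm Y) (adj_proj (-1) (delta_mx k.1 k.2))) =
      2^-1 * (mxentry k (comm X (comm Y (delta_mx k.1 k.2)))
              - mxentry k (comm X (comm Y (adjm (delta_mx k.1 k.2))))).
    rewrite /= /adj_proj scaleN1r !commZr mxentryZ (commBr Y (delta_mx _ _)).
    by rewrite (commBr X (comm _ _)) mxentryB.
  rewrite (eq_bigr _ (fun k _ => projE k)).
  (* (ad X)(ad Y) Z = XYZ - XZY - YZX + ZYX, to be used with Z a matrix unit or its adjoint. *)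
  have sumE (g : 'M[F]_n -> 'M[F]_n) :
    \sum_k mxentry k (comm X (comm Y (g (delta_mx k.1 k.2)))) =
    \sum_k mxentry k (X *m Y *m g (delta_mx k.1 k.2) *m 1%:M)
    - \sum_k mxentry k (X *m g (delta_mx k.1 k.2) *m Y)
    - \sum_k mxentry k (Y *m g (delta_mx k.1 k.2) *m X)
    + \sum_k mxentry k (1%:M *m g (delta_mx k.1 k.2) *m (Y *m X)).
    rewrite -!sumrB -big_split; apply: eq_bigr => k _.
    rewrite /= -!mxentryB -[RHS](linearD (mxentry k)) /= mul1mx mulmx1; congr mxentry.
    by rewrite !commE !mulmxBl !mulmxBr !mulmxA; mx_abel.
  rewrite -big_distrr sumrB (sumE id) (sumE adjm) !sum_entry_delta !sum_entry_adj_delta.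
  have /adj_eigenP aX := hX; have /adj_eigenP aY := hY.
  rewrite (mxtrace_adj_skew hX) (mxtrace_adj_skew hY) adjmM aX aY !scaleN1r.
  rewrite mulmx1 mulNmx mulmxN opprK.
  rewrite !mulNmx !linearN /= [adjm 1%:M](_ : _ = 1%:M); last first.
    by rewrite /adjm trmx1 mulmx1 mulmxV.
  rewrite mul1mx mxtrace1 (mxtrace_mulC Y X).
  by field; rewrite two_neq0.
- by move=> k; apply: adj_projP.
- by move=> Z hZ; apply: adj_eigen_frame.
- by move=> Z hZ /=; do 2! apply: (comm_adj_eigen _ _) => //.
Qed.

End FormAlgebra.

(** * Change of basis *)

Section Conjugation.
Variables (F : fieldType) (n : nat) (P : 'M[F]_n).
Hypothesis Pu : P \in unitmx.
Implicit Types x y S : 'M[F]_n.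
Local Notation cj x := (P *m x *m invmx P).

Lemma cjM x y : cj (x *m y) = cj x *m cj y.
Proof. by rewrite !mulmxA mulmxKV. Qed.
Lemma cjK x : invmx P *m cj x *m P = x.
Proof. by rewrite -!mulmxA mulVmx // mulmx1 mulKmx. Qed.
Lemma cjVK x : cj (invmx P *m x *m P) = x.
Proof. by rewrite -!mulmxA mulmxV // mulmx1 mulKVmx. Qed.
Lemma cj_inj x y : cj x = cj y -> x = y.
Proof. by move=> h; rewrite -[x]cjK h cjK. Qed.
Lemma cj_trace x y : \tr (x *m y) = \tr (cj x *m cj y).
Proof. by rewrite -cjM [RHS]mxtrace_mulC mulKmx. Qed.
Lemma cj_comm x y : cj (comm x y) = comm (cj x) (cj y).
Proof. by rewrite !commE mulmxBr mulmxBl !cjM. Qed.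

Lemma congr_unitmx S : S \in unitmx -> P *m S *m P^T \in unitmx.
Proof. by move=> Su; rewrite !unitmx_mul unitmx_tr Pu Su. Qed.

Lemma congr_skew S : S^T = - S -> (P *m S *m P^T)^T = - (P *m S *m P^T).
Proof. by move=> Ssk; rewrite !trmx_mul trmxK Ssk mulNmx mulmxN mulmxA. Qed.

(** The form has matrix [invmx S], so S itself transforms by congruence with P when x is conjugated
    by P. *)
Lemma adj_eigen_cj S c x : S \in unitmx ->
  (cj x \in adj_eigen (P *m S *m P^T) c) = (x \in adj_eigen S c).
Proof.
move=> Su; have S'u := congr_unitmx Su.
have E : cj x *m (P *m S *m P^T) = P *m (x *m S) *m P^T by rewrite !mulmxA mulmxKV.
have E2 : P *m S *m P^T *m (cj x)^T = P *m (S *m x^T) *m P^T.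
  rewrite !trmx_mul !mulmxA; congr (_ *m _ *m _).
  by rewrite -[P *m S *m P^T *m _]mulmxA -trmx_mul mulVmx // trmx1 mulmx1.
have PTu : P^T \in unitmx by rewrite unitmx_tr.
have adjE (T z : 'M[F]_n) : T \in unitmx ->
    reflect (T *m z^T = c *: (z *m T)) (z \in adj_eigen T c).
  move=> Tu; apply: (iffP (adj_eigenP _ _ _)); rewrite /adjm => h.
    by rewrite -(mulmxKV Tu (T *m z^T)) h scalemxAl.
  by rewrite h -scalemxAl mulmxK.
apply/(adjE _ _ S'u)/(adjE _ _ Su); rewrite E E2; [move=> h|move=> ->].
  rewrite -[S *m _](mulKmx Pu) -[P *m _](mulmxK PTu) h.
  by rewrite -scalemxAl -scalemxAr mulmxK // mulKmx.
by rewrite -scalemxAr -scalemxAl.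
Qed.

End Conjugation.

(** * The symplectic algebra and its modules *)

Section Symplectic.
Variables (F : numFieldType) (n : nat) (S : 'M[F]_n).
Hypothesis Su : S \in unitmx.
Hypothesis Ssk : S^T = - S.
Implicit Types (u v w p q r : 'cV[F]_n) (y : 'M[F]_n).

Let two_neq0 : 2 != 0 :> F. Proof. by rewrite pnatr_eq0. Qed.
Let Se : S^T = (-1) *: S. Proof. by rewrite scaleN1r. Qed.
Let ee : (-1) * (-1) = 1 :> F. Proof. by rewrite mulrNN mulr1. Qed.

Lemma invmx_skew : (invmx S)^T = - invmx S.
Proof. by rewrite (invmx_form Su Se ee) scaleN1r. Qed.

Definition sform u v : F := (u^T *m invmx S *m v) 0 0.
Local Notation b := sform.

Lemma sformDl u v w : b (u + v) w = b u w + b v w.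
Proof. by rewrite /b linearD !mulmxDl mxE. Qed.
Lemma sformDr u v w : b u (v + w) = b u v + b u w.
Proof. by rewrite /b mulmxDr mxE. Qed.
Lemma sformZl a u v : b (a *: u) v = a * b u v.
Proof. by rewrite /b linearZ /= -!scalemxAl mxE. Qed.
Lemma sformZr a u v : b u (a *: v) = a * b u v.
Proof. by rewrite /b -!scalemxAr mxE. Qed.
Lemma sformC u v : b u v = - b v u.
Proof.
rewrite /b; transitivity ((u^T *m invmx S *m v)^T 0 0); first by rewrite [in RHS]mxE.
by rewrite !trmx_mul trmxK invmx_skew mulNmx mulmxN mxE mulmxA.
Qed.
Lemma sformNr u v : b u (- v) = - b u v.
Proof. by rewrite -scaleN1r sformZr mulN1r. Qed.
Lemma sform0r u : b u 0 = 0.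
Proof. by rewrite /b mulmx0 mxE. Qed.
Lemma sform_alt u : b u u = 0.
Proof.
apply/eqP; have /eqP := sformC u u.
by rewrite -addr_eq0 -mulr2n -mulr_natl mulf_eq0 (negPf two_neq0).
Qed.

Lemma sform_nondeg v : v != 0 -> exists w, b w v != 0.
Proof.
move=> v0; have /matrix0Pn[i [j hij]] : invmx S *m v != 0.
  apply: contra v0 => /eqP h; apply/eqP.
  by rewrite -[v](mulKVmx Su) h mulmx0.
exists (delta_mx i 0); rewrite /b -mulmxA trmx_delta -rowE mxE.
by rewrite (ord1 j) in hij.
Qed.

Lemma sform_sep v u : v != 0 -> (forall c, u != c *: v) ->
  exists2 w, b w v = 0 & b w u != 0.
Proof.
(* [c] makes [u - c *: v] orthogonal to p. A vector w not orthogonal to this difference can then be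
   corrected by a multiple of p until it is orthogonal to v, without changing its pairing with the
   difference. *)
move=> /sform_nondeg[p hp] uv; pose c := b p u / b p v.
have : u - c *: v != 0 by rewrite subr_eq0.
case/sform_nondeg=> w; rewrite sformDr sformNr sformZr => hw.
exists (w - (b w v / b p v) *: p).
  by rewrite sformDl -scaleNr sformZl; field.
rewrite sformDl -scaleNr sformZl; move: hw; apply: contra => /eqP <-; apply/eqP.
by rewrite /c; field.
Qed.

Lemma sform_common v u : v != 0 -> u != 0 -> exists2 p, b p v != 0 & b p u != 0.
Proof.
move=> /sform_nondeg[p hp] /sform_nondeg[q hq].
have [pu|] := eqVneq (b p u) 0; last by exists p.
have [qv|] := eqVneq (b q v) 0; last by exists q.
by exists (p + q); rewrite sformDl ?pu ?qv ?addr0 ?add0r.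
Qed.

Lemma sform_perp2 u v : (2 < n)%N -> exists w, [/\ w != 0, b w u = 0 & b w v = 0].
Proof.
move=> n2; pose A := invmx S *m row_mx u v.
have : kermx A != 0.
  rewrite -mxrank_eq0 mxrank_ker subn_eq0 -ltnNge.
  by apply: leq_ltn_trans n2; rewrite rank_leq_col.
case/rowV0Pn => x /sub_kermxP; rewrite /A mulmxA mul_mx_row => h x0.
exists x^T; rewrite /b trmxK; have [-> ->] : x *m invmx S *m u = 0 /\ x *m invmx S *m v = 0.
  by split; [move/(congr1 lsubmx): h|move/(congr1 rsubmx): h]; rewrite ?row_mxKl ?row_mxKr linear0.
by split; rewrite ?mxE // -trmx0 (inj_eq trmx_inj).
Qed.

(** The image of the symmetrized (e = 1) or antisymmetrized (e = -1) tensor of u and v in the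
    matrices, through the form: sp is the symmetric square of the natural module and P its exterior
    square. *)
Definition rk2 (e : F) u v : 'M[F]_n := (u *m v^T + e *: (v *m u^T)) *m invmx S.

Lemma rk2C e u v : e * e = 1 -> rk2 e v u = e *: rk2 e u v.
Proof.
by move=> he; rewrite /rk2 [RHS]scalemxAl scalerDr scalerA he scale1r addrC.
Qed.
Lemma rk2Dr e u v w : rk2 e u (v + w) = rk2 e u v + rk2 e u w.
Proof.
by rewrite /rk2 linearD /= mulmxDr [(v + w) *m _]mulmxDl scalerDr -[RHS]mulmxDl addrACA.
Qed.
Lemma rk2Zr e a u v : rk2 e u (a *: v) = a *: rk2 e u v.
Proof.
rewrite /rk2 linearZ /= -scalemxAr -scalemxAl scalerA mulrC -scalerA -scalerDr.
by rewrite -scalemxAl.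
Qed.
Lemma rk2Dl e u v w : rk2 e (u + v) w = rk2 e u w + rk2 e v w.
Proof.
by rewrite /rk2 [(u + v)^T]linearD /= [(u + v) *m _]mulmxDl mulmxDr scalerDr -[RHS]mulmxDl addrACA.
Qed.
Lemma rk2Zl e a u v : rk2 e (a *: u) v = a *: rk2 e u v.
Proof.
rewrite /rk2 linearZ /= -scalemxAr -scalemxAl scalerA mulrC -scalerA -scalerDr.
by rewrite -scalemxAl.
Qed.
Lemma rk2Br e u v w : rk2 e u (v - w) = rk2 e u v - rk2 e u w.
Proof. by rewrite rk2Dr -scaleN1r rk2Zr scaleN1r. Qed.

Lemma rk2_adj e u v : e * e = 1 -> rk2 e u v \in adj_eigen S (- e).
Proof.
move=> he; apply/adj_eigenP; rewrite /adjm /rk2 trmx_mul invmx_skew mulNmx mulmxN.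
rewrite mulKVmx // linearD linearZ /= !trmx_mul !trmxK [RHS]scalemxAl; congr (_ *m _).
by rewrite scalerDr scalerA mulNr he scaleN1r scaleNr opprD addrC.
Qed.

Lemma mul_rk2 e u v w : rk2 e u v *m w = b v w *: u + (e * b u w) *: v.
Proof.
have out p q : p *m q^T *m invmx S *m w = b q w *: p.
  rewrite -!mulmxA (_ : q^T *m (invmx S *m w) = (b q w)%:M) ?mul_mx_scalar //.
  by rewrite [LHS]mx11_scalar mulmxA.
by rewrite /rk2 mulmxDl -scalemxAl mulmxDl -scalemxAl !out scalerA.
Qed.

Lemma sp_invmx y : y \in adj_eigen S (-1) -> invmx S *m y = - (y^T *m invmx S).
Proof.
move/adj_eigenP; rewrite scaleN1r => h.
by rewrite -[y in LHS]opprK -h /adjm mulmxN -!mulmxA mulKmx.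
Qed.

(** The Leibniz rule on the tensor square. *)
Lemma comm_rk2 e u v y : y \in adj_eigen S (-1) ->
  comm y (rk2 e u v) = rk2 e (y *m u) v + rk2 e u (y *m v).
Proof.
move=> hy; rewrite commE /rk2 -[_ *m _ *m y]mulmxA (sp_invmx hy) mulmxN opprK.
rewrite !trmx_mul !mulmxA -!mulmxDl; congr (_ *m _).
rewrite !mulmxDr !mulmxDl -!scalemxAr -!scalemxAl !mulmxA.
by rewrite addrACA [RHS]addrACA; congr (_ + _); rewrite addrC.
Qed.

(** [y *m S] is symmetric or skew according to e, so symmetrizing its expansion in matrix units
    doubles it. *)
Lemma rk2_span e y : e * e = 1 -> y \in adj_eigen S (- e) ->
  y = 2^-1 *: \sum_k mxentry k (y *m S) *: rk2 e (delta_mx k.1 0) (delta_mx k.2 0).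
Proof.
move=> he /adj_eigenP hy.
have hQ : (y *m S)^T = e *: (y *m S).
  rewrite trmx_mul Ssk mulNmx; move: hy; rewrite /adjm => /(congr1 (mulmx^~ S)).
  by rewrite mulmxKV // => ->; rewrite -scalemxAl scaleNr opprK.
have -> : \sum_k mxentry k (y *m S) *: rk2 e (delta_mx k.1 0) (delta_mx k.2 0)
   = (\sum_k mxentry k (y *m S) *: (delta_mx k.1 k.2 + e *: delta_mx k.2 k.1)) *m invmx S.
  rewrite mulmx_suml; apply: eq_bigr => k _.
  by rewrite /rk2 !trmx_delta !mul_delta_mx scalemxAl.
set Q := y *m S in hQ *.
have Qs : Q = \sum_k mxentry k Q *: delta_mx k.1 k.2.
  by rewrite [LHS]matrix_sum_delta pair_big.
have Qt : Q^T = \sum_k mxentry k Q *: delta_mx k.2 k.1.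
  rewrite {1}Qs linear_sum; apply: eq_bigr => k _.
  by rewrite linearZ /= trmx_delta.
have -> : \sum_k mxentry k Q *: (delta_mx k.1 k.2 + e *: delta_mx k.2 k.1) = Q + e *: Q^T.
  rewrite Qt [X in _ = X + _]Qs scaler_sumr -big_split; apply: eq_bigr => k _ /=.
  by rewrite scalerDr !scalerA [e * _]mulrC.
rewrite hQ scalerA he scale1r -mulr2n -scaler_nat -scalemxAl mulmxK //.
by rewrite scalerA mulVf // scale1r.
Qed.

Local Notation sp := (adj_eigen S (-1)).
Local Notation x_ w := (rk2 1 w w).

Lemma rk2_sp w : x_ w \in sp.
Proof. by apply: rk2_adj; rewrite mulr1. Qed.
Hint Resolve rk2_sp : core.

Lemma mul_x w v : x_ w *m v = (2 * b w v) *: w.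
Proof. by rewrite mul_rk2 mul1r -scalerDl -mulr2n mulr_natl. Qed.

Lemma comm_x e w u v : comm (x_ w) (rk2 e u v) =
  (2 * b w u) *: rk2 e w v + (2 * b w v) *: rk2 e u w.
Proof. by rewrite comm_rk2 // !mul_x rk2Zl rk2Zr. Qed.

Lemma memvZ_neq0 (vT : vectType F) (U : {vspace vT}) a (x : vT) :
  a != 0 -> a *: x \in U -> x \in U.
Proof. by move=> a0 /(memvZ a^-1); rewrite scalerA mulVf // scale1r. Qed.

(** A nonzero ideal is shown to contain one [x_ v]; bracketing with elements [x_ r] then replaces
    the two factors v by arbitrary vectors, one after the other. *)
Lemma sp_ideal (I : {vspace 'M[F]_n}) : (I <= sp)%VS -> stable_under sp I ->
  I = 0%VS \/ I = sp.
Proof.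
move=> Isub Ist; have [->|/eqP I0] := eqVneq I 0%VS; [by left|right].
apply/eqP; rewrite eqEsubv Isub /=.
pose y := vpick I; have yI : y \in I := memv_pick I.
have y0 : y != 0 by rewrite vpick0; apply/eqP.
have ysp := subvP Isub _ yI.
have e1 : 1 * 1 = 1 :> F by rewrite mulr1.
have quadC u v : b v (y *m u) = b u (y *m v).
  rewrite sformC /b trmx_mul -[_ *m y^T *m _]mulmxA.
  by rewrite -[y^T *m _]opprK -(sp_invmx ysp) mulmxN mulNmx mxE opprK !mulmxA.
(* The form b(u, y v) is symmetric for y in sp, so if it vanished on the diagonal it would vanish by
   polarization. *)
have [v hv] : exists v, b v (y *m v) != 0.
  apply: contrapT => hn; move/negP: y0; apply.
  have h0 v : b v (y *m v) = 0 by apply/eqP; apply: contrapT => /negP ?; apply: hn; exists v.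
  have h u v : b u (y *m v) = 0.
    have := h0 (u + v); rewrite mulmxDr !sformDl !sformDr !h0 add0r addr0 (quadC u v).
    by move/eqP; rewrite -mulr2n -mulr_natl mulf_eq0 (negPf two_neq0) => /eqP.
  apply/eqP/matrixP => i j; rewrite mxE.
  have -> : y i j = (y *m delta_mx j 0 : 'cV_n) i 0 by rewrite -colE mxE.
  have [->|/sform_nondeg[w]] := eqVneq (y *m delta_mx j 0 : 'cV_n) 0; first by rewrite mxE.
  by rewrite h eqxx.
(* [x_v, [x_v, y]] is a multiple of x_v with coefficient proportional to b(v, y v). *)
have xv : x_ v \in I.
  have h : comm (x_ v) (comm (x_ v) y) \in I by do 2! apply: (Ist _ _) => //.
  move: h; rewrite [comm _ y]commC comm_rk2 // (rk2C v (y *m v) e1) scale1r.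
  rewrite -mulr2n -scaler_nat -scaleN1r !commZr comm_x sform_alt mulr0 scale0r add0r.
  by rewrite !scalerA => /memvZ_neq0; apply; rewrite !mulf_neq0 ?oppr_eq0 ?oner_neq0.
have v0 : v != 0 by apply: contra hv => /eqP ->; rewrite mulmx0 sform0r.
have [w0 hw0] := sform_nondeg v0.
(* The bracket with [x_ r] inserts r only if r is not orthogonal to v. An orthogonal w is the
   difference of the non-orthogonal vectors w + w0 and w0. *)
have step1 w : rk2 1 w v \in I.
  have gen r : b r v != 0 -> rk2 1 r v \in I.
    move=> hr; have := Ist _ _ (rk2_sp r) xv; rewrite comm_x (rk2C r v e1) scale1r.
    by rewrite -scalerDl -mulr2n -[_ *+ 2]mulr_natl => /memvZ_neq0; apply; rewrite !mulf_neq0.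
  have [h|/gen//] := eqVneq (b w v) 0.
  have := gen (w + w0); rewrite sformDl h add0r => /(_ hw0).
  by rewrite rk2Dl => /(memvB) /(_ (gen _ hw0)); rewrite addrK.
have step2 w u : rk2 1 w u \in I.
  have gen r : b r v != 0 -> rk2 1 w r \in I.
    move=> hr; have := Ist _ _ (rk2_sp r) (step1 w); rewrite comm_x.
    rewrite rpredDl; last by apply: memvZ.
    by move=> /memvZ_neq0; apply; rewrite mulf_neq0.
  have [h|/gen//] := eqVneq (b u v) 0.
  have := gen (u + w0); rewrite sformDl h add0r => /(_ hw0).
  by rewrite rk2Dr => /(memvB) /(_ (gen _ hw0)); rewrite addrK.
apply/subvP => z hz; rewrite (rk2_span e1 hz) memvZ // memv_suml // => k _.
exact: memvZ.
Qed.

Lemma sp_simple : (0 < n)%N -> is_simple_lie sp.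
Proof.
move=> n0; split; first by move=> x y; exact: comm_adj_eigen.
  have v0 : (const_mx 1 : 'cV[F]_n) != 0.
    by apply/eqP => /matrixP /(_ (Ordinal n0) 0) /eqP; rewrite !mxE oner_eq0.
  set v := const_mx 1 in v0; have [w hw] := sform_nondeg v0.
  exists (x_ w), (x_ v); split=> //; apply/eqP.
  move/(congr1 (mulmx^~ v)); rewrite commE mulmxBl -(mulmxA (x_ w)) -(mulmxA (x_ v)) !mul_x.
  rewrite sform_alt mulr0 scale0r.
  rewrite (sform0r w) mulr0 scale0r sub0r mul0mx sformZr [b v w]sformC => /eqP.
  by rewrite oppr_eq0 scaler_eq0 (negPf v0) orbF !mulf_eq0 oppr_eq0 (negPf hw) (negPf two_neq0).
by move=> I; exact: sp_ideal.
Qed.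

Definition traceless : {vspace 'M[F]_n} := lker (linfun (@mxtrace F n : 'M[F]_n -> F^o)).
Lemma tracelessP x : reflect (\tr x = 0) (x \in traceless).
Proof. by rewrite memv_ker lfunE; exact: eqP. Qed.

Local Notation P := (adj_eigen S 1).
Definition adj_sym0 : {vspace 'M[F]_n} := (P :&: traceless)%VS.
Local Notation z_ := (rk2 (-1)).

Lemma rk2_trace u v : \tr (z_ u v) = - 2 * b u v.
Proof.
have out p q : \tr (p *m q^T *m invmx S) = b q p.
  by rewrite -mulmxA mxtrace_mulC /b /mxtrace big_ord1.
by rewrite /rk2 mulmxDl linearD /= -scalemxAl linearZ /= !out [b v u]sformC; ring.
Qed.

Lemma adj_sym_stable x y : x \in sp -> y \in adj_sym0 -> comm x y \in adj_sym0.
Proof.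
move=> hx; rewrite !memv_cap => /andP[hy _]; apply/andP.
split; first exact: (comm_adj_eigen Su hx hy).
by apply/tracelessP; rewrite commE linearB /= mxtrace_mulC subrr.
Qed.

(** If every vector is an eigenvector, y is a scalar matrix, and a traceless scalar matrix is 0 in
    characteristic 0. *)
Lemma non_scalar_vec y : \tr y = 0 -> y != 0 -> (0 < n)%N ->
  exists2 v : 'cV[F]_n, v != 0 & forall c, y *m v != c *: v.
Proof.
move=> tr0 y0 n0; apply: contrapT => hn; move/negP: y0; apply.
have ev (v : 'cV[F]_n) : v != 0 -> exists c, y *m v = c *: v.
  move=> v0; apply: contrapT => hc; apply: hn; exists v => // c.
  by apply/eqP => h; apply: hc; exists c.
have e0 (i : 'I_n) : (delta_mx i 0 : 'cV[F]_n) != 0.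
  by apply/eqP => /matrixP /(_ i 0) /eqP; rewrite !mxE !eqxx oner_eq0.
have yd i j : i != j -> y i j = 0.
  move=> ij; have [c /matrixP /(_ i 0)] := ev _ (e0 j).
  by rewrite -colE !mxE (negPf ij) mulr0.
have yii i j : i != j -> y i i = y j j.
  move=> ij; have ej0 : (delta_mx i 0 + delta_mx j 0 : 'cV[F]_n) != 0.
    apply/eqP => /matrixP /(_ i 0) /eqP.
    by rewrite !mxE !eqxx (negPf ij) addr0 oner_eq0.
  have [c hc] := ev _ ej0; have ji : j != i by rewrite eq_sym.
  move/matrixP: hc => hc; have := hc i 0; have := hc j 0; rewrite mulmxDr -!colE.
  rewrite !mxE !eqxx (negPf ij) (negPf ji) (yd _ _ ij) (yd _ _ ji).
  by rewrite !addr0 !add0r mulr1 => -> ->.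
pose i0 := Ordinal n0; have hy : y = (y i0 i0)%:M.
  apply/matrixP => i j; rewrite mxE; case: (eqVneq i j) => [<-|/yd //].
  by case: (eqVneq i i0) => [->//|/yii ->].
move: tr0; rewrite hy mxtrace_scalar => /eqP.
by rewrite -mulr_natr mulf_eq0 pnatr_eq0 (gtn_eqF n0) orbF => /eqP ->; rewrite raddf0.
Qed.

(** A nonzero submodule W is shown to contain every z_uv with u, v orthogonal, and then all
    differences of the normalized vectors z_uv / b(u, v). Hence z_uv is congruent to b(u, v) c
    modulo W for one fixed c. As the trace of z_uv is -2 b(u, v), the multiple of c cancels for
    traceless combinations. *)
Lemma adj_sym0_irr (W : {vspace 'M[F]_n}) : (2 < n)%N -> (W <= adj_sym0)%VS ->
  stable_under sp W -> W = 0%VS \/ W = adj_sym0.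
Proof.
move=> n2 Wsub Wst; have [->|/eqP W0] := eqVneq W 0%VS; [by left|right].
apply/eqP; rewrite eqEsubv Wsub /=.
have zC u v : z_ v u = - z_ u v by rewrite (rk2C u v ee) scaleN1r.
have perp u v : z_ u v \in W -> b u v = 0.
  move/(subvP Wsub); rewrite memv_cap => /andP[_ /tracelessP/eqP].
  by rewrite rk2_trace mulf_eq0 oppr_eq0 (negPf two_neq0) => /eqP.
pose A v := forall w, b w v = 0 -> z_ v w \in W.
have A1 v u : v != 0 -> (forall c, u != c *: v) -> z_ v u \in W -> A v.
  move=> v0 hu hW; have gen r : b r v = 0 -> b r u != 0 -> z_ v r \in W.
    move=> rv ru; have := Wst _ _ (rk2_sp r) hW.
    rewrite comm_x rv mulr0 scale0r add0r => /memvZ_neq0; apply.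
    by rewrite mulf_neq0.
  move=> w hw; have [h|/gen -> //] := eqVneq (b w u) 0.
  have [w0 hw0 hw0u] := sform_sep v0 hu.
  have := gen (w + w0); rewrite !sformDl h hw hw0 !add0r => /(_ erefl hw0u).
  by rewrite rk2Dr => /(memvB) /(_ (gen _ hw0 hw0u)); rewrite addrK.
(* A vector u orthogonal to both v and w exists since n > 2; bracketing with [x_ w] turns z_vu into
   a multiple of z_wu, and u is not a multiple of w. *)
have A2 v w : A v -> b w v != 0 -> A w.
  move=> Av hw; have [u [u0 uv uw]] := sform_perp2 v w n2.
  apply: (A1 _ u).
  - by apply: contra hw => /eqP ->; rewrite sformC sform0r oppr0.
  - move=> c; apply/eqP => hu; move/eqP: uv; rewrite hu sformZl mulf_eq0 (negPf hw) orbF.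
    by move=> /eqP c0; move: u0; rewrite hu c0 scale0r eqxx.
  - have := Wst _ _ (rk2_sp w) (Av u uv); rewrite comm_x [b w u]sformC uw oppr0 mulr0.
    by rewrite scale0r addr0 => /memvZ_neq0; apply; rewrite mulf_neq0.
have Aall v : A v.
  have [->|v0] := eqVneq v 0.
    by move=> w _; rewrite -(scale0r 0) rk2Zl scale0r mem0v.
  pose y := vpick W; have yW : y \in W := memv_pick W.
  have y0 : y != 0 by rewrite vpick0; apply/eqP.
  have := subvP Wsub _ yW; rewrite memv_cap => /andP[yP /tracelessP tr0].
  have [u u0 hu] := non_scalar_vec tr0 y0 (ltn_trans (isT : 0 < 2)%N n2).
  (* As y is self-adjoint, [x_u, y] is twice z_u,yu, and y u is not a multiple of u. *)
  have Au : A u.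
    apply: (A1 _ (y *m u) u0 hu).
    have := Wst _ _ (rk2_sp u) yW; move/adj_eigenP: yP; rewrite scale1r /adjm => yS.
    have yi : invmx S *m y = y^T *m invmx S by rewrite -[in LHS]yS -!mulmxA mulKmx.
    have -> : x_ u = 2 *: (u *m u^T *m invmx S).
      by rewrite /rk2 scale1r -mulr2n -scaler_nat -scalemxAl.
    rewrite commZl => /(memvZ_neq0 two_neq0).
    rewrite commE -!mulmxA yi !mulmxA -mulmxBl.
    by rewrite /rk2 scaleN1r trmx_mul !mulmxA.
  by have [p pu pv] := sform_common u0 v0; apply: A2 (A2 _ _ Au pu) _; rewrite sformC oppr_eq0.
(* Normalized to trace -2 and symmetric in u and v, so that a chain of pairs sharing a vector links
   any two of these elements modulo W. *)
pose D u v := (b u v)^-1 *: z_ u v.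
have DC u v : D v u = D u v.
  by rewrite /D zC [b v u]sformC invrN scalerN scaleNr opprK.
have D1 u v w : b u v != 0 -> b u w != 0 -> D u v - D u w \in W.
  move=> uv uw; rewrite /D -!rk2Zr -rk2Br; apply: Aall.
  by rewrite sformC sformDr sformNr !sformZr !mulVf // subrr oppr0.
have D2 u v p q : b u v != 0 -> b p q != 0 -> D u v - D p q \in W.
  move=> uv pq; have neq0 r s : b r s != 0 -> r != 0.
    by apply: contra => /eqP ->; rewrite sformC sform0r oppr0.
  have [r ru rp] := sform_common (neq0 _ _ uv) (neq0 _ _ pq).
  have ur : b u r != 0 by rewrite sformC oppr_eq0.
  have pr : b p r != 0 by rewrite sformC oppr_eq0.
  rewrite (_ : _ - _ = (D u v - D u r) + (D r u - D r p) + (D p r - D p q)).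
    by apply: rpredD; [apply: rpredD|]; apply: D1.
  by rewrite (DC u r) (DC p r) !subrKA.
have [c hc] : exists c, forall u v, z_ u v - b u v *: c \in W.
  have v0 : (const_mx 1 : 'cV[F]_n) != 0.
    by apply/eqP => /matrixP /(_ (Ordinal n2) 0) /eqP; rewrite !mxE oner_eq0.
  have [p hp] := sform_nondeg v0; exists (D p (const_mx 1)) => u v.
  have [h|h] := eqVneq (b u v) 0.
    by rewrite h scale0r subr0 Aall // sformC h oppr0.
  have := memvZ (b u v) (D2 _ _ _ _ h hp).
  by rewrite scalerBr {1}/D scalerA mulfV // scale1r.
apply/subvP => y; rewrite memv_cap => /andP[yP /tracelessP tr0].
have hy := rk2_span ee; rewrite opprK in hy; have {hy} hy := hy _ yP.
have : 2^-1 *: \sum_k mxentry k (y *m S) *: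
    (z_ (delta_mx k.1 0) (delta_mx k.2 0) - b (delta_mx k.1 0) (delta_mx k.2 0) *: c) \in W.
  by rewrite memvZ // memv_suml // => k _; rewrite memvZ.
under eq_bigr => k _ do rewrite scalerBr scalerA.
rewrite sumrB scalerBr -hy -scaler_suml (_ : \sum_k _ = 0) ?scale0r ?scaler0 ?subr0 //.
move: tr0; rewrite {1}hy linearZ linear_sum /= => /eqP.
rewrite mulf_eq0 invr_eq0 (negPf two_neq0) /=.
under eq_bigr => k _ do rewrite linearZ /= rk2_trace mulrCA.
by rewrite -big_distrr mulf_eq0 oppr_eq0 (negPf two_neq0) /= => /eqP.
Qed.

Lemma adj_sym_split : (0 < n)%N ->
  P = (<[1%:M]> + adj_sym0)%VS /\ directv (<[1%:M]> + adj_sym0).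
Proof.
move=> n0; have nF : n%:R != 0 :> F by rewrite pnatr_eq0 -lt0n.
have P1 : 1%:M \in P.
  by apply/adj_eigenP; rewrite /adjm trmx1 mulmx1 mulmxV // scale1r.
split.
  apply/eqP; rewrite eqEsubv; apply/andP; split; apply/subvP => y.
    move=> hy; apply/memv_addP; exists ((\tr y / n%:R) *: 1%:M).
      by rewrite memvZ ?memv_line.
    exists (y - (\tr y / n%:R) *: 1%:M); last by rewrite addrC subrK.
    rewrite memv_cap rpredB ?memvZ //; apply/tracelessP.
    by rewrite linearB /= linearZ /= mxtrace1 divfK // subrr.
  case/memv_addP => u /vlineP[k ->] [v]; rewrite memv_cap => /andP[hv _] ->.
  by rewrite rpredD // memvZ.
apply/directv_addP/eqP; rewrite -subv0; apply/subvP => y; rewrite !memv_cap memv0.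
case/and3P => /vlineP[k ->] _ /tracelessP.
rewrite linearZ /= mxtrace1 => /eqP; rewrite mulf_eq0 (negPf nF) orbF => /eqP ->.
by rewrite scale0r.
Qed.

End Symplectic.

(** * Jordan decomposition in the symplectic algebra *)

Section Interpolation.
Variable F : fieldType.
Implicit Types (p q : {poly F}) (L : seq F).

Lemma coprimep_linear_exp (a b : F) m : a != b ->
  coprimep (('X - a%:P) ^+ m) (('X - b%:P) ^+ m).
Proof. by move=> ab; rewrite coprimep_expl ?coprimep_expr // coprimep_XsubC2 // subr_eq0 eq_sym. Qed.

Lemma poly_crt L m (f : F -> F) : uniq L ->
  exists q, forall a, a \in L -> ('X - a%:P) ^+ m %| q - (f a)%:P.
Proof.
elim: L => [_|a L IH /= /andP[aL /IH[q hq]]]; first by exists 0.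
pose M := \prod_(b <- L) ('X - b%:P) ^+ m.
have /Bezout_eq1_coprimepP[[u v] /= uv] : coprimep M (('X - a%:P) ^+ m).
  rewrite /M big_seq; apply: (big_ind (fun p => coprimep p _)).
  - exact: coprime1p.
  - by move=> p r hp hr; rewrite coprimepMl hp.
  - by move=> b bL; apply: coprimep_linear_exp; apply: contraNneq aL => <-.
(* M vanishes modulo the powers already treated, while M u is 1 modulo the new one. *)
exists (q + M * (u * ((f a)%:P - q))) => b; rewrite inE => /orP[/eqP ->|bL].
  have -> : q + M * (u * ((f a)%:P - q)) - (f a)%:P =
            (q - (f a)%:P) * v * ('X - a%:P) ^+ m.
    rewrite (_ : (q - _) * v * _ = (q - (f a)%:P) * (u * M + v * ('X - a%:P) ^+ m - u * M)).
      by rewrite uv; ring.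
    by ring.
  exact: dvdp_mull.
rewrite addrAC dvdp_add ?hq // dvdp_mulr // /M (big_rem b) //=.
exact: dvdp_mulr.
Qed.

(** L being closed under negation, -q(-X) solves the same congruences as q, and the mean of the two
    is odd. *)
Lemma odd_interpolation L m : 2 != 0 :> F -> uniq L ->
  {in L, forall a, - a \in L} ->
  exists2 q, q \Po (- 'X) = - q & forall a, a \in L -> ('X - a%:P) ^+ m %| q - a%:P.
Proof.
move=> two uL NL; have [q hq] := poly_crt m id uL.
have compNN p : p \Po (- 'X) \Po (- 'X) = p.
  by rewrite -comp_polyA rmorphN /= comp_polyX opprK comp_polyXr.
exists (2^-1 *: (q - (q \Po (- 'X)))) => [|a aL].
  by rewrite comp_polyZ comp_polyB compNN -scalerN opprB.
have -> : 2^-1 *: (q - (q \Po - 'X)) - a%:P =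
          2^-1 *: ((q - a%:P) - ((q + a%:P) \Po - 'X)).
  rewrite comp_polyD comp_polyC; apply: (scalerI two).
  rewrite scalerBr !scalerA divff // !scale1r (scaler_nat 2).
  by ring.
rewrite dvdpZr ?invr_eq0 // dvdp_sub ?hq //.
have := hq _ (NL _ aL); rewrite polyCN !opprK => /dvdpP[r ->].
rewrite comp_polyM dvdp_mull // rmorphXn /= comp_polyD comp_polyX comp_polyC.
rewrite [- 'X + _]addrC -opprB exprNn -signr_odd.
by case: odd; rewrite ?expr1 ?expr0 ?mulN1r ?mul1r ?dvdpNl.
Qed.

End Interpolation.

(** * Nilpotent matrices and semisimple parts *)

Section Nilpotent.
Variables (F : numClosedFieldType) (n' : nat).
Local Notation n := n'.+1.
Implicit Types (x y h s t : 'M[F]_n).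

Definition nilpotent_mx x := exists m, x ^+ m = 0.

Lemma mxtrace_nilpotent x : nilpotent_mx x -> \tr x = 0.
Proof.
case=> m xm; have [r hr] := closed_field_poly_normal (char_poly x).
move: hr; rewrite (monicP (char_poly_monic x)) scale1r => hr.
have r0 (z : F) : z \in r -> z = 0.
  move=> zr; have : root (char_poly x) z by rewrite hr root_prod_XsubC.
  rewrite -eigenvalue_root_char => /eigenvalueP[v hv v0].
  have hk k : v *m x ^+ k = z ^+ k *: v.
    elim: k => [|k IH]; first by rewrite !expr0 mulmx1 scale1r.
    by rewrite !exprS -mulmxE mulmxA hv -scalemxAl IH scalerA.
  have /eqP := hk m; rewrite xm mulmx0 eq_sym scaler_eq0 (negPf v0) orbF expf_eq0.
  by case/andP=> _ /eqP.
have sr : size r = n.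
  by have := size_char_poly x; rewrite hr size_prod_XsubC => -[].
have : (char_poly x)`_n.-1 = - \tr x by rewrite char_poly_trace.
rewrite hr (eq_big_seq (fun=> 'X)) => [|z /r0 ->]; last by rewrite subr0.
rewrite big_const_seq count_predT sr iter_mulr_1 coefXn /= ltn_eqF // => /eqP.
by rewrite eq_sym oppr_eq0 => /eqP.
Qed.

Lemma nilpotent_mul x y : comm x y = 0 -> nilpotent_mx x -> nilpotent_mx (x *m y).
Proof.
move=> /comm_eq0P xy [m xm]; exists m.
by rewrite mulmxE exprMn_comm // xm mul0r.
Qed.

(* For [x ^+ m = 0], a product x^i y x^j with i + j >= 2m vanishes. *)
Lemma ad_nilpotent x y : nilpotent_mx x -> exists m, iter m (comm x) y = 0.
Proof.
case=> m xm; exists (m + m)%N.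
have : forall i j, (m + m <= i + j)%N -> x ^+ i * y * x ^+ j = 0.
  move=> i j hij; have [mi|im] := leqP m i.
    by rewrite -(subnK mi) exprD xm mulr0 !mul0r.
  have mj : (m <= j)%N by rewrite -(leq_add2l m) (leq_trans hij) // leq_add2r ltnW.
  by rewrite -(subnKC mj) exprD xm mul0r mulr0.
elim: (m + m)%N y => [|k IH] y hy; first by have := hy 0%N 0%N isT; rewrite mul1r mulr1.
rewrite iterSr; apply: IH => i j hij.
rewrite commE !mulmxE mulrBr mulrBl mulrA -exprSr hy ?addSn //.
by rewrite mulrA -[_ * x * _]mulrA -exprS hy ?subrr // addnS.
Qed.

(** In an eigenbasis of s, ad s multiplies the entry (i, j) by d_i - d_j, and a scalar whose square
    kills an entry kills that entry. *)
Lemma diagonalizable_ad2 s y : diagonalizable s ->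
  comm s (comm s y) = 0 -> comm s y = 0.
Proof.
case=> P Pu /similar_diagPex[d] /(similarP Pu) hs.
have cj z : comm s z = invmx P *m comm (diag_mx d) (P *m z *m invmx P) *m P.
  have -> : s = invmx P *m diag_mx d *m P by rewrite -mulmxA -hs mulmxA mulVmx // mul1mx.
  rewrite !commE mulmxBr mulmxBl !mulmxA mulmxKV //.
  by rewrite mulVmx // mul1mx.
rewrite (cj (comm s y)) (cj y) => /(congr1 (fun z => P *m z *m invmx P)).
rewrite mulmx0 mul0mx !mulmxA !mulmxV // !mul1mx !mulmxK // => h.
have := h; set w := P *m y *m invmx P; set c := comm (diag_mx d) w => h2.
suff -> : c = 0 by rewrite mulmx0 mul0mx.
apply/matrixP => i j; move/matrixP: h2 => /(_ i j).
have -> := comm_diagE d c i j; have := comm_diagE d w i j; rewrite -/c => ->.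
rewrite !mxE => /eqP.
rewrite mulf_eq0 => /orP[/eqP ->|/eqP->//].
by rewrite mul0r.
Qed.

Section Jordan.
Variable S : 'M[F]_n.
Hypothesis Su : S \in unitmx.

Lemma adjm_horner h p : h \in adj_eigen S (-1) ->
  adjm S (horner_mx h p) = horner_mx h (p \Po (- 'X)).
Proof.
move=> /adj_eigenP; rewrite scaleN1r => hh; elim/poly_ind: p => [|p c IH].
  by rewrite comp_poly0 !rmorph0 linear0.
rewrite comp_polyD comp_polyM comp_polyX comp_polyC !rmorphD !rmorphM /= rmorphN /=.
rewrite !horner_mx_X !horner_mx_C linearD /= -mulmxE adjmM // hh IH mulmxN mulNmx.
congr (- _ + _).
  exact: comm_mx_horner (erefl _).
by rewrite /adjm tr_scalar_mx mul_mx_scalar -scalemxAl mulmxV // scalemx1.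
Qed.

(* The semisimple part is q(h) for an odd polynomial q, so that it stays in the
   symplectic algebra. *)
Lemma jordan_decomposition h : h \in adj_eigen S (-1) ->
  exists s, [/\ s \in adj_eigen S (-1), diagonalizable s, nilpotent_mx (h - s) &
    forall y, comm h y = 0 -> comm s y = 0].
Proof.
move=> hh; have [r hr] := closed_field_poly_normal (char_poly h).
move: hr; rewrite (monicP (char_poly_monic h)) scale1r => hr.
(* The eigenvalues, made symmetric under negation as odd interpolation requires. The exponent
   exceeds all multiplicities, so that h is a root of D^m; its [.+1] makes it visibly positive,
   which is used when 'X - a must divide its own power. *)
pose L := undup (r ++ map -%R r); pose m := (size r).+1.
have NL : {in L, forall a, - a \in L}.
  move=> a; rewrite !mem_undup !mem_cat => /orP[ar|/mapP[b br ->]].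
    by rewrite map_f ?orbT.
  by rewrite opprK br.
have uL : uniq L by exact: undup_uniq.
have [|q qN hq] := odd_interpolation m _ uL NL; first by rewrite pnatr_eq0.
pose D := \prod_(a <- L) ('X - a%:P).
have Dr : horner_mx h (D ^+ m) = 0.
  have : char_poly h %| D ^+ m.
    have sub : {subset r <= L} by move=> a ar; rewrite mem_undup mem_cat ar.
    have D1 a : a \in r -> 'X - a%:P %| D by move=> /sub aL; rewrite /D (big_rem a) //= dvdp_mulr.
    rewrite hr /m exprS dvdp_mull //.
    elim: (r) D1 => [|a r' IH] D1; first by rewrite big_nil expr0.
    rewrite big_cons exprS dvdp_mul ?D1 ?mem_head // IH // => b br.
    by rewrite D1 // inE br orbT.
  by move=> /dvdpP[g ->]; rewrite rmorphM /= Cayley_Hamilton mulr0.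
exists (horner_mx h q); split.
- by apply/adj_eigenP; rewrite adjm_horner // qN rmorphN scaleN1r.
(* D has simple roots and annihilates q(h): each q - a is divisible by ('X - a)^m, hence their
   product by D^m. *)
- apply/diagonalizableP; exists L => //.
  apply: mxminpoly_min.
  have -> : horner_mx (horner_mx h q) D = horner_mx h (\prod_(a <- L) (q - a%:P)).
    rewrite !rmorph_prod; apply: eq_bigr => a _.
    by rewrite !rmorphB /= horner_mx_X !horner_mx_C.
  have : D ^+ m %| \prod_(a <- L) (q - a%:P).
    rewrite /D -prodrXl; elim: (L) hq => [|a L' IH] hq'; first by rewrite !big_nil.
    rewrite !big_cons; apply: dvdp_mul; first exact: hq' (mem_head _ _).
    by apply: IH => b bL; apply: hq'; rewrite inE bL orbT.
  by move=> /dvdpP[g ->]; rewrite rmorphM /= Dr mulr0.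
- exists m; have -> : h - horner_mx h q = horner_mx h ('X - q).
    by rewrite rmorphB /= horner_mx_X.
  (* q(a) = a at every root a of D. *)
  have : D %| 'X - q.
    apply: uniq_roots_dvdp; last by rewrite uniq_rootsE.
    apply/allP => a aL; rewrite -dvdp_XsubCl.
    rewrite (_ : 'X - q = ('X - a%:P) - (q - a%:P)); last by ring.
    rewrite dvdp_sub ?dvdpp // (dvdp_trans _ (hq _ aL)) //.
    by rewrite exprS dvdp_mulr.
  move=> /(@dvdp_exp2r _ _ _ m) /dvdpP[g hg].
  by rewrite -rmorphXn /= hg rmorphM /= Dr mulr0.
- move=> y /comm_eq0P hy; apply/comm_eq0P.
  exact: comm_horner_mx.
Qed.

End Jordan.

End Nilpotent.

(** * Cartan subalgebras of the symplectic algebra *)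

Section LowerCentral.
Variables (F : fieldType) (N : nat).
Implicit Types (U W H : {vspace 'M[F]_N}) (x y : 'M[F]_N).

Lemma lie_prod_mem U W x y : x \in U -> y \in W -> comm x y \in lie_prod U W.
Proof.
move=> xU yW; rewrite (coord_vbasis xU) (coord_vbasis yW) comm_suml memv_suml // => i _.
rewrite commZl memvZ // linear_sum memv_suml // => j _ /=; rewrite commZr memvZ //.
by apply: memv_span; apply: allpairs_f; rewrite mem_nth ?size_tuple.
Qed.

Lemma lie_prod_subv U W (V : {vspace 'M[F]_N}) :
  (forall x y, x \in U -> y \in W -> comm x y \in V) -> (lie_prod U W <= V)%VS.
Proof.
move=> h; apply/span_subvP => _ /allpairsP[[x y] [xU yW ->]].
by apply: h; apply: vbasis_mem.
Qed.

Lemma lie_prod_scalar U W (L : {scalar 'M[F]_N}) z :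
  (forall x y, x \in U -> y \in W -> L (comm x y) = 0) -> z \in lie_prod U W -> L z = 0.
Proof.
rewrite /lie_prod -[X in <<X>>%VS]in_tupleE => hL zUW; rewrite (coord_span zUW) linear_sum big1 // => i _.
rewrite linearZ /= (_ : L _ = 0) ?mulr0 //.
have /allpairsP[[x y] [xU yW ->]] := mem_nth 0 (ltn_ord i).
by apply: hL; apply: vbasis_mem.
Qed.

Definition lcs H k := iter k (lie_prod H) H.

Variable H : {vspace 'M[F]_N}.
Hypothesis Halg : is_subalgebra H.

Lemma lcs_mem k x y : x \in H -> y \in lcs H k -> comm x y \in lcs H k.+1.
Proof. exact: lie_prod_mem. Qed.

Lemma lcs_subS k : (lcs H k.+1 <= lcs H k)%VS.
Proof.
elim: k => [|k IH]; first by apply: lie_prod_subv => x y; apply: Halg.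
by apply: lie_prod_subv => x y xH /(subvP IH); apply: lcs_mem.
Qed.

Lemma lcs_sub k : (lcs H k <= H)%VS.
Proof. by elim: k => [|k IH] //; apply: subv_trans (lcs_subS k) IH. Qed.

Hypothesis Hnil : is_nilpotent_lie H.

Lemma lcs_ind (Q : nat -> Prop) :
  (forall k, lcs H k = 0%VS -> Q k) -> (forall k, Q k.+1 -> Q k) -> Q 0%N.
Proof.
move=> Q0 QS; have [m hm] := Hnil; have := Q0 m hm.
by elim: m {hm} => // m IH /QS.
Qed.

(** Engel's theorem for the action of H modulo H. By downward induction on the lower central series,
    some x outside H is sent into H by the k-th term. To pass from the term k+1 to the term k, the
    vectors of a basis of the latter are treated one at a time: their mutual brackets lie in the
    term k+1, so they act as commuting operators on the vectors that this term sends into H. *)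
Lemma engel (U : 'M[F]_N -> Prop) (x0 : 'M[F]_N) :
  (forall h x, h \in H -> U x -> U (comm h x)) ->
  (forall h x, h \in H -> U x -> exists m, iter m (comm h) x = 0) ->
  U x0 -> x0 \notin H ->
  exists x, [/\ U x, x \notin H & {in H, forall h, comm h x \in H}].
Proof.
move=> Ust Unil Ux0 x0H.
pose Q k := exists x, [/\ U x, x \notin H & {in lcs H k, forall h, comm h x \in H}].
suff : Q 0%N by [].
apply: lcs_ind => [k k0|k [x [Ux xH hx]]].
  by exists x0; split=> // h; rewrite k0 memv0 => /eqP ->; rewrite comm0x mem0v.
pose W (ys : seq 'M[F]_N) x := [/\ U x, {in lcs H k.+1, forall h, comm h x \in H} &
  forall y, y \in ys -> comm y x \in H].
have Wst (ys : seq 'M[F]_N) y x1 : {subset ys <= lcs H k} -> y \in lcs H k ->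
    W ys x1 -> W ys (comm y x1).
  move=> hys yk [U1 h1 h2]; have yH := subvP (lcs_sub k) _ yk; split; first exact: Ust.
    move=> z zk; rewrite jacobi rpredD //; last by apply: Halg => //; apply: h1.
    by apply: h1; rewrite commC rpredN; apply/(subvP (lcs_subS _))/lcs_mem.
  move=> z zys; rewrite jacobi rpredD //; last by apply: Halg => //; apply: h2.
  by apply: h1; apply: lcs_mem => //; apply/(subvP (lcs_sub k))/hys.
suff : forall ys : seq 'M[F]_N, {subset ys <= lcs H k} ->
    exists2 x, x \notin H & W ys x.
  move=> /(_ (vbasis (lcs H k))) [y /vbasis_mem //|x1 x1H [U1 _ h]].
  exists x1; split=> // y yk; rewrite (coord_vbasis yk) comm_suml memv_suml // => i _.
  by rewrite commZl memvZ // h // mem_nth // size_tuple.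
elim=> [_|y ys IH hys]; first by exists x.
have hys' : {subset ys <= lcs H k} by move=> z zys; apply: hys; rewrite inE zys orbT.
have yk : y \in lcs H k by apply: hys; rewrite mem_head.
have yH := subvP (lcs_sub k) _ yk.
have [x1 x1H Wx1] := IH hys'.
have [|m hm] := Unil y x1 yH; first by case: Wx1.
(* The last iterate lying outside H is the vector sought, and the iteration preserves [W ys]. *)
have : iter m (comm y) x1 \in H by rewrite hm mem0v.
elim: m {hm} x1 x1H Wx1 => [|m IHm] x1 x1H Wx1; first by move=> /= h; case/negP: x1H.
rewrite iterSr; have [c1|c1] := boolP (comm y x1 \in H).
  move=> _; exists x1 => //; case: Wx1 => U1 h1 h2; split=> // z.
  by rewrite inE => /orP[/eqP ->|/h2].
exact: IHm (Wst _ _ _ hys' yk Wx1).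
Qed.

End LowerCentral.

Section CartanDiag.
Variables (F : numClosedFieldType) (n' : nat).
Local Notation n := n'.+1.
Variables (S : 'M[F]_n) (H : {vspace 'M[F]_n}).
Implicit Types (x y h s t : 'M[F]_n).
Hypothesis Su : S \in unitmx.
Hypothesis Ssk : S^T = - S.
Local Notation sp := (adj_eigen S (-1)).
Hypothesis Hcar : is_cartan sp H.

Let Hsp x : x \in H -> x \in sp. Proof. by case: Hcar => /subvP h _ _ _; apply: h. Qed.
Let Halg : is_subalgebra H. Proof. by case: Hcar. Qed.
Let Hnil : is_nilpotent_lie H. Proof. by case: Hcar. Qed.
Let Hnorm x : x \in sp -> {in H, forall h, comm h x \in H} -> x \in H.
Proof.
by case: Hcar => _ _ _ hn xs hx; apply: hn => // h hH; rewrite commC rpredN hx.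
Qed.

Lemma cartan_semisimple_central h s : h \in H -> diagonalizable s ->
  (forall y, comm h y = 0 -> comm s y = 0) -> {in H, forall y, comm s y = 0}.
Proof.
move=> hH sd hs; suff : {in lcs H 0, forall y, comm s y = 0} by [].
apply: (lcs_ind Hnil (Q := fun k => {in lcs H k, forall y, comm s y = 0})).
  by move=> k k0 y; rewrite k0 memv0 => /eqP ->; rewrite commx0.
(* [h, y] lies in the next term, so s commutes with it; as [s, h] = 0, h commutes with [s, y], and
   by assumption on s so does s. *)
move=> k IH y yk; apply: diagonalizable_ad2 => //; apply: (hs).
have := IH _ (lcs_mem hH yk); rewrite jacobi => hj.
have hsh : comm s h = 0 by apply: hs; rewrite commxx.
by rewrite hsh comm0x add0r in hj.
Qed.

Lemma cartan_jordan h : h \in H -> exists s, [/\ s \in H, diagonalizable s,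
  nilpotent_mx (h - s) & {in H, forall y, comm s y = 0}].
Proof.
move=> hH; have [s [ssp sd hn hs]] := jordan_decomposition Su (Hsp hH).
have sc := cartan_semisimple_central hH sd hs.
exists s; split=> //; apply: Hnorm => // y yH.
by rewrite commC sc // oppr0 mem0v.
Qed.

Lemma diagonalizable_central t : t \in H -> diagonalizable t ->
  {in H, forall y, comm t y = 0}.
Proof. by move=> tH td; apply: (cartan_semisimple_central tH td). Qed.

(** The centralizer, among all matrices, of the semisimple elements of H: the block diagonal
    matrices in a common eigenbasis. *)
Definition block x := forall t, t \in H -> diagonalizable t -> comm t x = 0.

Lemma block_adj x : block x -> block (adjm S x).
Proof.
move=> bx t tH td; have /adj_eigenP at_ := Hsp tH.
have := adjm_comm Su t x; rewrite bx // linear0 at_ commZl scaleN1r => /eqP.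
by rewrite opprK eq_sym => /eqP.
Qed.

(** On this centralizer h acts like its nilpotent part, its semisimple part acting by 0. If x were
    outside H, Engel's argument would give an element outside H that normalizes H. *)
Lemma block_cartan x : x \in sp -> block x -> x \in H.
Proof.
move=> xs bx; apply: contrapT => /negP xH.
have [||||y [[ys _] /negP yH hy]] := @engel _ _ H Halg Hnil (fun y => y \in sp /\ block y) x.
- move=> h y hH [ys yb]; split; first by apply: comm_adj_eigen => //; apply: Hsp.
  move=> t tH td; rewrite jacobi (diagonalizable_central tH td hH) (yb t) //.
  by rewrite commx0 comm0x addr0.
- move=> h y hH [_ yb]; have [s [sH sd sn sc]] := cartan_jordan hH.
  have [m hm] := ad_nilpotent y sn; exists m; rewrite -[RHS]hm.
  have hc : comm (h - s) s = 0.
    by rewrite commC commBr commxx subr0 sc ?oppr0.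
  elim: m {hm} => //= m ->; set z := iter m _ y.
  suff sz : comm s z = 0 by rewrite -{1}(subrK s h) commDl sz addr0.
  rewrite /z; elim: m {z} => [|m IH]; first exact: yb.
  by rewrite iterS jacobi [comm s _]commC hc oppr0 comm0x IH commx0 addr0.
- by split.
- by [].
by apply: yH; apply: Hnorm.
Qed.

Lemma cartan_block x : x \in H -> block x.
Proof. by move=> xH t tH td; apply: diagonalizable_central. Qed.

(* A linear span of semisimple elements of H has bounded dimension, so finitely
   many of them span all the others. *)
Lemma cartan_codiag : exists2 P : 'M[F]_n, P \in unitmx &
  forall t, t \in H -> diagonalizable t -> is_diag_mx (P *m t *m invmx P).
Proof.
pose good (ts : seq 'M[F]_n) := forall t, t \in ts -> t \in H /\ diagonalizable t.
pose D k := `[< exists ts, good ts /\ \dim <<ts>> = k >].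
have D0 : exists k, D k by exists 0%N; apply/asboolP; exists [::]; rewrite span_nil dimv0.
have Db k : D k -> (k <= \dim {:'M[F]_n})%N.
  by move/asboolP => [ts [_ <-]]; apply/dimvS/subvf.
case: (ex_maxnP D0 Db) => k /asboolP[ts [gts dts]] kmax.
have spant t : t \in H -> diagonalizable t -> t \in <<ts>>%VS.
  move=> tH td; apply: contrapT => tts.
  have : D (\dim <<t :: ts>>).
    by apply/asboolP; exists (t :: ts); split=> // u; rewrite inE => /orP[/eqP ->|/gts].
  move/kmax; rewrite -dts span_cons => hdim; apply: tts.
  have /eqP -> : (<<ts>> == <[t]> + <<ts>>)%VS by rewrite eqEdim addvSr hdim.
  exact: subvP (addvSl _ _) _ (memv_line t).
have [P Pu /allP hP] : exists2 P, P \in unitmx & all [pred A | similar_diag P A] ts.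
  apply/codiagonalizableP; split=> [f g fts gts'|f /gts[]//].
  apply/comm_eq0P; apply: diagonalizable_central; first by case: (gts _ fts).
    by case: (gts _ fts).
  by case: (gts _ gts').
exists P => // t tH td.
have := spant t tH td; rewrite -[ts]in_tupleE => /coord_span ->.
rewrite mulmx_sumr mulmx_suml; apply/is_diag_mxP => i j ij; rewrite summxE big1 // => m _.
rewrite -scalemxAr -scalemxAl mxE.
have /= := hP _ (mem_nth 0 (ltn_ord m : (m < size ts)%N)).
by rewrite /similar_to conjumx // => /is_diag_mxP ->; rewrite ?mulr0.
Qed.

Variable P : 'M[F]_n.
Hypothesis Pu : P \in unitmx.
Hypothesis Pdiag : forall t, t \in H -> diagonalizable t -> is_diag_mx (P *m t *m invmx P).
Local Notation cj x := (P *m x *m invmx P).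

Definition same i j :=
  `[< forall t, t \in H -> diagonalizable t -> (cj t) i i = (cj t) j j >].

Lemma blockP x : block x <-> forall i j, ~~ same i j -> (cj x) i j = 0.
Proof.
have key t : t \in H -> diagonalizable t -> exists d, cj t = diag_mx d.
  by move=> tH td; apply/diag_mxP/Pdiag.
split=> [bx i j /negP sij|bx t tH td].
  apply: contrapT => xij; apply: sij; apply/asboolP => t tH td.
  have [d hd] := key t tH td; rewrite hd.
  have := cj_comm Pu t x; rewrite bx // mulmx0 mul0mx hd => /matrixP/(_ i j).
  rewrite comm_diagE mxE => /esym/eqP; rewrite mulf_eq0 subr_eq0 => /orP[/eqP h|/eqP //].
  by rewrite !mxE !eqxx h.
have [d hd] := key t tH td; apply: (cj_inj Pu); rewrite cj_comm // mulmx0 mul0mx hd.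
apply/matrixP => i j; rewrite comm_diagE [RHS]mxE.
have [/asboolP/(_ t tH td)|/bx ->] := boolP (same i j); last by rewrite mulr0.
by rewrite hd !mxE !eqxx !mulr1n => ->; rewrite subrr mul0r.
Qed.

Lemma same_refl i : same i i. Proof. by apply/asboolP. Qed.
Lemma same_sym i j : same i j = same j i.
Proof. by apply/asboolP/asboolP => h t tH td; rewrite h. Qed.
Lemma same_trans i j k : same i j -> same j k -> same i k.
Proof. by move=> /asboolP h /asboolP h'; apply/asboolP => t tH td; rewrite h // h'. Qed.

Lemma mxtrace_mul_delta (A : 'M[F]_n) i j : \tr (A *m delta_mx j i) = A i j.
Proof.
rewrite -(mul_delta_mx (0 : 'I_1)) mulmxA mxtrace_mulC /mxtrace big_ord1 mulmxA.
by rewrite -rowE -colE !mxE.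
Qed.

(* For a block matrix m, m - adj m is again a block matrix and lies in the
   symplectic algebra, hence in H. *)
Lemma trace_nondeg x : x \in H -> {in H, forall y, \tr (x *m y) = 0} -> x = 0.
Proof.
move=> xH hx; have xb := cartan_block xH.
have bm m : block m -> \tr (x *m m) = 0.
  move=> mb; have : m - adjm S m \in H.
    have adjK : adjm S (adjm S m) = m.
      by apply: (adjmK Su (e := -1)); rewrite ?scaleN1r ?mulrNN ?mulr1.
    apply: block_cartan; first by apply/adj_eigenP; rewrite linearB /= adjK scaleN1r opprB.
    by move=> t tH td; rewrite commBr mb // block_adj // subrr.
  move/hx; rewrite mulmxBr linearB /=.
  have /adj_eigenP ax := Hsp xH; rewrite scaleN1r in ax.
  have -> : \tr (x *m adjm S m) = - \tr (x *m m).
    by rewrite -[x in LHS]opprK -ax mulNmx linearN -adjmM //= mxtrace_adj // mxtrace_mulC.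
  by rewrite opprK -mulr2n -mulr_natl => /eqP; rewrite mulf_eq0 pnatr_eq0 => /eqP.
apply: (cj_inj Pu); rewrite mulmx0 mul0mx; apply/matrixP => i j; rewrite [RHS]mxE.
have [sij|/(proj1 (blockP x) xb) //] := boolP (same i j).
have : \tr (x *m (invmx P *m delta_mx j i *m P)) = 0.
  apply: bm; apply/blockP => a b; rewrite cjVK // mxE; case: eqP => //= ->; case: eqP => //= ->.
  by rewrite same_sym sij.
by rewrite (cj_trace Pu) cjVK // mxtrace_mul_delta.
Qed.

(** It suffices that the semisimple part s vanishes. Let e be the projector onto a joint eigenspace.
    It centralizes H, so tr(e x) = 0 because x is a sum of brackets, and tr(e (x - s)) = 0 by
    nilpotency. Hence tr(e s) = 0, which is the eigenvalue of s there times the rank of e. *)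
Lemma lcs1_nilpotent x : x \in lcs H 1 -> nilpotent_mx x.
Proof.
move=> x1; have xH : x \in H by apply: (subvP (lcs_sub Halg 1)).
have [s [sH sd sn sc]] := cartan_jordan xH.
suff s0 : s = 0 by rewrite -[x]subr0 -s0.
apply: (cj_inj Pu); rewrite mulmx0 mul0mx.
apply/matrixP => i j; rewrite [RHS]mxE.
have [<-|ij] := eqVneq i j; last by have /is_diag_mxP -> := Pdiag sH sd.
pose d : 'rV[F]_n := \row_k (same k i)%:R.
pose e := invmx P *m diag_mx d *m P.
have ec y : y \in H -> comm e y = 0.
  move=> yH; apply: (cj_inj Pu); rewrite cj_comm // cjVK // mulmx0 mul0mx.
  apply/matrixP => a b; rewrite comm_diagE [RHS]mxE [d 0 a]mxE [d 0 b]mxE.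
  have [sab|/(proj1 (blockP y) (cartan_block yH)) ->] := boolP (same a b); last by rewrite mulr0.
  suff -> : same a i = same b i by rewrite subrr mul0r.
  by apply/idP/idP; apply: same_trans; rewrite // same_sym.
have trx : \tr (e *m x) = 0.
  apply: (@lie_prod_scalar _ _ H H (mxtrace \o mulmx e)) x1 => y z yH zH /=.
  rewrite commE mulmxBr linearB /= !mulmxA.
  have /comm_eq0P -> := ec y yH.
  by rewrite -[y *m e *m z]mulmxA [\tr (y *m _)]mxtrace_mulC subrr.
have trn : \tr (e *m (x - s)) = 0.
  rewrite mxtrace_mulC mxtrace_nilpotent //; apply: nilpotent_mul => //.
  by rewrite commC ec ?oppr0 // rpredB.
move: trn; rewrite mulmxBr linearB /= trx sub0r => /eqP; rewrite oppr_eq0 => /eqP.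
rewrite (cj_trace Pu) cjVK // /mxtrace.
under eq_bigr => k _ do rewrite mul_diag_mx mxE [d 0 k]mxE.
rewrite (eq_bigr (fun k => (same k i)%:R * (cj s) i i)); last first.
  move=> k _; have [/asboolP ->//|_] := boolP (same k i); by rewrite !mul0r.
rewrite -mulr_suml => /eqP; rewrite mulf_eq0 => /orP[|/eqP //].
rewrite -natr_sum pnatr_eq0 sum_nat_eq0 => /forallP/(_ i).
by rewrite same_refl.
Qed.

(** A term of the lower central series that is followed by 0 is central in H. From index 1 on it
    consists of nilpotent elements, so it is orthogonal to H for the trace form and therefore 0.
    This descends to index 1. *)
Lemma cartan_abelian : {in H &, forall x y, comm x y = 0}.
Proof.
suff D1 : lcs H 1 = 0%VS.
  by move=> x y xH yH; apply/eqP; rewrite -memv0 -D1; apply: lie_prod_mem.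
have [m hm] := Hnil; have : lcs H m.+1 = 0%VS.
  by apply/eqP; rewrite -subv0 -hm; apply: lcs_subS.
elim: m {hm} => // m IH hm; apply: IH.
apply/eqP; rewrite -subv0; apply/subvP => x xm; rewrite memv0; apply/eqP.
have xH := subvP (lcs_sub Halg _) _ xm.
have x1 : x \in lcs H 1.
  by elim: (m) xm => // k IHk xk; apply: IHk; apply: (subvP (lcs_subS Halg _)).
apply: trace_nondeg => // y yH; apply/mxtrace_nilpotent/nilpotent_mul.
  by apply/eqP; rewrite commC oppr_eq0 -memv0 -hm; apply: lcs_mem.
exact: lcs1_nilpotent.
Qed.

(** The nilpotent part of x lies in H and commutes with H, so it is in the radical of the trace
    form. *)
Lemma cartan_diag x : x \in H -> is_diag_mx (cj x).
Proof.
move=> xH; have [s [sH sd sn sc]] := cartan_jordan xH.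
suff /eqP : x - s = 0 by rewrite subr_eq0 => /eqP ->; apply: Pdiag.
apply: trace_nondeg; first by rewrite rpredB.
move=> y yH; apply/mxtrace_nilpotent/nilpotent_mul => //.
by rewrite cartan_abelian // rpredB.
Qed.

End CartanDiag.

Lemma card_involution (T : finType) (f : T -> T) (A : {set T}) : involutive f ->
  (forall x, (f x \in A) = (x \notin A)) -> (#|A| + #|A| = #|T|)%N.
Proof.
move=> fK fA; rewrite -(cardsC A) -(card_imset (mem A) (inv_inj fK)).
congr (_ + _)%N; apply: eq_card => x; rewrite inE.
apply/imsetP/idP => [[y yA ->]|xA]; first by rewrite fA negbK.
by exists (f x); rewrite ?fK // fA.
Qed.

(** List the points that are smaller than their images, then these images in reverse order. *)
Lemma involution_rev_ord n (f : 'I_n -> 'I_n) : involutive f -> (forall i, f i != i) ->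
  exists s : 'S_n, forall i, f (s i) = s (rev_ord i).
Proof.
case: n f => [|n] f fK f0; first by exists 1%g => -[].
pose A := [set i : 'I_n.+1 | (i < f i)%N].
have fA x : (f x \in A) = (x \notin A).
  by rewrite !inE fK -leqNgt ltn_neqAle (_ : f x != x :> nat) // f0.
have cA : (#|A| + #|A| = n.+1)%N by rewrite (card_involution fK fA) card_ord.
pose e := enum A ++ rev (map f (enum A)).
have se : size e = n.+1 by rewrite size_cat size_rev size_map -cardE.
have ue : uniq e.
  rewrite cat_uniq rev_uniq (map_inj_uniq (inv_inj fK)) enum_uniq /= andbT.
  apply/hasPn => x; rewrite mem_rev => /mapP[y yA ->] /=.
  by rewrite mem_enum fA negbK -mem_enum.
pose g (i : 'I_n.+1) := nth ord0 e i.
have g_inj : injective g.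
  by move=> i j /eqP; rewrite nth_uniq ?se // => /eqP /val_inj.
exists (perm g_inj) => i; rewrite !permE.
have sA : size (enum A) = #|A| by rewrite -cardE.
move: #|A| cA sA => a cA sA.
have gen (k : 'I_n.+1) : (k < a)%N -> f (g k) = g (rev_ord k).
  move=> ka; rewrite /g /e !nth_cat sA ka /=.
  have -> : (n.+1 - k.+1 < a)%N = false by apply/negbTE; lia.
  rewrite nth_rev size_map sA; last by lia.
  by rewrite (nth_map ord0) ?sA; [congr (f (nth _ _ _)); lia|lia].
have [/gen//|ka] := ltnP i a.
have := gen (rev_ord i); rewrite rev_ordK => <- /=; first by rewrite fK.
by have := ltn_ord i; lia.
Qed.

(** * Antidiagonal normal form in an eigenbasis of the Cartan subalgebra *)

Section NormalForm.
Variables (F : numClosedFieldType) (n' : nat).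
Local Notation n := n'.+1.
Variables (S : 'M[F]_n) (H : {vspace 'M[F]_n}).
Implicit Types (x y h : 'M[F]_n).
Hypothesis Su : S \in unitmx.
Hypothesis Ssk : S^T = - S.
Local Notation sp := (adj_eigen S (-1)).
Hypothesis Hcar : is_cartan sp H.
Variable P : 'M[F]_n.
Hypothesis Pu : P \in unitmx.
Local Notation cj x := (P *m x *m invmx P).
Local Notation S' := (P *m S *m P^T).

Hypothesis Hdiag : forall x, x \in H -> is_diag_mx (cj x).

Lemma cartan_diagP x : (x \in H) = (x \in sp) && is_diag_mx (cj x).
Proof.
case: Hcar => Hs _ _ hn; apply/idP/andP => [xH|[xs /diag_mxP[d hd]]].
  by split; [exact: subvP Hs _ xH|exact: Hdiag].
apply: hn => // h hH; suff -> : comm x h = 0 by rewrite mem0v.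
apply: (cj_inj Pu); rewrite cj_comm // hd mulmx0 mul0mx.
have /diag_mxP[d' ->] := Hdiag hH.
apply/matrixP => i j; rewrite comm_diagE !mxE.
by case: eqP => [->|_]; rewrite ?subrr ?mul0r // mulr0n mulr0.
Qed.

(** Entry (i, j) of D S' + S' D = 0, with D the diagonal form of h. *)
Lemma cartan_form_weight h i j : h \in H -> S' i j != 0 -> (cj h) i i = - (cj h) j j.
Proof.
move=> hH hij; have /diag_mxP[d hd] := Hdiag hH.
have : cj h \in adj_eigen S' (-1) by rewrite adj_eigen_cj //; case: Hcar => /subvP hs _ _ _; exact: hs.
move/(adj_eigenN1P (congr_unitmx Pu Su))/matrixP/(_ i j).
rewrite hd tr_diag_mx mul_diag_mx mul_mx_diag.
move: (S') hij => M hij; rewrite !mxE [_ * M i j]mulrC -mulrDr => /eqP.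
rewrite mulf_eq0 (negPf hij) addr_eq0 => /eqP h0.
by rewrite !eqxx !mulr1n.
Qed.

Lemma cartan_invform_weight h i j : h \in H -> (invmx S') i j != 0 ->
  (cj h) i i = - (cj h) j j.
Proof.
move=> hH hij; have /diag_mxP[d hd] := Hdiag hH.
have : cj h \in adj_eigen S' (-1) by rewrite adj_eigen_cj //; case: Hcar => /subvP hs _ _ _; exact: hs.
move/(sp_invmx (congr_unitmx Pu Su))/matrixP/(_ i j).
rewrite hd tr_diag_mx mul_diag_mx mul_mx_diag.
move: (invmx S') hij => M hij; rewrite !mxE => /eqP.
rewrite -addr_eq0 [_ * M i j]mulrC -mulrDr mulf_eq0 (negPf hij) addrC addr_eq0 => /eqP h0.
by rewrite !eqxx !mulr1n.
Qed.

Lemma matrix_row_neq0 (M : 'M[F]_n) i : M \in unitmx -> exists j, M i j != 0.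
Proof.
move=> Mu; apply: contrapT => hn; have r0 : row i M = 0.
  apply/rowP => j; rewrite !mxE; apply: contrapT => /eqP h.
  by apply: hn; exists j.
have := congr1 (mulmx^~ (invmx M)) r0; rewrite mul0mx rowE mulmxK // => /matrixP/(_ 0 i)/eqP.
by rewrite !mxE !eqxx oner_eq0.
Qed.

(* If all of H had equal i-th and j-th eigenvalues, a non-diagonal element of the
   symplectic algebra would commute with H. *)
Lemma cartan_sep i j : i != j -> exists2 h, h \in H & (cj h) i i != (cj h) j j.
Proof.
move=> ij; apply: contrapT => hn.
have eqij h : h \in H -> (cj h) i i = (cj h) j j.
  by move=> hH; apply: contrapT => /eqP hne; apply: hn; exists h.
pose Q := invmx S'.
have Qsk a b : Q a b = - Q b a.
  have /matrixP/(_ b a) := invmx_skew (congr_unitmx Pu Su) (congr_skew P Ssk).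
  by rewrite mxE => ->; rewrite mxE.
have [k hk] : exists k, Q j k != 0 by apply: matrix_row_neq0; rewrite unitmx_inv congr_unitmx.
(* [k] carries the eigenvalue opposite to that of j, so y' has weight the i-th plus the k-th
   eigenvalue, which is the i-th minus the j-th, that is 0 under the assumption. *)
pose y' := rk2 S' 1 (delta_mx i 0) (delta_mx k 0).
have yE a b : y' a b = (a == i)%:R * Q k b + (a == k)%:R * Q i b.
  rewrite /y' /rk2 scale1r !trmx_delta !mul_delta_mx -/Q mulmxDl mxE.
  have dE (p q : 'I_n) : (delta_mx p q *m Q) a b = (a == p)%:R * Q q b.
    rewrite mxE (bigD1 q) //= big1 => [|m /negPf mq]; rewrite mxE ?eqxx ?andbT ?addr0 //.
    by rewrite mq andbF mul0r.
  by rewrite !dE.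
have : invmx P *m y' *m P \in H.
  case: Hcar => _ _ _; apply.
    rewrite -(adj_eigen_cj Pu) // cjVK //; apply: rk2_adj; rewrite ?mulr1 //.
      exact: congr_unitmx.
    exact: congr_skew.
  move=> h hH; suff -> : comm (invmx P *m y' *m P) h = 0 by rewrite mem0v.
  apply/eqP; rewrite commC oppr_eq0; apply/eqP; apply: (cj_inj Pu).
  rewrite cj_comm // cjVK // mulmx0 mul0mx; have /diag_mxP[d hd] := Hdiag hH.
  have dE a : d 0 a = (cj h) a a by rewrite hd !mxE eqxx mulr1n.
  have dQ a b : Q a b != 0 -> d 0 a = - d 0 b.
    by rewrite !dE; apply: cartan_invform_weight.
  have dij : d 0 i = d 0 j by rewrite !dE eqij.
  rewrite hd; apply/matrixP => a b; rewrite comm_diagE yE [RHS]mxE.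
  have t1 : (d 0 a - d 0 b) * ((a == i)%:R * Q k b) = 0.
    have [->|_] := eqVneq a i; last by rewrite mul0r mulr0.
    have [->|/dQ hkb] := eqVneq (Q k b) 0; first by rewrite !mulr0.
    by rewrite dij (dQ _ _ hk) hkb opprK subrr mul0r.
  have t2 : (d 0 a - d 0 b) * ((a == k)%:R * Q i b) = 0.
    have [->|_] := eqVneq a k; last by rewrite mul0r mulr0.
    have [->|/dQ hib] := eqVneq (Q i b) 0; first by rewrite !mulr0.
    by move: (dQ _ _ hk); rewrite -dij hib => /oppr_inj ->; rewrite subrr mul0r.
  by rewrite mulrDr t1 t2 addr0.
(* The entry (i, j) of y' is Q k j, doubled if i = k, hence nonzero off the diagonal. *)
move/Hdiag; rewrite cjVK // => /is_diag_mxP/(_ i j ij) /eqP.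
rewrite yE eqxx mul1r [Q k j]Qsk.
have [ik|_] := eqVneq i k; last by rewrite mul0r addr0 oppr_eq0 (negPf hk).
by rewrite mul1r ik [Q k j]Qsk -opprD oppr_eq0 -mulr2n -mulr_natl mulf_eq0 pnatr_eq0 (negPf hk).
Qed.

(** Since the eigenvalues are distinct functions on H, only one index carries the opposite of the
    i-th one, so each row of the form has a single nonzero entry. Skewness excludes fixed points and
    makes the pairing involutive. *)
Lemma form_involution : exists f : 'I_n -> 'I_n, [/\ involutive f, forall i, f i != i &
  forall i j, (S' i j != 0) = (j == f i)].
Proof.
have ex i : exists j, S' i j != 0 := matrix_row_neq0 i (congr_unitmx Pu Su).
pose f i := xchoose (ex i).
have sk a b : S' a b = - S' b a.
  by have /matrixP/(_ b a) := congr_skew P Ssk; rewrite mxE => ->; rewrite mxE.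
have fP i j : (S' i j != 0) = (j == f i).
  have hf := xchooseP (ex i); apply/idP/eqP => [hij|->]; last exact: hf.
  apply: contrapT => /eqP /cartan_sep[h hH /eqP]; apply; apply: oppr_inj.
  by rewrite -(cartan_form_weight hH hij) (cartan_form_weight hH hf).
exists f; split=> // [i|i].
  by apply/eqP; rewrite eq_sym -fP sk oppr_eq0 fP.
apply/eqP => fi; have := fP i i; rewrite fi eqxx => /eqP/eqP.
have /eqP := sk i i; rewrite -addr_eq0 -mulr2n -mulr_natl mulf_eq0 pnatr_eq0 /= => /eqP ->.
by rewrite eqxx.
Qed.

End NormalForm.

Lemma cartan_normal_form (F : numClosedFieldType) (n : nat) (S : 'M[F]_n)
    (H : {vspace 'M[F]_n}) : (0 < n)%N -> S \in unitmx -> S^T = - S ->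
    is_cartan (adj_eigen S (-1)) H ->
  exists P : 'M[F]_n, [/\ P \in unitmx,
    forall i j, ((P *m S *m P^T) i j != 0) = (j == rev_ord i) &
    forall x, (x \in H) = (x \in adj_eigen S (-1)) && is_diag_mx (P *m x *m invmx P)].
Proof.
case: n S H => // n S H _ Su Ssk Hcar.
have [P Pu hP] := cartan_codiag Hcar.
have Hdiag := cartan_diag Su Ssk Hcar Pu hP.
have [f [fK f0 fS]] := form_involution Su Ssk Hcar Pu Hdiag.
have [s hs] := involution_rev_ord fK f0.
have permM (A : 'M[F]_n.+1) : perm_mx s *m A *m perm_mx s^-1 = row_perm s (col_perm s A).
  by rewrite row_permE col_permE mulmxA.
have Psu : perm_mx s \in unitmx := unitmx_perm F s.
exists (perm_mx s *m P); split=> [|i j|x].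
- by rewrite unitmx_mul Psu.
- rewrite trmx_mul tr_perm_mx (_ : _ *m _ = perm_mx s *m (P *m S *m P^T) *m perm_mx s^-1).
    rewrite permM; move: (P *m S *m P^T) fS => M fS.
    by rewrite !mxE fS hs (inj_eq perm_inj).
  by rewrite !mulmxA.
rewrite (cartan_diagP Hcar Pu Hdiag); congr (_ && _).
have -> : invmx (perm_mx s *m P) = invmx P *m perm_mx s^-1.
  rewrite [LHS](invrM Psu Pu); congr (_ *m _).
  by rewrite -[RHS]mul1mx -(mulVmx Psu) -mulmxA -perm_mxM mulgV perm_mx1 mulmx1.
rewrite (_ : perm_mx s *m P *m x *m _ =
  perm_mx s *m (P *m x *m invmx P) *m perm_mx s^-1); last by rewrite !mulmxA.
rewrite permM; move: (P *m x *m invmx P) => M.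
have s_neq (t : 'S_n.+1) (i j : 'I_n.+1) : i != j :> nat -> t i != t j :> nat.
  by rewrite !val_eqE (inj_eq perm_inj).
apply/is_diag_mxP/is_diag_mxP => h i j /s_neq ij; first by rewrite !mxE h.
by have := h (s^-1 i)%g (s^-1 j)%g (ij _); rewrite !mxE !permKV.
Qed.

Lemma rev_ord_neq l (i : 'I_(2 * l)) : rev_ord i != i.
Proof. by rewrite -val_eqE /=; have := ltn_ord i; lia. Qed.

Lemma sub_lfunE (F : fieldType) (aT rT : vectType F) (f g : 'Hom(aT, rT)) x :
  (f - g) x = f x - g x.
Proof. by rewrite add_lfunE opp_lfunE. Qed.

(** * Weights of a diagonal torus *)

Section AntidiagonalForm.
Variables (F : fieldType) (l : nat) (T : 'M[F]_(2 * l)).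
Hypothesis Tu : T \in unitmx.
Hypothesis TP : forall i j, (T i j != 0) = (j == rev_ord i).

Lemma skew_entry i j : T^T = - T -> T i j = - T j i.
Proof. by move/matrixP/(_ j i); rewrite mxE => ->; rewrite mxE. Qed.

Lemma invmx_antidiag i j : invmx T i j = if j == rev_ord i then (T j i)^-1 else 0.
Proof.
have -> : invmx T = \matrix_(a, b) if b == rev_ord a then (T b a)^-1 else 0.
  rewrite -[LHS]mulmx1; apply: (canLR (mulKmx Tu)).
  apply/matrixP => a b; rewrite [LHS]mxE mxE (bigD1 (rev_ord a)) //= big1 ?addr0 => [|k ka].
    rewrite mxE rev_ordK; case: (eqVneq b a) => [->|ba]; last by rewrite mulr0.
    by rewrite mulfV ?TP ?eqxx.
  by have := TP a k; rewrite (negPf ka) => /negbFE/eqP ->; rewrite mul0r.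
by rewrite mxE.
Qed.

Lemma adjm_antidiag y i j : adjm T y i j =
  T i (rev_ord i) * (T j (rev_ord j))^-1 * y (rev_ord j) (rev_ord i).
Proof.
rewrite /adjm mxE (bigD1 (rev_ord j)) //= big1 ?addr0 => [|k kj]; last first.
  by rewrite invmx_antidiag -(inv_eq (@rev_ordK _)) eq_sym (negPf kj) mulr0.
rewrite invmx_antidiag rev_ordK eqxx mxE (bigD1 (rev_ord i)) //= big1 ?addr0 => [|k ki].
  by rewrite mxE mulrAC.
by have := TP i k; rewrite (negPf ki) => /negbFE/eqP ->; rewrite mul0r.
Qed.
End AntidiagonalForm.

(** * Coordinates, dual form and weights of an embedded torus *)

Section EmbeddedTorus.
Variables (F : numClosedFieldType) (l N : nat).
Local Notation n := (2 * l)%N.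
Variables (e0 : {linear 'M[F]_n -> 'M[F]_N}) (r0 : {linear 'M[F]_N -> 'M[F]_n}).
Hypothesis e0K : cancel e0 r0.
Variables (S P : 'M[F]_n) (H : {vspace 'M[F]_N}).
Hypothesis Pu : P \in unitmx.
Local Notation S' := (P *m S *m P^T).
Local Notation cj x := (P *m x *m invmx P).
Hypothesis Su : S \in unitmx.
Hypothesis Ssk : S^T = - S.
Hypothesis formP : forall i j, (S' i j != 0) = (j == rev_ord i).
Hypothesis memH : forall x, reflect
  (exists2 a, x = e0 a & (a \in adj_eigen S (-1)) && is_diag_mx (cj a)) (x \in H).
Implicit Types (i j k : 'I_n) (h : subvs_of H) (alpha beta : dual H).

Definition weight_coord i h : F^o := cj (r0 (vsval h)) i i.

Lemma weight_coord_linear i : linear (weight_coord i).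
Proof.
move=> a h h'; rewrite /weight_coord [vsval _]linearP [r0 _]linearP /= mulmxDr mulmxDl.
by rewrite -scalemxAr -scalemxAl [LHS]mxE [X in X + _]mxE.
Qed.
HB.instance Definition _ i :=
  GRing.isLinear.Build F (subvs_of H) F^o *:%R (weight_coord i) (weight_coord_linear i).

Definition theta i : dual H := linfun (weight_coord i).

Lemma thetaE i h : theta i h = cj (r0 (vsval h)) i i.
Proof. by rewrite lfunE. Qed.

Lemma torus_repr h : cj (r0 (vsval h)) = diag_mx (\row_i (theta i h : F)).
Proof.
have /memH[a ha /andP[_ /diag_mxP[d hd]]] := subvsP h.
by apply/matrixP => i j; rewrite [RHS]mxE [X in X *+ _]mxE thetaE ha e0K hd !mxE eqxx mulr1n.
Qed.

Lemma theta_rev i h : theta (rev_ord i) h = - theta i h.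
Proof.
have /memH[a ha /andP[sa _]] := subvsP h.
have := torus_repr h; rewrite ha e0K => hd.
move: sa; rewrite -(adj_eigen_cj Pu) // hd.
move/(adj_eigenN1P (congr_unitmx Pu Su))/matrixP/(_ i (rev_ord i)).
rewrite tr_diag_mx mul_diag_mx mul_mx_diag.
have := formP i (rev_ord i); rewrite eqxx; move: (S') => M M0; rewrite !mxE.
rewrite [_ * M i _]mulrC -mulrDr => /eqP; rewrite mulf_eq0 (negPf M0) addrC addr_eq0 /=.
by move/eqP.
Qed.

(** The factor 1/2 compensates for the sums over all 2l indices, where k and its mirror index
    contribute the same term. *)
Definition cotheta_mx k : 'M[F]_n :=
  invmx P *m (2^-1 *: (delta_mx k k - delta_mx (rev_ord k) (rev_ord k))) *m P.

Lemma diag_sp (d : 'rV[F]_n) : (forall i, d 0 (rev_ord i) = - d 0 i) ->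
  invmx P *m diag_mx d *m P \in adj_eigen S (-1).
Proof.
move=> hd; rewrite -(adj_eigen_cj Pu) // cjVK //.
apply/adj_eigenN1P; first exact: congr_unitmx.
rewrite tr_diag_mx mul_diag_mx mul_mx_diag; move: (S') formP => M hM.
apply/matrixP => i j; rewrite !mxE; have := hM i j; case: (j =P rev_ord i) => [-> _|_ /negbFE/eqP ->].
  by rewrite hd mulrN mulrC addrN.
by rewrite mulr0 mul0r addr0.
Qed.

Lemma cotheta_proof k : e0 (cotheta_mx k) \in H.
Proof.
apply/memH; exists (cotheta_mx k) => //; rewrite /cotheta_mx.
pose d : 'rV[F]_n := \row_i (2^-1 * ((i == k)%:R - (i == rev_ord k)%:R)).
have -> : 2^-1 *: (delta_mx k k - delta_mx (rev_ord k) (rev_ord k)) = diag_mx d.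
  apply/matrixP => i j; rewrite !mxE; have [->|ij] := eqVneq i j.
    by rewrite !andbb mulr1n.
  rewrite mulr0n; have nij q : (i == q) && (j == q) = false.
    by apply/negP => /andP[/eqP iq /eqP jq]; rewrite iq jq eqxx in ij.
  by rewrite !nij subrr mulr0.
rewrite cjVK // diag_mx_is_diag andbT; apply: diag_sp => i; rewrite !mxE.
rewrite (inv_eq (@rev_ordK _)) (can_eq (@rev_ordK _)).
by rewrite -mulrN opprB.
Qed.

Definition cotheta k : subvs_of H := Subvs (cotheta_proof k).

Definition pair_coef i k : F := (i == k)%:R - (i == rev_ord k)%:R.

Lemma pair_coef_id i : pair_coef i i = 1.
Proof. by rewrite /pair_coef eqxx eq_sym (negPf (rev_ord_neq i)) subr0. Qed.
Lemma pair_coefC i k : pair_coef i k = pair_coef k i.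
Proof. by rewrite /pair_coef [k == i]eq_sym [k == rev_ord i]eq_sym (inv_eq (@rev_ordK _)). Qed.
Lemma pair_coef_neq i k : i != k -> pair_coef i k = - (k == rev_ord i)%:R.
Proof. by rewrite pair_coefC /pair_coef eq_sym => /negPf ->; rewrite sub0r. Qed.

Lemma theta_cotheta i k : theta i (cotheta k) = 2^-1 * pair_coef i k.
Proof.
rewrite thetaE /= e0K cjVK // !mxE !andbb.
by [].
Qed.

Lemma torus_decomp h : h = \sum_k (theta k h : F) *: cotheta k.
Proof.
apply: val_inj => /=; rewrite linear_sum /=.
have /memH[a ha _] := subvsP h; rewrite ha.
under eq_bigr => k _ do rewrite -linearZ.
rewrite -linear_sum /=; congr (e0 _); apply: (cj_inj Pu).
have := torus_repr h; rewrite ha e0K => ->.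
rewrite mulmx_sumr mulmx_suml; apply/matrixP => i j; rewrite summxE.
under eq_bigr => k _ do rewrite -scalemxAr -scalemxAl cjVK // !mxE.
rewrite !mxE; have [<-|ij] := eqVneq i j; last first.
  rewrite big1 // => k _; have nij q : (i == q) && (j == q) = false.
    by apply/negP => /andP[/eqP iq /eqP jq]; rewrite iq jq eqxx in ij.
  by rewrite !nij subrr !mulr0.
under eq_bigr => k _ do rewrite !andbb -(inv_eq (@rev_ordK _)) mulrBr mulrBr.
rewrite sumrB mulr1n (bigD1 i) //= eqxx mulr1 big1 ?addr0 => [|k ki]; last first.
  by rewrite eq_sym (negPf ki) !mulr0.
rewrite (bigD1 (rev_ord i)) //= eqxx mulr1 big1 ?addr0 => [|k ki]; last first.
  by rewrite eq_sym (negPf ki) !mulr0.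
rewrite theta_rev mulNr opprK -mulrDr -div1r -mulr2n -[_ *+ 2]mulr_natr div1r.
by field.
Qed.

Lemma dual_decomp alpha : alpha = \sum_k (alpha (cotheta k) : F) *: theta k.
Proof.
apply/lfunP => h; rewrite [in LHS](torus_decomp h) linear_sum sum_lfunE.
by apply: eq_bigr => k _; rewrite linearZ scale_lfunE /= /GRing.scale /= mulrC.
Qed.

Lemma cotheta_rev k : cotheta (rev_ord k) = - cotheta k.
Proof.
apply: val_inj => /=; rewrite -[RHS]linearN; congr (e0 _).
by rewrite /cotheta_mx rev_ordK -mulNmx -mulmxN -scalerN opprB.
Qed.

(** A frame of 2l vectors, each contributing theta_k(cotheta_k) = 1/2. *)
Lemma dim_torus : \dim H = l.
Proof.
pose phi (k : 'I_n) : {scalar 'M[F]_N} :=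
  [the {scalar 'M[F]_N} of (mxentry (k, k) \o mulmxr (invmx P) \o mulmx P \o r0)].
have phiE k h : phi k (vsval h) = theta k h by rewrite thetaE.
have decH : {in H, forall x, x = \sum_k phi k x *: vsval (cotheta k)}.
  move=> x xH; have := torus_decomp (Subvs xH) => /(congr1 vsval).
  rewrite linear_sum => /= {1}->; apply: eq_bigr => k _.
  by rewrite -(phiE k (Subvs xH)).
have := dim_frame (fun k => subvsP (cotheta k)) decH.
under eq_bigr => k _ do rewrite phiE theta_cotheta pair_coef_id mulr1.
rewrite sumr_const card_ord -[RHS]mulr_natr natrM mulKf ?pnatr_eq0 // => /eqP.
by rewrite eqr_nat => /eqP.
Qed.

Lemma dim_dual : \dim {: dual H} = l.
Proof. by rewrite -[RHS]dim_torus -[RHS]muln1 dimvf. Qed.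

Section DualForm.
Variables (U : {vspace 'M[F]_N}) (kappa : F).
Hypothesis kappa0 : kappa != 0.
Hypothesis killingE : forall h h', killing U (vsval h) (vsval h') =
  kappa * \sum_i theta i h * theta i h'.

Lemma killing_inner_linear h :
  linear (fun h' : subvs_of H => killing U (vsval h) (vsval h') : F^o).
Proof.
move=> a x y; rewrite !killingE -[X in _ = X + _]/(a * (kappa * \sum_i theta i h * theta i x)).
rewrite mulrCA -mulrDr; congr (_ * _).
rewrite mulr_sumr -big_split; apply: eq_bigr => i _ /=.
have -> : theta i (a *: x + y) = a * theta i x + theta i y by exact: linearP.
by rewrite mulrDr mulrCA.
Qed.

(** [killing_map] applies [linfun] to bare functions, which evaluates as expected once they are
    known to be linear; linearity in both arguments comes from [killingE]. *)
Lemma killing_mapE h h' : killing_map U H h h' = killing U (vsval h) (vsval h').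
Proof.
pose g h : dual H :=
  linfun (fun h' : subvs_of H => killing U (vsval h) (vsval h') : F^o).
have gE x y : g x y = killing U (vsval x) (vsval y).
  pose L := HB.pack_for {linear subvs_of H -> F^o}
    (fun h' : subvs_of H => killing U (vsval x) (vsval h') : F^o)
    (GRing.isLinear.Build _ _ _ _ _ (killing_inner_linear x)).
  exact: (lfunE L).
have glin : linear g.
  move=> a x y; apply/lfunP => z; rewrite add_lfunE scale_lfunE !gE.
  have Ksym (u v : subvs_of H) : killing U (vsval u) (vsval v) = killing U (vsval v) (vsval u).
    by rewrite !killingE; congr (_ * _); apply: eq_bigr => i _; rewrite mulrC.
  by rewrite (Ksym _ z) (Ksym x z) (Ksym y z); apply: killing_inner_linear.
pose L := HB.pack_for {linear subvs_of H -> dual H} g (GRing.isLinear.Build _ _ _ _ _ glin).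
have -> : killing_map U H h = g h by exact: (lfunE L).
exact: gE.
Qed.

(** The vector that represents alpha for the Killing form, that is, its preimage under
    [killing_map]. *)
Definition dual_repr alpha : subvs_of H :=
  kappa^-1 *: \sum_k (alpha (cotheta k) : F) *: cotheta k.

Lemma theta_dual_repr i alpha : theta i (dual_repr alpha) = kappa^-1 * alpha (cotheta i).
Proof.
rewrite linearZ linear_sum /=; congr (_ * _).
under eq_bigr => k _ do
  rewrite linearZ /= theta_cotheta /pair_coef /GRing.scale /= mulrBr mulrBr -(inv_eq (@rev_ordK _)).
rewrite sumrB (bigD1 i) //= eqxx mulr1 big1 ?addr0 => [|k ki]; last first.
  by rewrite eq_sym (negPf ki) !mulr0.
rewrite (bigD1 (rev_ord i)) //= eqxx mulr1 big1 ?addr0 => [|k ki]; last first.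
  by rewrite eq_sym (negPf ki) !mulr0.
rewrite cotheta_rev linearN mulNr opprK -mulrDl -mulr2n -mulr_natl.
by field.
Qed.

Lemma killing_map_repr alpha : killing_map U H (dual_repr alpha) = alpha.
Proof.
apply/lfunP => h; rewrite killing_mapE killingE.
under eq_bigr => i _ do rewrite theta_dual_repr -mulrA.
rewrite -mulr_sumr mulrA mulfV // mul1r [in RHS](torus_decomp h) linear_sum.
by apply: eq_bigr => i _; rewrite linearZ mulrC.
Qed.

Lemma killing_map_inj : lker (killing_map U H) == 0%VS.
Proof.
rewrite -subv0; apply/subvP => h; rewrite memv_ker memv0 => /eqP h0.
rewrite (torus_decomp h) big1 // => k _.
have := killing_mapE h (cotheta k); rewrite h0 zero_lfunE killingE => /esym/eqP.
rewrite mulf_eq0 (negPf kappa0) /=.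
under eq_bigr => i _ do rewrite theta_cotheta.
have -> : \sum_i theta i h * (2^-1 * pair_coef i k) = theta k h.
  rewrite [in RHS](torus_decomp h) linear_sum; apply: eq_bigr => i _.
  by rewrite linearZ /= theta_cotheta pair_coefC.
by move/eqP => ->; rewrite scale0r.
Qed.

Lemma dual_formE alpha beta : dual_form U H alpha beta = beta (dual_repr alpha).
Proof.
have reprK a : ((killing_map U H)^-1)%VF a = dual_repr a.
  by rewrite -{1}(killing_map_repr a) lker0_lfunK // killing_map_inj.
rewrite /dual_form !reprK.
have := killing_mapE (dual_repr beta) (dual_repr alpha); rewrite killing_map_repr => ->.
by rewrite !killingE; congr (_ * _); apply: eq_bigr => i _; rewrite mulrC.
Qed.

Lemma dual_form_root i j k m :
  dual_form U H (theta i - theta j) (theta k - theta m) = (2 * kappa)^-1 *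
    (pair_coef i k - pair_coef i m - pair_coef j k + pair_coef j m).
Proof.
rewrite dual_formE sub_lfunE !theta_dual_repr !sub_lfunE !theta_cotheta.
by rewrite invfM; field.
Qed.

(** The two values 1/kappa and 2/kappa are the squared lengths of the short and of the long
    roots. *)
Lemma dual_form_root_sq i j : i != j -> dual_form U H (theta i - theta j) (theta i - theta j) =
  kappa^-1 * (1 + (j == rev_ord i)%:R).
Proof.
move=> ij; rewrite dual_form_root !pair_coef_id (pair_coefC j) (pair_coef_neq ij).
by rewrite invfM; field.
Qed.

End DualForm.

Lemma theta_sub_neq0 i j : i != j -> theta i - theta j != 0.
Proof.
move=> ij; apply/eqP => /lfunP/(_ (cotheta i)); rewrite sub_lfunE !theta_cotheta zero_lfunE.
move/eqP; rewrite -mulrBr mulf_eq0 invr_eq0 pnatr_eq0 /= pair_coef_id pair_coefC.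
by rewrite (pair_coef_neq ij) opprK -(natrD _ 1) pnatr_eq0.
Qed.

(** * Weights on the skew and on the self-adjoint matrices *)

Section Weights.
Variables (c : F) (e : {linear 'M[F]_n -> 'M[F]_N}).
Hypothesis cc : c * c = 1.
Hypothesis e_inj : injective e.
Hypothesis e_equiv : forall a y, a \in adj_eigen S (-1) -> y \in adj_eigen S c ->
  comm (e0 a) (e y) = e (comm a y).

Definition is_weight alpha := exists y, [/\ y \in adj_eigen S c, y != 0 &
  forall h, comm (vsval h) (e y) = (alpha h : F) *: e y].

Lemma weight_eq alpha y : y \in adj_eigen S c ->
  (forall h, comm (vsval h) (e y) = (alpha h : F) *: e y) <->
  (forall h i j, (theta i h - theta j h) * (cj y) i j = alpha h * (cj y) i j).
Proof.
move=> yc; have hE h : exists2 a, vsval h = e0 a & comm (e0 a) (e y) = e (comm a y).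
  have /memH[a ha /andP[sa _]] := subvsP h; exists a => //; exact: e_equiv.
have cjE h a : vsval h = e0 a -> forall i j,
    (cj (comm a y)) i j = (theta i h - theta j h) * (cj y) i j.
  move=> ha i j; have := torus_repr h; rewrite ha e0K cj_comm // => ->.
  by rewrite comm_diagE !mxE.
split=> hw h.
  move=> i j; have [a ha hc] := hE h; rewrite -(cjE h a ha).
  have := hw h; rewrite ha hc -linearZ => /e_inj ->.
  by rewrite -scalemxAr -scalemxAl mxE.
have [a ha hc] := hE h; rewrite ha hc -linearZ; congr (e _); apply: (cj_inj Pu).
apply/matrixP => i j; rewrite (cjE h a ha) hw.
by rewrite -scalemxAr -scalemxAl [RHS]mxE.
Qed.

(** The adjoint maps the unit at (i, j) to a multiple of the one at (rev j, rev i), which has the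
    same weight, so projecting a unit yields a weight vector unless the projection is 0. This
    happens exactly for c = 1 and j = rev i, where skewness of the form makes the unit its own
    negative adjoint. *)
Lemma is_weightP alpha : is_weight alpha <->
  exists i j, (c = 1 -> j != rev_ord i) /\ alpha = theta i - theta j.
Proof.
have S'sk : S'^T = - S' := congr_skew P Ssk.
have S'u : S' \in unitmx := congr_unitmx Pu Su.
have skE i j := skew_entry i j S'sk; have adjE := adjm_antidiag S'u formP.
split=> [[y [yc y0 /(weight_eq _ yc) hw]]|[i [j [hij ->]]]].
  have /matrix0Pn[i [j yij]] : cj y != 0.
    by apply: contra y0 => /eqP h0; apply/eqP/(cj_inj Pu); rewrite h0 mulmx0 mul0mx.
  exists i, j; split.
    move=> c1; apply: contra yij => /eqP jE.
    have : cj y \in adj_eigen S' c by rewrite adj_eigen_cj.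
    move/adj_eigenP/matrixP/(_ i j); rewrite adjE jE rev_ordK [RHS]mxE c1 mul1r [S' (rev_ord i) i]skE.
    have S0 : S' i (rev_ord i) != 0 by rewrite formP eqxx.
    rewrite invrN mulrN mulfV // mulN1r => /eqP; rewrite eq_sym -addr_eq0 -mulr2n -mulr_natl.
    by rewrite mulf_eq0 pnatr_eq0.
  apply/lfunP => h; rewrite sub_lfunE.
  by have := hw h i j => /(mulIf yij).
pose y' := adj_proj S' c (delta_mx i j); pose y := invmx P *m y' *m P.
have y'c : y' \in adj_eigen S' c.
  by apply: (adj_projP S'u (e := -1)); rewrite ?scaleN1r ?mulrNN ?mulr1.
have cy : cj y = y' by rewrite cjVK.
have yc : y \in adj_eigen S c by rewrite -(adj_eigen_cj Pu) // cy.
have yE a b : y' a b = 2^-1 * (((a == i) && (b == j))%:R + c *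
    (S' a (rev_ord a) * (S' b (rev_ord b))^-1 * ((rev_ord b == i) && (rev_ord a == j))%:R)).
  by rewrite /y' /adj_proj mxE [X in _ * X]mxE [X in _ * (_ + X)]mxE adjE !mxE.
exists y; split=> //.
  apply/eqP => y0; have := yE i j; rewrite -cy y0 mulmx0 mul0mx mxE => /esym/eqP.
  rewrite mulf_eq0 invr_eq0 pnatr_eq0 !eqxx /=.
  rewrite [rev_ord j == i](inv_eq (@rev_ordK _)) [rev_ord i == j]eq_sym.
  have [ji|ji] := eqVneq j (rev_ord i); last by rewrite andbF !mulr0 addr0 oner_eq0.
  have c1 : c = -1.
    have : (c - 1) * (c + 1) == 0 by apply/eqP; rewrite mulrBl mulrDr cc mulr1 mul1r; ring.
    rewrite mulf_eq0 subr_eq0 addr_eq0 => /orP[/eqP /hij|/eqP//].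
    by rewrite ji eqxx.
  have S0 : S' i (rev_ord i) != 0 by rewrite formP eqxx.
  rewrite ji rev_ordK [S' (rev_ord i) i]skE invrN mulrN mulfV // c1 mulr1 mulrNN mulr1.
  by rewrite -(natrD _ 1 1) pnatr_eq0.
apply/weight_eq => // h a b; rewrite cy yE sub_lfunE.
have [ab|nab] := boolP ((a == i) && (b == j)).
  by case/andP: ab => /eqP -> /eqP ->.
have [/andP[/eqP bi /eqP aj]|nab2] := boolP ((rev_ord b == i) && (rev_ord a == j)); last first.
  by rewrite !mulr0 addr0 !mulr0.
rewrite -bi -aj !theta_rev; congr (_ * _).
by rewrite opprK addrC.
Qed.

End Weights.

End EmbeddedTorus.

(** * The root system of type C *)

Section RootSystemC.
Variables (F : numClosedFieldType) (l N : nat).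
Local Notation n := (2 * l)%N.
Variables (e0 : {linear 'M[F]_n -> 'M[F]_N}) (r0 : {linear 'M[F]_N -> 'M[F]_n}).
Hypothesis e0K : cancel e0 r0.
Variables (S P : 'M[F]_n) (H : {vspace 'M[F]_N}).
Hypothesis Pu : P \in unitmx.
Local Notation S' := (P *m S *m P^T).
Local Notation cj x := (P *m x *m invmx P).
Hypothesis Su : S \in unitmx.
Hypothesis formP : forall i j, (S' i j != 0) = (j == rev_ord i).
Hypothesis memH : forall x, reflect
  (exists2 a, x = e0 a & (a \in adj_eigen S (-1)) && is_diag_mx (cj a)) (x \in H).
Implicit Types (i j : 'I_n) (alpha beta : dual H).

Local Notation theta := (theta r0 P H).

Variables (U : {vspace 'M[F]_N}) (kappa : F).
Hypothesis kappa0 : 0 < kappa.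
Hypothesis killingE : forall h h' : subvs_of H, killing U (vsval h) (vsval h') =
  kappa * \sum_i theta i h * theta i h'.
Hypothesis rootsP : forall alpha, lie_roots U H alpha <->
  exists i j, i != j /\ alpha = theta i - theta j.

Let kappa_neq0 : kappa != 0. Proof. exact: lt0r_neq0. Qed.
Let root_sq i j : i != j -> dual_form U H (theta i - theta j) (theta i - theta j) =
  kappa^-1 * (1 + (j == rev_ord i)%:R).
Proof. exact: (dual_form_root_sq e0K Pu Su formP memH kappa_neq0 killingE). Qed.

Let theta_revE i : theta (rev_ord i) = - theta i.
Proof.
by apply/lfunP => h; rewrite opp_lfunE (theta_rev e0K Pu Su formP memH).
Qed.

Lemma short_rootP alpha : (1 < l)%N ->
  (lie_roots U H alpha /\ forall beta, lie_roots U H beta ->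
     dual_form U H alpha alpha <= dual_form U H beta beta) <->
  exists i j, [/\ i != j, j != rev_ord i & alpha = theta i - theta j].
Proof.
move=> l1; split=> [[/rootsP[i [j [ij ->]]] hs]|[i [j [ij ji ->]]]].
  exists i, j; split=> //; apply/negP => ji.
  (* For l > 1 the indices 0 and 1 are not mirror images, so they give a root shorter than one with
     j = rev i. *)
  have [i0 i1] : (0 < n)%N /\ (1 < n)%N by lia.
  have ne : Ordinal i0 != Ordinal i1 by [].
  have := hs (theta (Ordinal i0) - theta (Ordinal i1)).
  rewrite !root_sq // ji; case: eqP => [/(congr1 val) /= h|_]; first by exfalso; lia.
  move=> h; have /h : lie_roots U H (theta (Ordinal i0) - theta (Ordinal i1)).
    by apply/rootsP; exists (Ordinal i0), (Ordinal i1).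
  by rewrite ler_pM2l ?invr_gt0 // lerD2l ler10.
split; first by apply/rootsP; exists i, j.
move=> _ /rootsP[i' [j' [ij' ->]]]; rewrite !root_sq // (negPf ji).
by rewrite ler_pM2l ?invr_gt0 // lerD2l ler0n.
Qed.

Lemma long_rootP alpha : (0 < l)%N ->
  (lie_roots U H alpha /\ forall beta, lie_roots U H beta ->
     dual_form U H beta beta <= dual_form U H alpha alpha) <->
  exists i, alpha = theta i - theta (rev_ord i).
Proof.
move=> l1; have rev_neq i : i != rev_ord i by rewrite eq_sym rev_ord_neq.
split=> [[/rootsP[i [j [ij ->]]] hs]|[i ->]].
  exists i; congr (_ - theta _); apply/eqP; apply: contrapT => /negP ji.
  have := hs (theta i - theta (rev_ord i)); rewrite !root_sq // eqxx (negPf ji).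
  move=> h; have /h : lie_roots U H (theta i - theta (rev_ord i)).
    by apply/rootsP; exists i, (rev_ord i).
  by rewrite ler_pM2l ?invr_gt0 // lerD2l ler10.
split; first by apply/rootsP; exists i, (rev_ord i).
move=> _ /rootsP[i' [j' [ij' ->]]]; rewrite !root_sq // eqxx.
by rewrite ler_pM2l ?invr_gt0 // lerD2l; case: eqP => //; rewrite ler01.
Qed.

(* [theta] with its index read as a natural number, and 0 out of range *)
Definition theta_nat (m : nat) : dual H := oapp theta 0 (insub m).

Lemma theta_natE i : theta_nat i = theta i.
Proof. by rewrite /theta_nat valK. Qed.

(** The last one needs no separate clause: theta_l = - theta_(l-1), so it equals 2 theta_(l-1), the
    long simple root. *)
Definition simple_root (k : 'I_l) : dual H := theta_nat k - theta_nat k.+1.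

Lemma theta_nat_step m : (m.+1 < n)%N ->
  exists k : 'I_l, theta_nat m - theta_nat m.+1 = simple_root k.
Proof.
move=> mn; have [ml|lm] := ltnP m l; first by exists (Ordinal ml).
have kl : (n - m.+2 < l)%N by lia.
have revE p q : (p + q = n.-1)%N -> (p < n)%N -> theta_nat p = - theta_nat q.
  move=> pq pn; have := theta_revE (Ordinal pn); rewrite -!theta_natE /= => h.
  by rewrite -[LHS]opprK -h; congr (- theta_nat _); lia.
exists (Ordinal kl); rewrite /simple_root /=.
rewrite (revE m (n - m.+2).+1%N); [|lia|lia]; rewrite (revE m.+1 (n - m.+2)%N); [|lia|lia].
by rewrite opprK addrC.
Qed.

(* Every theta_k - theta_(k+1) is a simple root: for k >= l, it is the one of index
   n - 2 - k since theta_(n-1-i) = - theta_i. *)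
Lemma positive_root m p : (m <= p < n)%N ->
  exists k : 'I_l -> nat, theta_nat m - theta_nat p = \sum_i simple_root i *+ k i.
Proof.
elim: p => [|p IH] /andP[mp pn].
  exists (fun=> 0%N); rewrite big1 ?subrr //.
  by move: mp; rewrite leqn0 => /eqP ->; rewrite subrr.
have [->|mp1] := eqVneq m p.+1.
  by exists (fun=> 0%N); rewrite big1 ?subrr.
have [k hk] : exists k : 'I_l -> nat, theta_nat m - theta_nat p = \sum_i simple_root i *+ k i.
  by apply: IH; lia.
have [q hq] := theta_nat_step pn.
exists (fun u : 'I_l => k u + (u == q))%N.
rewrite -(subrKA (theta_nat p)) hk hq; under [RHS]eq_bigr => u _ do rewrite mulrnDr.
rewrite big_split /=; congr (_ + _); rewrite (bigD1 q) //= eqxx big1 ?addr0 // => u /negPf ->.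
by rewrite mulr0n.
Qed.

Lemma roots_base beta : lie_roots U H beta -> exists k : 'I_l -> nat,
  beta = \sum_i simple_root i *+ k i \/ beta = - \sum_i simple_root i *+ k i.
Proof.
move=> /rootsP[i [j [ij ->]]]; have [lij|lji] := leqP i j.
  have [|k hk] := @positive_root i j; first by rewrite lij ltn_ord.
  by exists k; left; rewrite -hk !theta_natE.
have [|k hk] := @positive_root j i; first by rewrite ltnW //= ltn_ord.
by exists k; right; rewrite -hk !theta_natE opprB.
Qed.

(** By dimension it is enough to span, and 2 theta_k is the root theta_k - theta_(rev k). *)
Lemma simple_root_basis : basis_of fullv (codom simple_root).
Proof.
rewrite basisEdim size_codom card_ord (dim_dual e0K Pu Su formP memH) leqnn andbT.
have dspan i j : theta i - theta j \in <<codom simple_root>>%VS.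
  wlog lij : i j / (i <= j)%N.
    move=> h; have [lij|lji] := leqP i j; first exact: h.
    by rewrite -opprB rpredN h // ltnW.
  have [|k hk] := @positive_root i j; first by rewrite lij ltn_ord.
  rewrite -!theta_natE hk memv_suml // => q _; rewrite rpredMn //.
  by apply/memv_span/codom_f.
apply/subvP => alpha _; rewrite (dual_decomp e0K Pu Su formP memH alpha).
apply: memv_suml => k _; apply: memvZ.
have := dspan k (rev_ord k); rewrite theta_revE opprK -mulr2n -scaler_nat.
by apply: memvZ_neq0; rewrite pnatr_eq0.
Qed.

Lemma simple_rootE (k : 'I_l) : exists2 i : 'I_n, i = k :> nat &
  exists2 j : 'I_n, j = k.+1 :> nat & simple_root k = theta i - theta j.
Proof.
have [kn kn1] : (k < n)%N /\ (k.+1 < n)%N by have := ltn_ord k; lia.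
exists (Ordinal kn) => //; exists (Ordinal kn1) => //.
by rewrite /simple_root -!theta_natE.
Qed.

Lemma simple_root_cartan (i j : 'I_l) :
  2 * dual_form U H (simple_root i) (simple_root j) /
      dual_form U H (simple_root j) (simple_root j) = (cartan_matrix_C l i j)%:~R.
Proof.
have [p pi [q qi ->]] := simple_rootE i; have [r rj [s sj ->]] := simple_rootE j.
have rs : r != s by rewrite -val_eqE /= rj sj; lia.
rewrite (root_sq rs) (dual_form_root e0K Pu Su formP memH kappa_neq0 killingE).
(* The mirror index of b is n - 1 - b; this turns all coefficients into linear arithmetic on natural
   numbers. *)
have cE (a b : 'I_n) : pair_coef F a b = (a == b :> nat)%:R - (a + b == n.-1)%N%:R.
  rewrite /pair_coef -val_eqE; congr (_ - _%:R); rewrite -val_eqE /=.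
  by have := ltn_ord b; have := ltn_ord a; case: eqP; case: eqP => //; lia.
have il := ltn_ord i; have jl := ltn_ord j.
have -> : (s == rev_ord r) = (j.+1 == l).
  by rewrite -val_eqE /= sj rj; apply/eqP/eqP; lia.
rewrite !cE pi qi rj sj mxE -(val_eqE i j) /=.
have -> : (i + j == n.-1)%N = false by apply/negbTE; lia.
have -> : (i + j.+1 == n.-1)%N = (i.+1 == l) && (j.+1 == l) by lia.
have -> : (i.+1 + j == n.-1)%N = (i.+1 == l) && (j.+1 == l) by lia.
have -> : (i.+1 + j.+1 == n.-1)%N =
  ((i.+1 == l) && (j.+2 == l)) || ((j.+1 == l) && (i.+2 == l)) by lia.
rewrite eqSS.
have two0 : 1 + 1 != 0 :> F by rewrite -(natrD _ 1 1) pnatr_eq0.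
have [ij|ij] := eqVneq (i : nat) j.
  have -> : (i == j.+1 :> nat) = false by apply/negbTE; lia.
  have -> : (i.+1 == j :> nat) = false by apply/negbTE; lia.
  rewrite ij; have [jl1|jl1] := eqVneq j.+1 l.
    have -> : (j.+2 == l)%N = false by apply/negbTE; lia.
    by rewrite /= invfM; field; rewrite kappa_neq0.
  by rewrite /= invfM; field; rewrite kappa_neq0.
have [ij1|ij1] := eqVneq (i : nat) j.+1.
  have -> : (i.+1 == j :> nat) = false by apply/negbTE; lia.
  have -> : (j.+1 == l)%N = false by apply/negbTE; lia.
  have -> : (j.+2 == l)%N = (i.+1 == l) by rewrite ij1.
  by have [il1|il1] := eqVneq i.+1 l; rewrite /= invfM; field; rewrite kappa_neq0.
have [ji1|ji1] := eqVneq (i.+1 : nat) j.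
  have -> : (i.+1 == l)%N = false by apply/negbTE; lia.
  have -> : (i.+2 == l)%N = (j.+1 == l) by rewrite ji1.
  by have [jl1|jl1] := eqVneq j.+1 l; rewrite /= invfM; field; rewrite ?kappa_neq0 ?two0.
have -> : (i.+1 == l) && (j.+1 == l) = false by lia.
have -> : ((i.+1 == l) && (j.+2 == l)) || ((j.+1 == l) && (i.+2 == l)) = false by lia.
by rewrite /= invfM; field; case: (_ == l); rewrite ?kappa_neq0 ?two0 //= addr0 oner_neq0.
Qed.

Lemma root_type_C : has_root_type_C U H l.
Proof.
exists simple_root; split.
- exact: simple_root_basis.
- move=> k; have [i hi [j hj ->]] := simple_rootE k; apply/rootsP.
  by exists i, j; split=> //; rewrite -val_eqE /= hi hj; lia.
- exact: roots_base.
- exact: simple_root_cartan.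
Qed.

End RootSystemC.

(** * Transport along Lie algebra embeddings *)

Section Transport.
Variables (F : fieldType) (n N : nat).
Variables (e0 : {linear 'M[F]_n -> 'M[F]_N}) (r0 : {linear 'M[F]_N -> 'M[F]_n}).
Hypothesis e0K : cancel e0 r0.
Hypothesis e0_comm : forall x y, comm (e0 x) (e0 y) = e0 (comm x y).
Variable K : {vspace 'M[F]_n}.
Local Notation E0 := (linfun e0).

Lemma linfun_inj_ker (vT wT : vectType F) (f : {linear vT -> wT}) :
  injective f -> lker (linfun f) == 0%VS.
Proof. by move=> fI; apply/lker0P => x y; rewrite !lfunE => /fI. Qed.

Lemma mem_lin_img (vT wT : vectType F) (f : {linear vT -> wT}) (W : {vspace vT}) x :
  reflect (exists2 y, x = f y & y \in W) (x \in (linfun f @: W)%VS).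
Proof.
apply: (iffP memv_imgP) => [[y yW ->]|[y -> yW]]; exists y; rewrite ?lfunE //.
Qed.

Lemma mem_lin_img_inj (vT wT : vectType F) (f : {linear vT -> wT}) (W : {vspace vT}) y :
  injective f -> (f y \in (linfun f @: W)%VS) = (y \in W).
Proof.
move=> fI; apply/mem_lin_img/idP => [[z /fI -> //]|yW]; by exists y.
Qed.

Lemma mem_lin_pre (vT wT : vectType F) (f : {linear vT -> wT}) (W : {vspace wT}) y :
  (y \in (linfun f @^-1: W)%VS) = (f y \in W).
Proof. by rewrite -memv_preim lfunE. Qed.

Section Module.
Variable e : {linear 'M[F]_n -> 'M[F]_N}.
Hypothesis e_inj : injective e.
Hypothesis e_equiv : forall a y, a \in K -> comm (e0 a) (e y) = e (comm a y).

Lemma stable_pre V : stable_under (E0 @: K)%VS V -> stable_under K (linfun e @^-1: V)%VS.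
Proof.
move=> hV x y xK; rewrite !mem_lin_pre -e_equiv // => yV; apply: hV => //.
by apply/mem_lin_img; exists x.
Qed.

Lemma stable_img W : stable_under K W -> stable_under (E0 @: K)%VS (linfun e @: W)%VS.
Proof.
move=> hW _ _ /mem_lin_img[x -> xK] /mem_lin_img[y -> yW].
by rewrite e_equiv // mem_lin_img_inj // hW.
Qed.

Lemma sub_img_preK W V : (V <= linfun e @: W)%VS -> (linfun e @: (linfun e @^-1: V) = V)%VS.
Proof. by move=> h; apply: lpreimK; apply: subv_trans h (limgS _ (subvf _)). Qed.

Lemma sub_pre W V : (V <= linfun e @: W)%VS -> (linfun e @^-1: V <= W)%VS.
Proof.
move=> h; apply/subvP => y; rewrite mem_lin_pre => /(subvP h).
by rewrite mem_lin_img_inj.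
Qed.

Lemma irreducible_img W : is_irreducible_module K W ->
  is_irreducible_module (E0 @: K)%VS (linfun e @: W)%VS.
Proof.
case=> Wst W0 Wirr; split; first exact: stable_img.
  move=> h; apply: W0; apply/eqP; rewrite -subv0; apply/subvP => y yW.
  have : e y \in 0%VS by rewrite -h mem_lin_img_inj.
  by rewrite !memv0 raddf_eq0.
move=> V Vsub Vst; case: (Wirr (linfun e @^-1: V)%VS (sub_pre Vsub) (stable_pre Vst)) => h;
  [left|right].
  by rewrite -(sub_img_preK Vsub) h limg0.
by rewrite -(sub_img_preK Vsub) h.
Qed.

Lemma trivial_img T : is_trivial_module K T ->
  is_trivial_module (E0 @: K)%VS (linfun e @: T)%VS.
Proof.
move=> h _ _ /mem_lin_img[x -> xK] /mem_lin_img[y -> yW].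
by rewrite e_equiv // h // linear0.
Qed.

Lemma dim_lin_img W : \dim (linfun e @: W) = \dim W.
Proof. by apply: limg_dim_eq; rewrite (eqP (linfun_inj_ker e_inj)) capv0. Qed.

Lemma directv_img T W : directv (T + W) -> directv (linfun e @: T + linfun e @: W).
Proof.
move=> /directv_addP TW; apply/directv_addP.
by rewrite -lker0_img_cap ?linfun_inj_ker // TW limg0.
Qed.

End Module.

Let e0_inj : injective e0. Proof. exact: can_inj e0K. Qed.

Lemma simple_img : is_simple_lie K -> is_simple_lie (E0 @: K)%VS.
Proof.
case=> Ksub [x [y [xK yK xy]]] Kid.
have eq0 a z : a \in K -> comm (e0 a) (e0 z) = e0 (comm a z) by move=> _; exact: e0_comm.
split.
- move=> _ _ /mem_lin_img[a -> aK] /mem_lin_img[b -> bK].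
  by rewrite e0_comm mem_lin_img_inj // Ksub.
- exists (e0 x), (e0 y); split; rewrite ?mem_lin_img_inj //.
  by rewrite e0_comm raddf_eq0.
- move=> V Vsub Vst; have := sub_img_preK Vsub.
  case: (Kid (E0 @^-1: V)%VS (sub_pre e0_inj Vsub) (stable_pre eq0 Vst)) => ->.
    by rewrite limg0 => <-; left.
  by move=> <-; right.
Qed.

(** Reduces Cartan subalgebras of the embedded copy to those of K itself, where the structure theory
    above applies. *)
Lemma cartan_pre H : is_cartan (E0 @: K)%VS H ->
  is_cartan K (E0 @^-1: H)%VS /\ H = (E0 @: (E0 @^-1: H))%VS.
Proof.
case=> Hsub Halg [m hm] Hnorm; have HK := sub_img_preK Hsub.
have memH' x : (x \in (E0 @^-1: H)%VS) = (e0 x \in H) by exact: mem_lin_pre.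
split=> //; split.
- by have := sub_pre e0_inj Hsub.
- by move=> x y; rewrite !memH' -e0_comm; apply: Halg.
- exists m; apply/eqP; rewrite -subv0; apply/subvP => x xm.
  have : e0 x \in 0%VS.
    rewrite -hm; elim: m {hm} x xm => [|m IH] x; first by rewrite /= memH'.
    rewrite -mem_lin_pre; apply: subvP; apply: lie_prod_subv => y z yH zm.
    by rewrite mem_lin_pre -e0_comm; apply: lie_prod_mem; rewrite -?memH' // IH.
  by rewrite !memv0 raddf_eq0.
- move=> x xK hx; rewrite memH'; apply: Hnorm; first by rewrite mem_lin_img_inj.
  move=> h; rewrite -{1}HK => /mem_lin_img[z -> zH].
  by rewrite e0_comm -memH' hx.
Qed.

Lemma killing_img x y : is_subalgebra K -> x \in K -> y \in K ->
  killing (E0 @: K) (e0 x) (e0 y) = killing K x y.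
Proof.
move=> Kalg xK yK; have bK (i : 'I_(\dim K)) : (vbasis K)`_i \in K.
  by rewrite vbasis_mem ?mem_nth ?size_tuple.
rewrite /killing.
rewrite (@coord_trace_frame _ _ _ _ (fun i : 'I_(\dim K) => e0 (vbasis K)`_i)
  (fun i : 'I_(\dim K) => [the {scalar 'M[F]_N} of coord (vbasis K) i \o r0])
  (comm (e0 x) \o comm (e0 y))).
- by apply: eq_bigr => i _ /=; rewrite !e0_comm e0K.
- by move=> i; rewrite mem_lin_img_inj.
- move=> _ /mem_lin_img[z -> zK]; rewrite {1}(coord_vbasis zK) linear_sum.
  by apply: eq_bigr => i _; rewrite linearZ /= e0K.
- move=> _ /mem_lin_img[z -> zK] /=; rewrite !e0_comm mem_lin_img_inj //.
  by do 2! apply: (Kalg _ _ _ _) => //.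
Qed.

End Transport.

(** * The graded components of so_4l *)

Section StandardForm.
Variables (F : fieldType) (l : nat).
Local Notation n := (2 * l)%N.

Definition std_form : 'M[F]_n :=
  \matrix_(i, j) ((-1) ^+ i.+1 *+ (j == rev_ord i)).
Local Notation S := std_form.

Lemma std_form_skew : S^T = - S.
Proof.
apply/matrixP => i j; rewrite !mxE -(inv_eq (@rev_ordK _)) eq_sym.
have [->|_] := eqVneq j (rev_ord i); last by rewrite !mulr0n oppr0.
rewrite !mulr1n /= -signr_odd -[in RHS]signr_odd.
have -> : odd (n - i.+1).+1 = ~~ odd i.+1 by have := ltn_ord i; lia.
by case: odd; rewrite ?expr0 ?expr1 ?opprK.
Qed.

Lemma std_form_sq : S *m S = - 1%:M.
Proof.
have := std_form_skew => h; rewrite -[S in S *m _]opprK -h mulNmx; congr (- _).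
apply/matrixP => i j; rewrite !mxE (bigD1 (rev_ord i)) //= big1 ?addr0 => [|k ki].
  rewrite !mxE rev_ordK eqxx mulr1n [i == j]eq_sym.
  have [_|_] := eqVneq j i; last by rewrite mulr0n mulr0.
  by rewrite mulr1n -expr2 sqrr_sign.
by rewrite !mxE -(inv_eq (@rev_ordK _)) eq_sym (negPf ki) mulr0n mul0r.
Qed.

Lemma std_form_unit : S \in unitmx.
Proof.
have : S *m (- S) = 1%:M by rewrite mulmxN std_form_sq opprK.
by case/mulmx1_unit.
Qed.

Lemma std_form_inv : invmx S = - S.
Proof.
by rewrite -[RHS](mulKmx std_form_unit) mulmxN std_form_sq opprK mulmx1.
Qed.

End StandardForm.

(** * The two automorphisms in block form, and equivariant embeddings *)

Section Concrete.
Variables (R : realType) (l : nat).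
Local Notation C := R[i].
Local Notation n := (2 * l)%N.
Local Notation S := (std_form C l).
Local Notation N := (n + n)%N.

Lemma sigma0_mx : \sum_(i < N) (-1) ^+ i.+1 *: delta_mx i (rev_ord i)
  = block_mx 0 S S 0 :> 'M[C]_N.
Proof.
have -> : \sum_(i < N) (-1) ^+ i.+1 *: delta_mx i (rev_ord i) =
    \matrix_(i, j) ((-1) ^+ i.+1 *+ (j == rev_ord i)) :> 'M[C]_N.
  apply/matrixP => i j; rewrite summxE mxE (bigD1 i) //= big1 ?addr0 => [|k ki].
    by rewrite !mxE eqxx mulr_natr.
  by rewrite !mxE eq_sym (negPf ki) mulr0.
have rl (a : 'I_n) : rev_ord (lshift n a) = rshift n (rev_ord a).
  by apply: val_inj => /=; have := ltn_ord a; lia.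
have rr (a : 'I_n) : rev_ord (rshift n a) = lshift n (rev_ord a).
  by apply: val_inj => /=; have := ltn_ord a; lia.
apply/matrixP => i j; rewrite mxE.
case: (split_ordP i) => a ->; case: (split_ordP j) => b -> /=; rewrite ?rl ?rr.
- by rewrite block_mxEul eq_lrshift mxE.
- by rewrite block_mxEur (inj_eq (@rshift_inj _ _)) mxE.
(* Rows of the lower half are shifted by the even number 2l, so their signs agree with those of the
   upper half. *)
- rewrite block_mxEdl (inj_eq (@lshift_inj _ _)) mxE; congr (_ *+ _).
  by rewrite -signr_odd -[in RHS]signr_odd -addnS oddD oddM.
- by rewrite block_mxEdr eq_rlshift mxE.
Qed.

Lemma sigma1_mx : \sum_(i < n) ((-1) ^+ i.+1 *: delta_mx (lshift n i) (rshift n (rev_ord i))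
   - (-1) ^+ i.+1 *: delta_mx (rshift n i) (lshift n (rev_ord i))) =
  block_mx 0 S (- S) 0 :> 'M[C]_N.
Proof.
apply/matrixP => i j; rewrite summxE.
case: (split_ordP i) => a ->; case: (split_ordP j) => b ->.
- rewrite block_mxEul mxE big1 // => k _.
  by rewrite !mxE !(eq_lrshift, eq_rlshift) /= ?andbF !mulr0 subrr.
- rewrite block_mxEur mxE (bigD1 a) //= big1 ?addr0 => [|k ka].
    rewrite !mxE eqxx (inj_eq (@rshift_inj _ _)) eq_lrshift /= mulr0 subr0.
    by rewrite mulr_natr.
  by rewrite !mxE (inj_eq (@lshift_inj _ _)) [a == k]eq_sym (negPf ka) eq_lrshift !mulr0 subrr.
- rewrite block_mxEdl [RHS]mxE mxE (bigD1 a) //= big1 ?addr0 => [|k ka].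
    rewrite !mxE eqxx (inj_eq (@lshift_inj _ _)) eq_rlshift mulr0 sub0r.
    by rewrite mulr_natr.
  by rewrite !mxE eq_rlshift (inj_eq (@rshift_inj _ _)) [a == k]eq_sym (negPf ka) !mulr0 subrr.
- rewrite block_mxEdr mxE big1 // => k _.
  by rewrite !mxE !(eq_lrshift, eq_rlshift) /= ?andbF !mulr0 subrr.
Qed.

Lemma invmxE (T : 'M[C]_N) T' : T *m T' = 1%:M -> invmx T = T'.
Proof.
move=> h; have [Tu _] := mulmx1_unit h.
by rewrite -[LHS]mulmx1 -h mulKmx.
Qed.

Lemma sigma0E a b c d : sigma0 (block_mx a b c d) =
  block_mx (- (S *m d *m S)) (- (S *m c *m S)) (- (S *m b *m S)) (- (S *m a *m S)) :> 'M[C]_N.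
Proof.
rewrite /sigma0 /Ad sigma0_mx (@invmxE _ (block_mx 0 (- S) (- S) 0)).
  by rewrite !mulmx_block !(mul0mx, mulmx0, add0r, addr0) !mulmxN.
rewrite mulmx_block !(mul0mx, mulmx0, add0r, addr0) mulmxN std_form_sq opprK.
by rewrite -scalar_mx_block.
Qed.

Lemma sigma1E a b c d : sigma1 (block_mx a b c d) =
  block_mx (- (S *m d *m S)) (S *m c *m S) (S *m b *m S) (- (S *m a *m S)) :> 'M[C]_N.
Proof.
rewrite /sigma1 /Ad sigma1_mx (@invmxE _ (block_mx 0 S (- S) 0)).
  by rewrite !mulmx_block !(mul0mx, mulmx0, add0r, addr0) !mulNmx !mulmxN opprK.
rewrite mulmx_block !(mul0mx, mulmx0, add0r, addr0) mulmxN mulNmx std_form_sq opprK.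
by rewrite -scalar_mx_block.
Qed.

Lemma Ad_linear (A : 'M[C]_N) : linear (@Ad R l A).
Proof.
by move=> a X Y; rewrite /Ad mulmxDr mulmxDl -scalemxAr -scalemxAl.
Qed.
HB.instance Definition _ A :=
  GRing.isLinear.Build C 'M[C]_N 'M[C]_N *:%R (@Ad R l A) (@Ad_linear A).

Lemma adjm_std a : adjm S a = - (S *m a^T *m S).
Proof. by rewrite /adjm std_form_inv mulmxN. Qed.

Lemma std_sandwich a : S *m (S *m a *m S) *m S = a.
Proof.
rewrite !mulmxA std_form_sq -mulmxA std_form_sq mulNmx mul1mx mulNmx mulmxN mulmx1.
by rewrite opprK.
Qed.

Lemma aut_order2 (s : 'M[C]_N -> 'M[C]_N) :
  (forall X, s (s X) = X) -> (exists2 X, X \in so_algebra R l & s X != X) ->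
  aut_order (so_algebra R l) s = 2%N.
Proof.
move=> ss [X Xso sX]; rewrite /aut_order.
set Q := (X in xget _ X).
have Q2 : Q 2%N.
  split=> // [Y _|[|[|m]] // _ h]; first exact: ss.
  by case/negP: sX; apply/eqP; exact: h.
have [n0 nid nmin] : Q (xget 0%N Q) by apply: xgetPex; exists 2%N.
apply/eqP; rewrite eqn_leq; apply/andP; split.
  by apply: nmin => // Y _; exact: ss.
by case: Q2 => _ _; apply.
Qed.

Lemma root_of_unity2 : Defs.root_of_unity R 2 = -1.
Proof.
rewrite /Defs.root_of_unity mulrC mulKf ?pnatr_eq0 // cospi sinpi.
by apply/eqP; rewrite eq_complex /= oppr0 !eqxx.
Qed.

Definition diag_emb (a : 'M[C]_n) : 'M[C]_N := block_mx a 0 0 (- a^T).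
(** Writing the upper block as b = y S turns b^T = -b into y^* = y. The sigma_1-eigenvalue s then
    forces the lower block s S b S = - s S y. *)
Definition offdiag_emb (s : C) (y : 'M[C]_n) : 'M[C]_N :=
  block_mx 0 (y *m S) (- s *: (S *m y)) 0.

Lemma diag_emb_linear : linear diag_emb.
Proof.
move=> a x y; rewrite /diag_emb scale_block_mx add_block_mx !scaler0 !addr0.
by rewrite linearP /= opprD scalerN.
Qed.
HB.instance Definition _ :=
  GRing.isLinear.Build C 'M[C]_n 'M[C]_N *:%R diag_emb diag_emb_linear.

Lemma offdiag_emb_linear s : linear (offdiag_emb s).
Proof.
move=> a x y; rewrite /offdiag_emb scale_block_mx add_block_mx !scaler0 !addr0.
by rewrite mulmxDl -scalemxAl mulmxDr -scalemxAr scalerDr scalerA mulrC -scalerA.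
Qed.
HB.instance Definition _ s :=
  GRing.isLinear.Build C 'M[C]_n 'M[C]_N *:%R (offdiag_emb s) (offdiag_emb_linear s).

Lemma diag_embK : cancel diag_emb (@ulsubmx C n n n n).
Proof. by move=> a; rewrite /diag_emb block_mxKul. Qed.

Lemma offdiag_emb_inj s : injective (offdiag_emb s).
Proof.
move=> x y /eq_block_mx[_ h _ _].
by move/(congr1 (mulmx^~ (invmx S))): h; rewrite !mulmxK // std_form_unit.
Qed.

Lemma comm_diag_emb a b : comm (diag_emb a) (diag_emb b) = diag_emb (comm a b).
Proof.
rewrite !commE /diag_emb !mulmx_block !(mul0mx, mulmx0, add0r, addr0).
rewrite opp_block_mx add_block_mx !oppr0 !addr0 linearB /= !trmx_mul.
by rewrite !mulNmx !mulmxN !opprK opprB.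
Qed.

(** On the upper block diag(a, -a^T) acts by b |-> a b + b a^T; for a in sp, S a^T = - a S turns
    this into the commutator on y. *)
Lemma comm_diag_offdiag s a y : a \in adj_eigen S (-1) ->
  comm (diag_emb a) (offdiag_emb s y) = offdiag_emb s (comm a y).
Proof.
move=> /(adj_eigenN1P (std_form_unit C l))/eqP; rewrite addrC addr_eq0 => /eqP ha.
have ha' : a^T *m S = - (S *m a).
  have := congr1 (fun z => S *m z *m S) ha.
  rewrite mulmxN mulNmx mulmxA std_form_sq -[S *m (a *m S) *m S]mulmxA -[a *m S *m S]mulmxA.
  rewrite std_form_sq mulNmx mul1mx mulNmx mulmxN mulmxN mulmx1 opprK => h.
  by rewrite -h opprK.
have ur : a *m (y *m S) - y *m S *m (- a^T) = comm a y *m S.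
  by rewrite mulmxN opprK -(mulmxA y) ha mulmxN !mulmxA -mulmxBl.
have dl : (- a^T) *m (- s *: (S *m y)) - (- s *: (S *m y)) *m a = - s *: (S *m comm a y).
  rewrite -scalemxAr -scalemxAl -scalerBr; congr (_ *: _).
  by rewrite mulNmx mulmxA ha' mulNmx opprK -!mulmxA -mulmxBr.
rewrite [LHS]commE /offdiag_emb /diag_emb !mulmx_block !(mul0mx, mulmx0, add0r, addr0).
by rewrite opp_block_mx add_block_mx ur dl !subr0.
Qed.

End Concrete.

(** * The four graded components *)

Section Gradings.
Variables (R : realType) (l : nat).
Hypothesis l_gt0 : (0 < l)%N.
Local Notation C := R[i].
Local Notation n := (2 * l)%N.
Local Notation S := (std_form C l).
Local Notation N := (n + n)%N.
Local Notation so := (so_algebra R l).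
Local Notation S0 := (@sigma0 R l).
Local Notation S1 := (@sigma1 R l).
Implicit Types (a b c y : 'M[C]_n) (X : 'M[C]_N).

Let Su : S \in unitmx := std_form_unit C l.
Let two_neq0 : 2 != 0 :> C. Proof. by rewrite pnatr_eq0. Qed.

Lemma std_mull y : S *m (S *m y) = - y.
Proof. by rewrite mulmxA std_form_sq mulNmx mul1mx. Qed.
Lemma std_mulr y : y *m S *m S = - y.
Proof. by rewrite -mulmxA std_form_sq mulmxN mulmx1. Qed.

Lemma std_sandwichN a : - (S *m - (S *m a *m S) *m S) = a.
Proof. by rewrite mulmxN mulNmx opprK std_sandwich. Qed.

Lemma sigma0K X : S0 (S0 X) = X.
Proof.
rewrite -[X]submxK; move: (ulsubmx X) (ursubmx X) (dlsubmx X) (drsubmx X) => a b c d.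
by rewrite sigma0E sigma0E; congr (block_mx _ _ _ _); exact: std_sandwichN.
Qed.
Lemma sigma1K X : S1 (S1 X) = X.
Proof.
rewrite -[X]submxK; move: (ulsubmx X) (ursubmx X) (dlsubmx X) (drsubmx X) => a b c d.
rewrite sigma1E sigma1E; congr (block_mx _ _ _ _); try exact: std_sandwichN.
  exact: std_sandwich.
exact: std_sandwich.
Qed.

Lemma diag_emb_so a : diag_emb a \in so.
Proof. by apply/so_algebraP; exists a, 0, 0; split; rewrite ?trmx0 ?oppr0. Qed.

Lemma diag1_neqN : diag_emb 1%:M != - diag_emb 1%:M :> 'M[C]_N.
Proof.
have k0 : (0 < n)%N by lia.
apply/eqP; rewrite -linearN /= => /(can_inj (@diag_embK R l)).
move=> /matrixP/(_ (Ordinal k0) (Ordinal k0))/eqP; rewrite !mxE !eqxx mulr1n -subr_eq0 opprK -(natrD _ 1 1).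
by rewrite pnatr_eq0.
Qed.

(** Witnesses that neither automorphism is the identity on so, so that both have order 2. *)
Lemma sigma_diag1 : S0 (diag_emb 1%:M) = - diag_emb 1%:M /\ S1 (diag_emb 1%:M) = - diag_emb 1%:M.
Proof.
rewrite /diag_emb sigma0E sigma1E opp_block_mx trmx1 !(mulmxN, mulNmx, mulmx0, mul0mx, oppr0).
by rewrite !mulmx1 std_form_sq !opprK.
Qed.

Lemma aut_order_sigma0 : aut_order so S0 = 2%N.
Proof.
apply: aut_order2; first exact: sigma0K.
exists (diag_emb 1%:M); first exact: diag_emb_so.
by rewrite (proj1 sigma_diag1) eq_sym diag1_neqN.
Qed.
Lemma aut_order_sigma1 : aut_order so S1 = 2%N.
Proof.
apply: aut_order2; first exact: sigma1K.
exists (diag_emb 1%:M); first exact: diag_emb_so.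
by rewrite (proj2 sigma_diag1) eq_sym diag1_neqN.
Qed.

Definition zsign (p : int) : C := (-1) ^+ odd `|p|%N.

Lemma exprz_N1 (p : int) : (-1 : C) ^ p = zsign p.
Proof.
rewrite /zsign signr_odd; case: p => m /=; first by rewrite -exprnP.
by rewrite NegzE -exprnN -exprVn invrN1.
Qed.

Lemma zsign_sq p : zsign p * zsign p = 1.
Proof. by rewrite -expr2 sqrr_sign. Qed.

Lemma leigenP (f : {linear 'M[C]_N -> 'M[C]_N}) e X :
  reflect (f X = e *: X) (X \in passmx.leigenspace (linfun f) e).
Proof.
rewrite memv_ker add_lfunE opp_lfunE scale_lfunE id_lfunE lfunE /= subr_eq0.
exact: eqP.
Qed.

Lemma gdotP p q X : reflect [/\ X \in so, S0 X = zsign p *: X & S1 X = zsign q *: X]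
  (X \in gdot R l p q).
Proof.
rewrite /gdot /grading aut_order_sigma0 aut_order_sigma1 root_of_unity2 !exprz_N1.
rewrite !memv_cap; apply: (iffP andP) => [[/andP[Xs]]|[Xs h0 h1]].
  by move=> /(@leigenP (@Ad R l _)) h0 /(@leigenP (@Ad R l _)) h1.
split; last exact/(@leigenP (@Ad R l _)).
by apply/andP; split; [exact: Xs|exact/(@leigenP (@Ad R l _))].
Qed.

(** sigma_0 and sigma_1 agree on the diagonal blocks and are opposite on the off-diagonal ones.
    Equal eigenvalues therefore kill the off-diagonal blocks, and distinct eigenvalues the diagonal
    ones. *)
Lemma gdot_diag p q : odd `|p|%N = odd `|q|%N ->
  gdot R l p q = (linfun (@diag_emb R l) @: adj_eigen S (- zsign p))%VS.
Proof.
move=> pq; have zpq : zsign q = zsign p by rewrite /zsign pq.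
apply/vspaceP => X; apply/gdotP/memv_imgP; rewrite zpq; set s := zsign p.
  case=> /so_algebraP[a [b [c [-> hb hc]]]].
  rewrite sigma0E sigma1E scale_block_mx => /eq_block_mx[ha h1 _ _] /eq_block_mx[_ h2 _ _].
  have b0 : b = 0.
    have : 2 *: (s *: b) = 0 by rewrite scaler_nat mulr2n -{1}h1 -h2 addNr.
    move/eqP; rewrite !scaler_eq0 (negPf two_neq0) /s /zsign signr_eq0.
    by move/eqP.
  have c0 : c = 0.
    by rewrite -[c]std_sandwich h2 b0 scaler0 mulmx0 mul0mx.
  exists a; last by rewrite lfunE b0 c0.
  apply/adj_eigenP; rewrite adjm_std scaleNr -ha mulmxN mulNmx opprK.
  by [].
case=> a /adj_eigenP; rewrite adjm_std scaleNr => /oppr_inj ha ->; rewrite lfunE /=.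
have ha' : S *m a *m S = s *: a^T.
  have := congr1 trmx ha; rewrite linearZ /= !trmx_mul trmxK std_form_skew.
  by rewrite mulNmx mulmxN mulmxN opprK mulmxA.
split; first exact: diag_emb_so.
  rewrite /diag_emb sigma0E scale_block_mx !(mulmx0, mul0mx, scaler0, oppr0).
  by rewrite mulmxN mulNmx opprK ha ha' scalerN.
rewrite /diag_emb sigma1E scale_block_mx !(mulmx0, mul0mx, scaler0, oppr0).
by rewrite mulmxN mulNmx opprK ha ha' scalerN.
Qed.

Lemma gdot_offdiag p q : odd `|p|%N != odd `|q|%N ->
  gdot R l p q = (linfun (offdiag_emb (zsign q)) @: adj_eigen S 1)%VS.
Proof.
move=> pq; have zpq : zsign p = - zsign q.
  by rewrite /zsign; move: pq; case: odd; case: odd => //= _; rewrite ?expr0 ?expr1 ?opprK.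
apply/vspaceP => X; apply/gdotP/memv_imgP; rewrite zpq; set s := zsign q.
have ss : s * s = 1 := zsign_sq q.
  case=> /so_algebraP[a [b [c [-> hb hc]]]].
  rewrite sigma0E sigma1E !scale_block_mx => /eq_block_mx[h0 _ _ _] /eq_block_mx[h1 h2 _ _].
  have a0 : a = 0.
    have : 2 *: (s *: a) = 0 by rewrite scaler_nat mulr2n -{1}h1 h0 scaleNr addNr.
    move/eqP; rewrite !scaler_eq0 (negPf two_neq0) /s /zsign signr_eq0.
    by move/eqP.
  exists (- (b *m S)).
    apply/adj_eigenP; rewrite scale1r adjm_std linearN /= trmx_mul hb std_form_skew.
    rewrite mulNmx (mulmxN S b) opprK (mulmxN S (S *m b)) mulNmx opprK mulmxA std_form_sq.
    by rewrite mulNmx mul1mx mulNmx.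
  rewrite lfunE /= /offdiag_emb a0 trmx0 oppr0.
  have -> : - (b *m S) *m S = b by rewrite mulNmx -mulmxA std_form_sq mulmxN mulmx1 opprK.
  congr (block_mx _ _ _ _); rewrite mulmxN scalerN scaleNr opprK mulmxA.
  by rewrite scalemxAl scalemxAr -h2 std_sandwich.
have ss : s * s = 1 := zsign_sq q.
case=> y /adj_eigenP; rewrite adjm_std scale1r => hy ->; rewrite lfunE /=.
have hy1 : S *m y^T = y *m S.
  by rewrite -[in RHS]hy mulNmx -(mulmxA (S *m y^T)) std_form_sq mulmxN mulmx1 opprK.
have hy2 : y^T *m S = S *m y.
  by rewrite -[in RHS]hy mulmxN -(mulmxA S) std_mull opprK.
split.
- apply/so_algebraP; exists 0, (y *m S), (- s *: (S *m y)); split.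
  + by rewrite trmx0 oppr0.
  + by rewrite trmx_mul std_form_skew mulNmx hy1.
  + by rewrite linearZ /= trmx_mul std_form_skew mulmxN hy2 scalerN.
- rewrite /offdiag_emb sigma0E scale_block_mx !(mulmx0, mul0mx, scaler0, oppr0).
  rewrite scalerA mulrNN ss scale1r (mulmxA S y S) std_mulr opprK.
  by rewrite -scalemxAr -scalemxAl std_mull mulNmx scalerN scaleNr opprK.
- rewrite /offdiag_emb sigma1E scale_block_mx !(mulmx0, mul0mx, scaler0, oppr0).
  rewrite scalerA mulrN ss scaleN1r (mulmxA S y S) std_mulr.
  by rewrite -scalemxAr -scalemxAl std_mull mulNmx scalerN scaleNr opprK.
Qed.

(** A uniform access to all degrees: an equivariant copy of sp if both are even, of P otherwise. *)
Lemma gdot_emb p q : exists e : {linear 'M[C]_n -> 'M[C]_N},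
  [/\ injective e,
      forall a y, a \in adj_eigen S (-1) -> comm (diag_emb a) (e y) = e (comm a y) &
      gdot R l p q = (linfun e @: adj_eigen S (if odd `|p|%N || odd `|q|%N then 1 else -1))%VS].
Proof.
have [pq|pq] := eqVneq (odd `|p|%N) (odd `|q|%N).
  exists (@diag_emb R l); split; first exact: can_inj (@diag_embK R l).
    by move=> a y _; exact: comm_diag_emb.
  rewrite (gdot_diag pq); congr (_ @: adj_eigen S _)%VS; rewrite /zsign pq orbb.
  by case: odd; rewrite ?expr0 ?expr1 ?opprK.
exists (@offdiag_emb R l (zsign q)); split; first exact: offdiag_emb_inj.
  by move=> a y; exact: comm_diag_offdiag.
rewrite (gdot_offdiag pq); congr (_ @: adj_eigen S _)%VS.
by move: pq; case: odd; case: odd.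
Qed.

Lemma gdot00 : gdot R l 0 0 = (linfun (@diag_emb R l) @: adj_eigen S (-1))%VS.
Proof.
have pq : odd `|0 : int|%N = odd `|0 : int|%N by [].
by rewrite (gdot_diag pq) /zsign expr0.
Qed.

End Gradings.

(** * Weight vectors of the toroidal algebra *)

Section FiniteSupport.
Variables (K : nzRingType) (I : choiceType) (V : lmodType K).

Lemma single_at i (v : V) : (single i v : I -> V) i = v.
Proof. by rewrite /= /single_fun eqxx. Qed.

Lemma single_off i j (v : V) : j != i -> (single i v : I -> V) j = 0.
Proof. by rewrite /= /single_fun => /negPf ->. Qed.

Lemma single0 i : single i 0 = 0 :> finsupp I V.
Proof. by apply: finsuppP => j; rewrite /= /single_fun; case: eqP. Qed.

Lemma fs_sum_single (T : nmodType) (G : I -> V -> T) i v : G i 0 = 0 ->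
  fs_sum G (single i v) = G i v.
Proof.
move=> G0; rewrite /fs_sum; have [v0|v0] := eqVneq v 0.
  have -> : supp (single i v : I -> V) = set0.
    by apply/seteqP; split=> j //=; rewrite /supp /= v0 /single_fun; case: (j == i); rewrite eqxx.
  by rewrite fsbig_set0 v0 G0.
have -> : supp (single i v : I -> V) = [set i]%classic.
  apply/seteqP; split=> j; rewrite /supp /= /single_fun.
    by case: (j =P i) => // _; rewrite eqxx.
  by move=> ->; rewrite eqxx.
by rewrite fsbig_set1 single_at.
Qed.
End FiniteSupport.

Section Bracket.
Variables (R : realType) (N : nat).
Local Notation C := R[i].
Local Notation M := 'M[C]_N.
Local Notation C2 := (C^o * C^o)%type.
Variable g : {vspace M}.

Lemma killing0l x : killing g 0 x = 0.
Proof.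
by rewrite /killing big1 // => i _; rewrite comm0x linear0.
Qed.

Lemma pairing0r (c : C2) : pairing c 0 = 0.
Proof. by rewrite /pairing /= !mulr0 addr0. Qed.

Lemma cls0 : cls (0 : finsupp deg C2) = 0.
Proof. by apply: (@addrI _ (cls (0 : finsupp deg C2))); rewrite -clsD !addr0. Qed.

(** As h and the k_i sit in degree 0, the derivations kill them, and the central term of the bracket
    vanishes since d(t^0) = 0. *)
Lemma tor_bracket_cartan h (c e : C2) f (z : Kdiff R) (c' : C2) r :
  let X := tor_bracket g (tor_cartan h c e) (f, z, c') in
  [/\ (X.1.1 : deg -> M) r = comm h (f r) + pairing c r *: f r,
      X.1.2 = Kderiv_act c z & X.2 = 0].
Proof.
move=> X; split; last by [].
  rewrite -[LHS]/((fs_sum (fun a x => fs_sum (fun b y => single (a + b) (comm x y)) f)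
    (single 0 h) + deriv_act c f - deriv_act c' (single 0 h)) r).
  rewrite !fs_addE fs_oppE !deriv_actE.
  have -> : pairing c' r *: single 0 h r = 0.
    have [->|r0] := eqVneq r 0; last by rewrite single_off // scaler0.
    by rewrite pairing0r scale0r.
  rewrite subr0; congr (_ + _).
  rewrite fs_sum_single.
    rewrite (_ : (fun b y => single (0 + b) (comm h y)) = fun b y => single b (comm h y)).
      by rewrite (fs_map_sumE (F := fun _ y => comm h y)) // commx0.
    by apply/funext => b; apply/funext => y; rewrite add0r.
  rewrite /fs_sum; apply: fsbig1 => b _.
  by rewrite comm0x single0.
rewrite -[LHS]/(cls (fs_sum (fun a x => fs_sum (fun b y =>
    single (a + b) (killing g x y *: deg_vec R a)) f) (single 0 h))
  + Kderiv_act c z - Kderiv_act c' (cls (single 0 e))).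
rewrite fs_sum_single; last first.
  by rewrite /fs_sum; apply: fsbig1 => b _; rewrite killing0l scale0r single0.
have -> : fs_sum (fun b y => single (0 + b) (killing g h y *: deg_vec R 0)) f = 0.
  rewrite /fs_sum; apply: fsbig1 => b _.
  have -> : deg_vec R 0 = 0 by [].
  by rewrite scaler0 single0.
have -> : Kderiv_act c' (cls (single 0 e)) = 0.
  rewrite Kderiv_act_cls (_ : deriv_act _ _ = 0) ?cls0 //.
  apply: finsuppP => j; rewrite deriv_actE; have [->|j0] := eqVneq j 0.
    by rewrite pairing0r scale0r.
  by rewrite single_off // scaler0.
by rewrite cls0 subr0 add0r.
Qed.

Lemma Kderiv_act0 (z : Kdiff R) : Kderiv_act 0 z = 0.
Proof.
rewrite /Kderiv_act (_ : deriv_act _ _ = 0) ?cls0 //.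
by apply: finsuppP => r; rewrite deriv_actE /pairing /= !mul0r addr0 scale0r.
Qed.

Variables (s0 s1 : M -> M) (H : {vspace M}).

Lemma toroidal_weight (alpha : dual H) (u : C2) : alpha != 0 ->
  (exists X, [/\ in_toroidal g s0 s1 X, X != 0 &
     forall (h : subvs_of H) c e, tor_bracket g (tor_cartan (vsval h) c e) X
       = weight_eval ((alpha, u) : weights H) h c *: X]) <->
  exists m n : int, u = (m%:~R, n%:~R) /\ exists x, [/\ x \in grading g s0 s1 m n, x != 0 &
     forall h : subvs_of H, comm (vsval h) x = (alpha h : C) *: x].
Proof.
(* Bracketing with [h0] alone kills the central and the derivation part of X, yet multiplies them by
   the nonzero number alpha(h0). *)
move=> a0; have [h0 ah0] : exists h, alpha h != 0.
  apply: contrapT => hn; move/negP: a0; apply; apply/eqP/lfunP => h.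
  by rewrite zero_lfunE; apply: contrapT => /eqP hh; apply: hn; exists h.
split=> [[[[f z] c'] [[hf _] X0 hX]]|[m [n [-> [x [xg x0 hx]]]]]].
  have wE (h : subvs_of H) : weight_eval ((alpha, u) : weights H) h 0 = alpha h.
    by rewrite /weight_eval /= !mulr0 !addr0.
  have w0 (c : C2) : weight_eval ((alpha, u) : weights H) 0 c = u.1 * c.1 + u.2 * c.2.
    by rewrite /weight_eval /= linear0 add0r.
  have fE h c r : comm (vsval h) (f r) + pairing c r *: f r =
      weight_eval ((alpha, u) : weights H) h c *: f r.
    have [<- _ _] := tor_bracket_cartan (vsval h) c 0 f z c' r.
    by rewrite hX.
  have c'0 : c' = 0.
    have [_ _ ] := tor_bracket_cartan (vsval h0) 0 0 f z c' 0.
    rewrite hX wE /= => /eqP; case: (c') => c1 c2.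
    by rewrite scaler_eq0 (negPf ah0) => /eqP.
  have z0 : z = 0.
    have [_ + _] := tor_bracket_cartan (vsval h0) 0 0 f z c' 0.
    by rewrite hX wE Kderiv_act0 => /eqP; rewrite scaler_eq0 (negPf ah0) => /eqP.
  have [r fr] : exists r, f r != 0.
    apply: contrapT => hn; move/negP: X0; apply; apply/eqP.
    rewrite c'0 z0 (_ : f = 0) //; apply: finsuppP => r.
    by apply: contrapT => /eqP hh; apply: hn; exists r.
  (* Bracketing with derivations alone multiplies [f r] by its degree, so u is read off at c = (1,
     0) and (0, 1). *)
  have uE (c : C2) : pairing c r = u.1 * c.1 + u.2 * c.2.
    have := fE 0 c r; rewrite w0 linear0 comm0x add0r => /eqP.
    by rewrite -subr_eq0 -scalerBl scaler_eq0 (negPf fr) orbF subr_eq0 => /eqP.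
  exists r.1, r.2; split.
    have := uE (1, 0); have := uE (0, 1); rewrite /pairing /=.
    rewrite !mul1r !mul0r !mulr0 !mulr1 !addr0 !add0r => -> ->.
    by case: (u).
  exists (f r); split=> //; first by have := hf r.1 r.2; case: (r) fr.
  move=> h; have := fE h 0 r; rewrite wE /pairing /= !mul0r addr0 scale0r addr0.
  by [].
exists (single (m, n) x, 0, 0); split.
- split=> /=.
    move=> p q; rewrite /single_fun; case: eqP => [[-> ->] //|_].
    exact: mem0v.
  exists 0; first by rewrite cls0.
  by move=> r; rewrite eqxx.
- apply/eqP => /(congr1 (fun X : toroidal R N => X.1.1 (m, n))) /=.
  by rewrite /single_fun eqxx => /eqP; rewrite (negPf x0).
move=> h c e; have XE := tor_bracket_cartan (vsval h) c e (single (m, n) x) 0 0.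
case EX: (tor_bracket _ _ _) => [[f' z'] c'']; rewrite EX /= in XE.
congr (_, _, _).
- apply: finsuppP => r; have [-> _ _] := XE r; rewrite fs_scaleE.
  have [->|rmn] := eqVneq r (m, n).
    rewrite single_at /single_fun eqxx hx -scalerDl; congr (_ *: _).
    by rewrite /weight_eval /pairing /= mulrC [c.2 * _]mulrC addrA.
  by rewrite single_off // /single_fun (negPf rmn) commx0 !scaler0 addr0.
- have [_ -> _] := XE 0; rewrite scaler0.
  rewrite -cls0 Kderiv_act_cls (_ : deriv_act c 0 = 0) //.
  by apply: finsuppP => r; rewrite deriv_actE scaler0.
- by have [_ _ ->] := XE 0; rewrite scaler0.
Qed.

End Bracket.

(** * Roots of the twisted toroidal algebra *)

Section Modules.
Variables (R : realType) (l : nat).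
Hypothesis hl : (2 <= l)%N.
Local Notation C := R[i].
Local Notation n := (2 * l)%N.
Local Notation S := (std_form C l).
Local Notation N := (n + n)%N.
Local Notation sp := (adj_eigen S (-1)).
Local Notation P0 := (adj_sym0 S).

Let l_gt0 : (0 < l)%N := ltnW hl.
Let n_gt2 : (2 < n)%N. Proof. lia. Qed.
Let n_gt0 : (0 < n)%N. Proof. lia. Qed.
Let Su : S \in unitmx := std_form_unit C l.
Let Ssk : S^T = - S := std_form_skew C l.

Let E : {linear 'M[C]_n -> 'M[C]_N} := @diag_emb R l.
Let r0 : {linear 'M[C]_N -> 'M[C]_n} := (@lsubmx C n n n \o @usubmx C n n N).
Let e0K : cancel E r0 := @diag_embK R l.
Let e0_comm x y : comm (E x) (E y) = E (comm x y) := comm_diag_emb x y.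

Lemma gdot00_simple : is_simple_lie (gdot R l 0 0).
Proof.
rewrite (gdot00 R l_gt0).
exact: (simple_img e0K e0_comm (sp_simple Su Ssk n_gt0)).
Qed.

(** P has dimension (n^2 - n)/2 with n = 2l, and the scalar matrices account for 1. *)
Lemma dim_adj_sym0 : \dim P0 = (2 * l ^ 2 - l - 1)%N.
Proof.
have [PE /directv_addP dir] := adj_sym_split Su n_gt0.
have one0 : (1%:M : 'M[C]_n) != 0.
  by apply/eqP => /matrixP/(_ (Ordinal n_gt0) (Ordinal n_gt0))/eqP; rewrite !mxE eqxx oner_eq0.
have dP : \dim (adj_eigen S 1) = (\dim P0).+1.
  by rewrite PE dimv_disjoint_sum // dim_vline one0.
have two0 : 2 != 0 :> C by rewrite pnatr_eq0.
have := @dim_adj_eigen C n S Su (-1) _ _ two0 1 _.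
rewrite scaleN1r mulrNN !mulr1 mul1r => /(_ Ssk erefl erefl).
rewrite dP => h.
have : (2 * (\dim P0).+1 + n)%:R = (n * n)%:R :> C.
  by rewrite natrD [(2 * _)%:R]natrM h [(n * n)%:R]natrM; field.
move/eqP; rewrite eqr_nat => /eqP; move: (\dim P0) => d; nia.
Qed.

Lemma adj_sym0_irreducible : is_irreducible_module sp P0.
Proof.
split; first by move=> x y; exact: adj_sym_stable.
  by move=> h; have := dim_adj_sym0; rewrite h dimv0; nia.
by move=> W; exact: adj_sym0_irr.
Qed.

(** The trivial summand is the image of the scalar matrices. *)
Lemma gdot_odd_split (p q : int) : odd `|p|%N || odd `|q|%N ->
  exists T W : {vspace 'M[C]_N},
    [/\ gdot R l p q = (T + W)%VS /\ directv (T + W),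
        \dim T = 1%N /\ is_trivial_module (gdot R l 0 0) T &
        \dim W = (2 * l ^ 2 - l - 1)%N /\ is_irreducible_module (gdot R l 0 0) W].
Proof.
move=> pq; have [e [e_inj e_eq ->]] := gdot_emb R l_gt0 p q; rewrite pq.
have e_eq' a y : a \in sp -> comm (diag_emb a) (e y) = e (comm a y) := e_eq a y.
have [PE dir] := adj_sym_split Su n_gt0.
have one0 : (1%:M : 'M[C]_n) != 0.
  by apply/eqP => /matrixP/(_ (Ordinal n_gt0) (Ordinal n_gt0))/eqP; rewrite !mxE eqxx oner_eq0.
exists (linfun e @: <[1%:M]>)%VS, (linfun e @: P0)%VS; rewrite (gdot00 R l_gt0); split; split.
- by rewrite PE limgD.
- exact: directv_img.
- by rewrite dim_lin_img // dim_vline one0.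
- apply: (trivial_img e_eq') => x _ xs /vlineP[k ->].
  by rewrite commZr commE mulmx1 mul1mx subrr scaler0.
- by rewrite dim_lin_img // dim_adj_sym0.
- exact: (irreducible_img e_inj e_eq' adj_sym0_irreducible).
Qed.

Section Cartan.
Variable H : {vspace 'M[C]_N}.
Variable P : 'M[C]_n.
Hypothesis Pu : P \in unitmx.
Local Notation cj x := (P *m x *m invmx P).
Hypothesis formP : forall i j, ((P *m S *m P^T) i j != 0) = (j == rev_ord i).
Hypothesis memH : forall x, reflect
  (exists2 a, x = diag_emb a & (a \in sp) && is_diag_mx (cj a)) (x \in H).
Implicit Types (alpha : dual H).
Local Notation theta := (theta r0 P H).
Local Notation so := (so_algebra R l).


Lemma torus_trace (h h' : subvs_of H) :
  \tr (ulsubmx (vsval h) *m ulsubmx (vsval h')) = \sum_i theta i h * theta i h'.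
Proof.
rewrite (cj_trace Pu) !(torus_repr e0K memH) mul_diag_mx /mxtrace.
by apply: eq_bigr => i _; rewrite mxE [X in X * _]mxE [X in _ * X]mxE mxE eqxx mulr1n.
Qed.

Lemma killing_gdot00 (h h' : subvs_of H) :
  killing (gdot R l 0 0) (vsval h) (vsval h') =
  (n%:R + 2) * \sum_i theta i h * theta i h'.
Proof.
rewrite -torus_trace.
have /memH[a ha /andP[sa _]] := subvsP h; have /memH[b hb /andP[sb _]] := subvsP h'.
rewrite (gdot00 R l_gt0) ha hb (killing_img e0K e0_comm) //; last first.
  by move=> x y; exact: comm_adj_eigen.
rewrite (killing_adj_skew Su (e := -1)) ?scaleN1r ?mulrNN ?mulr1 ?pnatr_eq0 //.
by rewrite mulrN1 opprK !diag_embK.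
Qed.

(** The symmetric form that so preserves, which brings so under the general Killing form computation
    with e = 1. *)
Definition swap_form : 'M[C]_N := block_mx 0 1%:M 1%:M 0.

Lemma swap_form_sq : swap_form *m swap_form = 1%:M.
Proof.
rewrite /swap_form mulmx_block !(mul0mx, mulmx0, add0r, addr0) mulmx1.
by rewrite -scalar_mx_block.
Qed.

Lemma so_adj_eigen : so = adj_eigen swap_form (-1).
Proof.
have [Ju _] := mulmx1_unit swap_form_sq.
apply/vspaceP => X; apply/so_algebraP/(adj_eigenN1P Ju).
  case=> a [b [c [-> hb hc]]]; rewrite /swap_form tr_block_mx !mulmx_block.
  rewrite !(mul0mx, mulmx0, add0r, addr0, mulmx1, mul1mx) add_block_mx hb hc.
  by rewrite linearN /= trmxK !subrr addNr -[RHS]block_mx_const.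
rewrite -[X]submxK; move: (ulsubmx X) (ursubmx X) (dlsubmx X) (drsubmx X) => a b c d.
rewrite /swap_form tr_block_mx !mulmx_block.
rewrite !(mul0mx, mulmx0, add0r, addr0, mulmx1, mul1mx) add_block_mx.
rewrite -[RHS]block_mx_const => /eq_block_mx[hb _ hd hc]; exists a, b, c.
split; last 2 first.
- by apply/eqP; rewrite -addr_eq0 addrC; apply/eqP.
- by apply/eqP; rewrite -addr_eq0 addrC; apply/eqP.
by congr (block_mx _ _ _ _); apply/eqP; rewrite -addr_eq0; apply/eqP.
Qed.

(** The factor N - 2 belongs to so_N; the factor 2 appears because the blocks a and -a^T contribute
    equally to the trace. *)
Lemma killing_so (h h' : subvs_of H) :
  killing so (vsval h) (vsval h') =
  ((N%:R - 2) * 2) * \sum_i theta i h * theta i h'.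
Proof.
rewrite -torus_trace.
have /memH[a ha /andP[sa _]] := subvsP h; have /memH[b hb /andP[sb _]] := subvsP h'.
have [Ju _] := mulmx1_unit swap_form_sq.
have Jt : swap_form^T = 1 *: swap_form.
  by rewrite scale1r /swap_form tr_block_mx !trmx0 !trmx1.
rewrite ha hb so_adj_eigen (killing_adj_skew Ju Jt) ?mulr1 ?pnatr_eq0 //; last 2 first.
- by rewrite -so_adj_eigen diag_emb_so.
- by rewrite -so_adj_eigen diag_emb_so.
rewrite -mulrA !diag_embK; congr (_ * _).
rewrite /diag_emb mulmx_block !(mul0mx, mulmx0, add0r, addr0) mxtrace_block.
rewrite mulNmx mulmxN opprK -trmx_mul mxtrace_tr [\tr (b *m a)]mxtrace_mulC.
by rewrite mulr_natl mulr2n.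
Qed.

Lemma weightP (p q : int) alpha :
  (exists x, [/\ x \in gdot R l p q, x != 0 &
     forall h : subvs_of H, comm (vsval h) x = (alpha h : C) *: x]) <->
  exists i j, ((odd `|p|%N || odd `|q|%N) -> j != rev_ord i) /\ alpha = theta i - theta j.
Proof.
have [e [e_inj e_eq ->]] := gdot_emb R l_gt0 p q.
set c := if _ then _ else _.
have cc : c * c = 1 by rewrite /c; case: ifP; rewrite ?mulrNN mulr1.
have e_eq' a y : a \in sp -> y \in adj_eigen S c -> comm (diag_emb a) (e y) = e (comm a y).
  by move=> sa _; exact: e_eq.
have wP := is_weightP e0K Pu Su Ssk formP memH cc e_inj e_eq' alpha.
have cP : c = 1 <-> odd `|p|%N || odd `|q|%N.
  rewrite /c; case: ifP => // _; split=> // /eqP.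
  by rewrite eq_sym -subr_eq0 opprK -(natrD _ 1 1) pnatr_eq0.
split=> [[x [/mem_lin_img[y -> yS] x0 hx]]|[i [j [hij aE]]]].
  have /wP[i [j [hij aE]]] : is_weight S c e alpha.
    by exists y; split=> //; apply: contraNneq x0 => ->; rewrite linear0.
  by exists i, j; split=> // /cP.
have /wP[y [yS y0 hy]] : exists i j, (c = 1 -> j != rev_ord i) /\ alpha = theta i - theta j.
  by exists i, j; split=> // /cP.
exists (e y); split; [by rewrite mem_lin_img_inj| |by []].
by apply: contra y0 => /eqP ey; apply/eqP; apply: e_inj; rewrite ey linear0.
Qed.

Lemma lie_rootsP alpha : lie_roots (gdot R l 0 0) H alpha <->
  exists i j, i != j /\ alpha = theta i - theta j.
Proof.
(* The condition [alpha != 0] of [lie_roots] compares functions, not linear maps. *)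
split=> [[a0 /weightP[i [j [_ aE]]]]|[i [j [ij aE]]]].
  exists i, j; split=> //; apply/eqP => ij; move/eqP: a0; apply; apply/funext => h.
  by rewrite aE ij sub_lfunE subrr.
split; last by apply/weightP; exists i, j.
apply/eqP => a0; have := theta_sub_neq0 e0K Pu Su formP memH ij; rewrite -aE => /eqP; apply.
by apply/lfunP => h; rewrite zero_lfunE a0.
Qed.

Let kappa_gt0 : 0 < n%:R + 2 :> C.
Proof. by rewrite -natrD ltr0n addn2. Qed.

Lemma shortP alpha : short_roots (gdot R l 0 0) H alpha <->
  exists i j, [/\ i != j, j != rev_ord i & alpha = theta i - theta j].
Proof. exact: (short_rootP e0K Pu Su formP memH kappa_gt0 killing_gdot00 lie_rootsP alpha hl). Qed.

Lemma longP alpha : long_roots (gdot R l 0 0) H alpha <->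
  exists i, alpha = theta i - theta (rev_ord i).
Proof. exact: (long_rootP e0K Pu Su formP memH kappa_gt0 killing_gdot00 lie_rootsP alpha l_gt0). Qed.

Lemma gdot00_type_C : has_root_type_C (gdot R l 0 0) H l.
Proof. exact: (root_type_C e0K Pu Su formP memH kappa_gt0 killing_gdot00 lie_rootsP). Qed.

Let kappa_so_neq0 : (N%:R - 2) * 2 != 0 :> C.
Proof.
rewrite mulf_neq0 ?pnatr_eq0 // subr_eq0 eqr_nat; lia.
Qed.

Lemma weight_form_theta i j : i != j -> dual_form so H (theta i - theta j) (theta i - theta j) != 0.
Proof.
move=> ij; rewrite (dual_form_root_sq e0K Pu Su formP memH kappa_so_neq0 killing_so) //.
by rewrite mulf_neq0 ?invr_eq0 // -(natrD _ 1) pnatr_eq0.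
Qed.

Lemma weight_form0 : dual_form so H 0 0 = 0.
Proof.
by rewrite (dual_formE e0K Pu Su formP memH kappa_so_neq0 killing_so) zero_lfunE.
Qed.

(** Non-isotropic here means nonzero on H: the zero functional is isotropic, and every nonzero
    theta_i - theta_j is not. *)
Lemma toroidal_rootsP (beta : weights H) :
  toroidal_roots so (@sigma0 R l) (@sigma1 R l) H beta <->
  exists i j (m p : int), [/\ i != j, (odd `|m|%N || odd `|p|%N) -> j != rev_ord i &
    beta = (theta i - theta j, (m%:~R, p%:~R))].
Proof.
case: beta => alpha u; split.
  case; rewrite /weight_form /= => f0.
  have a0 : alpha != 0 by apply: contraNneq f0 => ->; rewrite weight_form0.
  case/(toroidal_weight _ _ _ u a0) => m [p [-> /weightP[i [j [hij aE]]]]].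
  exists i, j, m, p; split=> //; last by rewrite aE.
  apply/eqP => ij; move/eqP: a0; apply; rewrite aE ij.
  by apply/lfunP => h; rewrite sub_lfunE subrr zero_lfunE.
case=> i [j [m [p [ij hij [aE ->]]]]]; rewrite aE; split.
  exact: weight_form_theta.
have a0 : theta i - theta j != 0 by rewrite (theta_sub_neq0 e0K Pu Su formP memH).
apply/(toroidal_weight _ _ _ _ a0); exists m, p; split=> //.
by apply/weightP; exists i, j.
Qed.

Lemma weight_degE alpha (m p : int) :
  weight_of (R := R) alpha + delta0 H *~ m + delta1 H *~ p = (alpha, (m%:~R, p%:~R)).
Proof.
have mulnE (V W : zmodType) (x : V) (y : W) (k : nat) : (x, y) *+ k = (x *+ k, y *+ k).
  by elim: k => // k IH; rewrite !mulrS IH.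
have mulzE (V W : zmodType) (x : V) (y : W) (k : int) : (x, y) *~ k = (x *~ k, y *~ k).
  by case: k => k; [exact: mulnE|rewrite NegzE !mulrNz -!pmulrn mulnE].
rewrite /weight_of /delta0 /delta1 !mulzE !mul0rz; congr (_, (_, _)) => /=.
- by rewrite !addr0.
- by rewrite add0r addr0.
- by rewrite !add0r.
Qed.

End Cartan.

Local Open Scope classical_set_scope.

Lemma cartan_roots (H : {vspace 'M[C]_N}) : is_cartan (gdot R l 0 0) H ->
  has_root_type_C (gdot R l 0 0) H l /\
  toroidal_roots (so_algebra R l) (@sigma0 R l) (@sigma1 R l) H =
    [set b | exists a (m n : int), short_roots (gdot R l 0 0) H a /\
       b = weight_of a + delta0 H *~ m + delta1 H *~ n]
    `|`
    [set b | exists a (m n : int), long_roots (gdot R l 0 0) H a /\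
       b = weight_of a + delta0 H *~ (2 * m) + delta1 H *~ (2 * n)].
Proof.
move=> Hcar; have := Hcar; rewrite {1}(gdot00 R l_gt0).
move=> /(cartan_pre e0K e0_comm)[].
set H' := (_ @^-1: H)%VS => Hcar' HE.
have [P [Pu formP hP]] := cartan_normal_form n_gt0 Su Ssk Hcar'.
have memH x : reflect (exists2 a, x = diag_emb a & (a \in sp) && is_diag_mx (P *m a *m invmx P))
    (x \in H).
  by rewrite HE; apply: (iffP (mem_lin_img _ _ _)) => -[a -> ha]; exists a; rewrite // ?hP // -hP.
split; first exact: (gdot00_type_C Pu formP memH).
apply/seteqP; split=> b.
  move=> /(toroidal_rootsP Pu formP memH)[i [j [m [p [ij hij ->]]]]].
  (* A root with j = rev i is long and occurs only if both degrees are even; any other root is short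
     and occurs in every degree. *)
  have [ji|ji] := eqVneq j (rev_ord i); last first.
    left; exists (theta r0 P H i - theta r0 P H j), m, p.
    rewrite weight_degE; split; last by [].
    by apply/(shortP Pu formP memH); exists i, j.
  right; have /norP[me pe] : ~~ (odd `|m|%N || odd `|p|%N).
    by apply/negP => /hij; rewrite ji eqxx.
  have half (k : int) : ~~ odd `|k|%N -> exists k', k = 2 * k'.
    by move=> ke; exists (k %/ 2)%Z; lia.
  have [m' ->] := half m me; have [p' ->] := half p pe.
  exists (theta r0 P H i - theta r0 P H j), m', p'.
  rewrite weight_degE; split; last by [].
  by apply/(longP Pu formP memH); exists i; rewrite ji.
case=> [[a [m [p [/(shortP Pu formP memH)[i [j [ij ji ->]]] ->]]]]|
        [a [m [p [/(longP Pu formP memH)[i ->] ->]]]]].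
  by rewrite weight_degE; apply/(toroidal_rootsP Pu formP memH); exists i, j, m, p.
rewrite weight_degE; apply/(toroidal_rootsP Pu formP memH); exists i, (rev_ord i), (2 * m), (2 * p).
split=> //; first by rewrite eq_sym rev_ord_neq.
by rewrite !abszM !oddM.
Qed.

End Modules.

Local Open Scope classical_set_scope.
Local Open Scope ring_scope.

Theorem mainTheorem6 (R : realType) (l : nat) (hl : (2 <= l)%N) :
  [/\ is_simple_lie (gdot R l 0 0),
      forall p q : int, (p, q) \in [:: (0, 1); (1, 0); (1, 1)] ->
        exists T W : {vspace 'M[R[i]]_(2 * l + 2 * l)},
          [/\ gdot R l p q = (T + W)%VS /\ directv (T + W),
              \dim T = 1%N /\ is_trivial_module (gdot R l 0 0) T &
              \dim W = (2 * l ^ 2 - l - 1)%N /\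
              is_irreducible_module (gdot R l 0 0) W] &
      forall H : {vspace 'M[R[i]]_(2 * l + 2 * l)},
        is_cartan (gdot R l 0 0) H ->
        has_root_type_C (gdot R l 0 0) H l /\
        toroidal_roots (so_algebra R l) (@sigma0 R l) (@sigma1 R l) H =
          [set b | exists a (m n : int),
             short_roots (gdot R l 0 0) H a /\
             b = weight_of a + delta0 H *~ m + delta1 H *~ n]
          `|`
          [set b | exists a (m n : int),
             long_roots (gdot R l 0 0) H a /\
             b = weight_of a + delta0 H *~ (2 * m) + delta1 H *~ (2 * n)]].
Proof.
split; [exact: gdot00_simple hl| |exact: cartan_roots hl].
by move=> p q pq; apply: (gdot_odd_split R hl); move: pq; rewrite !inE => /or3P[] /eqP[-> ->].
Qed.
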